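(* Let $\mathcal{G}$ be a strict Lie 2-group arising from a smooth crossed module $(\alpha,\beta,H,G)$, and let $M$ be a smooth manifold. Then semi-strict principal $\mathcal{G}$-2-bundles over $M$ are classified up to Morita equivalence by $\check{H}(M,\mathcal{G})$; that is, the assignment $\mathcal{P}\mapsto[z(\mathcal{P})]$ induces a well-defined bijection from the collection of Morita equivalence classes of semi-strict principal $\mathcal{G}$-2-bundles over $M$ to $\check{H}(M,\mathcal{G})$.
   Context: Manifolds are Hausdorff and modelled on locally convex spaces; Lie groups may be infinite-dimensional. Smooth crossed module: Lie groups $G,H$, a smooth homomorphism $\beta:H\to G$ and an action $\alpha$ of $G$ on $H$ by automorphisms, written $g.h$, with $G\times H\to H$ smooth, such that $\beta(g.h)=g\beta(h)g^{-1}$ and $\beta(h).h'=hh'h^{-1}$. The associated strict Lie 2-group $\mathcal{G}$ is the category with objects $G$, morphisms $H\rtimes G$, where $(h,g)$ is a morphism $g\to\beta(h)g$, composition $(h',\beta(h)g)\circ(h,g)=(h'h,g)$, identities $\mathrm{id}_g=(e,g)$, and multiplication functor given by the group multiplications of $G$ and of $H\rtimes G$, i.e. $(h,g)\cdot(h',g')=(h\,(g.h'),gg')$. Smooth 2-space: small category $\mathcal{M}$ whose sets of objects $\mathcal{M}_0$, morphisms $\mathcal{M}_1$ and composable pairs are smooth manifolds with all structure maps smooth. Smooth functors are smooth on objects and morphisms; smooth natural transformations are smooth as maps $\mathcal{M}_0\to\mathcal{M}'_1$. A manifold is regarded as a smooth 2-space with only identity morphisms. Strict $\mathcal{G}$-2-space: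 smooth 2-space $\mathcal{M}$ with a smooth functor $\mathcal{M}\times\mathcal{G}\to\mathcal{M}$, $(x,g)\mapsto x.g$, that is a right action of groups on objects and on morphisms. A morphism of strict $\mathcal{G}$-2-spaces is a smooth functor $F$ with $F(x.g)=F(x).g$ on objects and morphisms. A 2-morphism $\tau:F\Rightarrow F'$ is a smooth natural transformation with $\tau(x.g)=\tau(x).\mathrm{id}_g$. An equivalence is a morphism $F:\mathcal{M}\to\mathcal{M}'$ admitting a morphism $F':\mathcal{M}'\to\mathcal{M}$ (weak inverse) and 2-morphisms (natural isomorphisms) $F\circ F'\Rightarrow\mathrm{id}$, $F'\circ F\Rightarrow\mathrm{id}$. Semi-strict principal $\mathcal{G}$-2-bundle over $M$: a strict $\mathcal{G}$-2-space $\mathcal{P}$ with a smooth functor $\pi:\mathcal{P}\to M$ for which there are an open cover $(U_i)_{i\in I}$ of $M$ and equivalences of strict $\mathcal{G}$-2-spaces $\Phi_i:\mathcal{P}|_{U_i}\to U_i\times\mathcal{G}$ (with $\mathcal{P}|_{U_i}=\pi^{-1}(U_i)$, and $\mathcal{G}$ acting on $U_i\times\mathcal{G}$ by right multiplication on the second factor) with weak inverses $\overline{\Phi}_i$ such that $\pi|_{U_i}=\mathrm{pr}_1\circ\Phi_i$ and $\pi\circ\overline{\Phi}_i=\mathrm{pr}_1$. A semi-strict bundle morphism $\Phi:\mathcal{P}\to\mathcal{P}'$ is a morphism of strict $\mathcal{G}$-2-spaces with $\pi'\circ\Phi=\pi$. $\mathcal{P}$ and $\mathcal{P}'$ are Morita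 equivalent if there are a semi-strict principal $\mathcal{G}$-2-bundle $\overline{\mathcal{P}}$ over $M$ and semi-strict bundle morphisms $\overline{\mathcal{P}}\to\mathcal{P}$ and $\overline{\mathcal{P}}\to\mathcal{P}'$. Cocycles: multiple indices denote intersections, $U_{ij}=U_i\cap U_j$ etc. A $\mathcal{G}$-valued cocycle on $M$ is $z=(U_i,g_{ij},h_{ijk})$ with $(U_i)$ an open cover and smooth maps $g_{ij}:U_{ij}\to G$, $h_{ijk}:U_{ijk}\to H$ satisfying pointwise $\beta(h_{ijk})g_{ij}g_{jk}=g_{ik}$ on $U_{ijk}$, $h_{ikl}h_{ijk}=h_{ijl}\,(g_{ij}.h_{jkl})$ on $U_{ijkl}$, and $g_{ii}=e_G$, $h_{ijj}=h_{jji}=e_H$. Two cocycles $(U_i,g_{ij},h_{ijk})$, $(U'_{i'},g'_{i'j'},h'_{i'j'k'})$ are cohomologous (equivalent) if there are a common refinement $(V_i)_{i\in J}$ ($V_i\subseteq U_{\bar i}$, $V_i\subseteq U'_{\bar i'}$ for chosen $\bar i\in I,\bar i'\in I'$) and smooth maps $\gamma_i:V_i\to G$, $\eta_{ij}:V_{ij}\to H$ with $\gamma_i g'_{\bar i'\bar j'}=\beta(\eta_{ij})g_{\bar i\bar j}\gamma_j$ on $V_{ij}$, $\eta_{ik}h_{\bar i\bar j\bar k}=(\gamma_i.h'_{\bar i'\bar j'\bar k'})\,\eta_{ij}\,(g_{\bar i\bar j}.\eta_{jk})$ on $V_{ijk}$, and $\eta_{ii}=e_H$. $\check{H}(M,\mathcal{G})$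 is the set of equivalence classes of cocycles. The cocycle $z(\mathcal{P})$: choose an open cover $(U_i)_{i\in I}$ of $M$, equivalences of strict $\mathcal{G}$-2-spaces $\Phi_i:\mathcal{P}|_{U_i}\to U_i\times\mathcal{G}$ and weak inverses $\overline{\Phi}_i:U_i\times\mathcal{G}\to\mathcal{P}|_{U_i}$ with $\pi|_{U_i}=\mathrm{pr}_1\circ\Phi_i$, $\pi\circ\overline{\Phi}_i=\mathrm{pr}_1$ and $\Phi_i\circ\overline{\Phi}_i=\mathrm{id}$, and 2-morphisms $\overline{\tau}_i:\overline{\Phi}_i\circ\Phi_i\Rightarrow\mathrm{id}_{\mathcal{P}|_{U_i}}$, normalised so that $\Phi_i(\overline{\tau}_i(p))$ is an identity for every object $p$. Define $g_{ij}$ by $\Phi_j(\overline{\Phi}_i(x,e))=(x,g_{ij}(x)^{-1})$ for $x\in U_{ij}$, and $h_{ijk}$ by $\Phi_k(\overline{\tau}_j(\overline{\Phi}_i(x,e)))=\bigl(x,\bigl(g_{ik}(x)^{-1}.h_{ijk}(x)^{-1},(g_{ij}(x)g_{jk}(x))^{-1}\bigr)\bigr)$ for $x\in U_{ijk}$. Then $z(\mathcal{P})=(U_i,g_{ij},h_{ijk})$. *)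

(* Defs.v *)
From HB Require Import structures.
From mathcomp Require Import all_boot all_order all_algebra.
From mathcomp Require Import all_classical all_reals all_analysis.
Set Implicit Arguments.
Unset Strict Implicit.
Unset Printing Implicit Defensive.
Import Order.TTheory GRing.Theory Num.Theory.
Import numFieldNormedType.Exports.

Local Open Scope classical_set_scope.
Local Open Scope ring_scope.

(* Michal-Bastiani calculus: [f] is C^0 on the open set [U] when it is
   continuous there, and C^(n+1) when moreover all directional derivatives
   [df (x, v)] exist for [x] in [U] and [df] is C^n on [U * E]. *)
Fixpoint Cn_on (R : realType) (n : nat) (E F : tvsType R) (U : set E)
    (f : E -> F) : Prop :=
  (forall x, U x -> {for x, continuous f}) /\
  (if n is m.+1 then
     exists2 df : E * E -> F,
       (forall x v, U x ->
          (fun t : R => t^-1 *: (f (x + t *: v) - f x)) @ 0^' --> df (x, v)) &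
       Cn_on m (U `*` [set: E]) df
   else True).

Definition Cinfty_on (R : realType) (E F : tvsType R) (U : set E)
    (f : E -> F) : Prop :=
  forall n, Cn_on n U f.

(* Only the restriction of [chart_map] to [chart_dom] is meaningful. *)
Record chart (R : realType) (M : topologicalType) := Chart {
  chart_model : tvsType R ;
  chart_dom : set M ;
  chart_map :> M -> chart_model }.

Definition chart_axiom (R : realType) (M : topologicalType) (c : chart R M) :=
  [/\ hausdorff_space (chart_model c),
      open (chart_dom c),
      set_inj (chart_dom c) c,
      forall x, chart_dom c x -> {for x, continuous (c : M -> _)} &
      forall V, V `<=` chart_dom c -> open V -> open (c @` V)].

(* [d \o f \o c^-1] is smooth where it is defined; the map [F] below is a total
   extension of it. *)
Definition smooth_in_charts (R : realType) (M N : topologicalType)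
    (c : chart R M) (d : chart R N) (f : M -> N) : Prop :=
  let D := chart_dom c `&` f @^-1` chart_dom d in
  exists2 F : chart_model c -> chart_model d,
    (forall x, D x -> F (c x) = d (f x)) & Cinfty_on (c @` D) F.

HB.mixin Record hasAtlas (R : realType) M of Topological M := {
  atlas : chart R M -> Prop }.

#[short(type="chartedType")]
HB.structure Definition Charted (R : realType) :=
  {M of Topological M & hasAtlas R M}.

Definition smooth (R : realType) (M N : chartedType R) (f : M -> N) : Prop :=
  continuous f /\
  forall (c : chart R M) (d : chart R N), atlas c -> atlas d ->
    smooth_in_charts c d f.

Definition smooth_manifold (R : realType) (M : chartedType R) : Prop :=
  [/\ hausdorff_space M,
      forall c : chart R M, atlas c -> chart_axiom c,
      forall x : M, exists2 c : chart R M, atlas c & chart_dom c x &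
      forall c d : chart R M, atlas c -> atlas d -> smooth_in_charts c d id].

HB.mixin Record Charted_isManifold (R : realType) M of Charted R M := {
  manifoldP : smooth_manifold M }.

#[short(type="manifoldType")]
HB.structure Definition Manifold (R : realType) :=
  {M of Charted R M & Charted_isManifold R M}.

Definition prod_chart (R : realType) (M N : topologicalType)
    (c : chart R M) (d : chart R N) : chart R (M * N)%type :=
  @Chart R (M * N)%type (chart_model c * chart_model d)%type
    (chart_dom c `*` chart_dom d) (fun x => (c x.1, d x.2)).

HB.instance Definition _ (R : realType) (M N : chartedType R) :=
  hasAtlas.Build R (M * N)%type (fun e =>
    exists (c : chart R M) (d : chart R N),
      [/\ atlas c, atlas d & e = prod_chart c d]).

Definition sub_chart (R : realType) (M : topologicalType) (U : set M)
    (c : chart R M) : chart R (set_type U) :=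
  @Chart R (set_type U) (chart_model c) (set_val @^-1` chart_dom c)
    (fun x => c (set_val x)).

HB.instance Definition _ (R : realType) (M : chartedType R) (U : set M) :=
  hasAtlas.Build R (set_type U) (fun e =>
    exists2 c : chart R M, atlas c & e = sub_chart U c).

(* Maps on an open subset [U] of [M] are represented by total maps on [M] whose
   values outside of [U] are irrelevant. *)
Definition smooth_on (R : realType) (M N : chartedType R) (U : set M)
    (f : M -> N) : Prop :=
  smooth (fun x : set_type U => f (set_val x)).

Definition open_cover (M : topologicalType) (I : Type) (U : I -> set M) : Prop :=
  (forall i, open (U i)) /\ \bigcup_i U i = [set: M].

#[short(type="chartedGroupType")]
HB.structure Definition ChartedGroup (R : realType) :=
  {G of Group G & Charted R G}.

HB.mixin Record ChartedGroup_isLieGroup (R : realType) G of ChartedGroup R G := {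
  mulg_smooth : smooth (fun x : G * G => (x.1 * x.2)%g) ;
  invg_smooth : smooth (fun x : G => (x^-1)%g) }.

#[short(type="lieGroupType")]
HB.structure Definition LieGroup (R : realType) :=
  {G of ChartedGroup R G & Manifold R G & ChartedGroup_isLieGroup R G}.

Record crossed_module (R : realType) := CrossedModule {
  cmG : lieGroupType R ;
  cmH : lieGroupType R ;
  cm_beta : cmH -> cmG ;
  cm_act : cmG -> cmH -> cmH ;
  cm_beta_smooth : smooth cm_beta ;
  cm_betaM : forall h h', cm_beta (h * h')%g = (cm_beta h * cm_beta h')%g ;
  cm_act_smooth : smooth (fun x : cmG * cmH => cm_act x.1 x.2) ;
  cm_act1 : forall h, cm_act 1%g h = h ;
  cm_actM : forall g g' h, cm_act (g * g')%g h = cm_act g (cm_act g' h) ;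
  cm_actMr : forall g h h', cm_act g (h * h')%g = (cm_act g h * cm_act g h')%g ;
  cm_beta_act : forall g h, cm_beta (cm_act g h) = (g * cm_beta h * g^-1)%g ;
  cm_peiffer : forall h h', cm_act (cm_beta h) h' = (h * h' * h^-1)%g }.

Local Open Scope group_scope.

#[local] Obligation Tactic := try by [].

Lemma cm_beta1 (R : realType) (X : crossed_module R) : cm_beta (1 : cmH X) = 1.
Proof. by apply: (@mulgI _ (cm_beta (1 : cmH X))); rewrite -cm_betaM !mulg1. Qed.

Lemma cm_actr1 (R : realType) (X : crossed_module R) (g : cmG X) :
  cm_act g (1 : cmH X) = 1.
Proof. by apply: (@mulgI _ (cm_act g (1 : cmH X))); rewrite -cm_actMr !mulg1. Qed.

Definition sdmul (R : realType) (X : crossed_module R) (a b : cmH X * cmG X) :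
    cmH X * cmG X :=
  (a.1 * cm_act a.2 b.1, a.2 * b.2).

(* [cmp f g _] is the composite of [f] after [g]. *)
Record category (R : realType) := Category {
  ob : chartedType R ;
  mor : chartedType R ;
  src : mor -> ob ;
  tgt : mor -> ob ;
  idm : ob -> mor ;
  cmp : forall f g : mor, src f = tgt g -> mor ;
  src_idm : forall x, src (idm x) = x ;
  tgt_idm : forall x, tgt (idm x) = x ;
  src_cmp : forall f g (e : src f = tgt g), src (cmp e) = src g ;
  tgt_cmp : forall f g (e : src f = tgt g), tgt (cmp e) = tgt f ;
  cmp_idl : forall f (e : src (idm (tgt f)) = tgt f), cmp e = f ;
  cmp_idr : forall f (e : src f = tgt (idm (src f))), cmp e = f ;
  cmpA : forall f g h (e1 : src f = tgt g) (e2 : src g = tgt h)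
    (e3 : src f = tgt (cmp e2)) (e4 : src (cmp e1) = tgt h), cmp e3 = cmp e4 }.
Arguments src {R c}.
Arguments tgt {R c}.
Arguments idm {R c}.
Arguments cmp {R c} f g.

(* [D] is the set of composable pairs. A manifold structure on it that is
   unrelated to [mor C * mor C] would make the smoothness of the composition
   meaningless, so it is required to be the fibre product of [src] and [tgt] in
   the category of manifolds. *)
Definition smooth_2space (R : realType) (C : category R) : Prop :=
  [/\ smooth_manifold (ob C), smooth_manifold (mor C),
      smooth (@src R C), smooth (@tgt R C) & smooth (@idm R C)] /\
  exists (D : manifoldType R) (p q : D -> mor C)
      (e : forall d, src (p d) = tgt (q d)),
    [/\ forall f g, src f = tgt g -> exists! d, p d = f /\ q d = g,
        smooth p, smooth q,
        forall (N : manifoldType R) (k : N -> D),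
          smooth (p \o k) -> smooth (q \o k) -> smooth k &
        smooth (fun d => cmp (p d) (q d) (e d))].

Record functor (R : realType) (C D : category R) := Functor {
  fob : ob C -> ob D ;
  fmor : mor C -> mor D ;
  src_fmor : forall f, src (fmor f) = fob (src f) ;
  tgt_fmor : forall f, tgt (fmor f) = fob (tgt f) ;
  fmor_idm : forall x, fmor (idm x) = idm (fob x) ;
  fmor_cmp : forall f g (e : src f = tgt g) (e' : src (fmor f) = tgt (fmor g)),
    fmor (cmp f g e) = cmp (fmor f) (fmor g) e' }.

Definition smooth_functor (R : realType) (C D : category R) (F : functor C D) :=
  smooth (fob F) /\ smooth (fmor F).

Definition eq_functor (R : realType) (C D : category R) (F F' : functor C D) :=
  fob F =1 fob F' /\ fmor F =1 fmor F'.

Program Definition id_functor (R : realType) (C : category R) : functor C C :=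
  @Functor R C C id id _ _ _ _.
Next Obligation. by move=> R C f g e e' /=; congr cmp; exact: Prop_irrelevance. Qed.

Program Definition comp_functor (R : realType) (C D E : category R)
    (F : functor D E) (F' : functor C D) : functor C E :=
  @Functor R C E (fob F \o fob F') (fmor F \o fmor F') _ _ _ _.
Next Obligation. by move=> R C D E F F' f /=; rewrite !src_fmor. Qed.
Next Obligation. by move=> R C D E F F' f /=; rewrite !tgt_fmor. Qed.
Next Obligation. by move=> R C D E F F' x /=; rewrite !fmor_idm. Qed.
Next Obligation.
move=> R C D E F F' f g e /= e'.
have e1 : src (fmor F' f) = tgt (fmor F' g) by rewrite src_fmor tgt_fmor e.
by rewrite (fmor_cmp e e1) (fmor_cmp e1 e').
Qed.

Program Definition disc (R : realType) (M : chartedType R) : category R :=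
  @Category R M M id id id (fun f _ _ => f) _ _ _ _ _ _ _.

Program Definition prod_category (R : realType) (C D : category R) : category R :=
  @Category R (ob C * ob D)%type (mor C * mor D)%type
    (fun f => (src f.1, src f.2)) (fun f => (tgt f.1, tgt f.2))
    (fun x => (idm x.1, idm x.2))
    (fun f g e => (cmp f.1 g.1 (congr1 fst e), cmp f.2 g.2 (congr1 snd e)))
    _ _ _ _ _ _ _.
Next Obligation. by move=> R C D [x y] /=; rewrite !src_idm. Qed.
Next Obligation. by move=> R C D [x y] /=; rewrite !tgt_idm. Qed.
Next Obligation. by move=> R C D f g e /=; rewrite !src_cmp. Qed.
Next Obligation. by move=> R C D f g e /=; rewrite !tgt_cmp. Qed.
Next Obligation. by move=> R C D [f1 f2] e /=; rewrite !cmp_idl. Qed.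
Next Obligation. by move=> R C D [f1 f2] e /=; rewrite !cmp_idr. Qed.
Next Obligation.
by move=> R C D f g h e1 e2 e3 e4 /=; congr pair; exact: cmpA.
Qed.

Program Definition lie2group (R : realType) (X : crossed_module R) : category R :=
  @Category R (cmG X) (cmH X * cmG X)%type
    snd (fun a => cm_beta a.1 * a.2) (fun g => (1, g))
    (fun a b _ => (a.1 * b.1, b.2)) _ _ _ _ _ _ _.
Next Obligation. by move=> R X g /=; rewrite cm_beta1 mul1g. Qed.
Next Obligation. by move=> R X a b /= ->; rewrite cm_betaM mulgA. Qed.
Next Obligation. by move=> R X [h g] e /=; rewrite mul1g. Qed.
Next Obligation. by move=> R X [h g] e /=; rewrite mulg1. Qed.
Next Obligation. by move=> R X f g h e1 e2 e3 e4 /=; rewrite mulgA. Qed.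

Record g2space (R : realType) (X : crossed_module R) := G2Space {
  g2carrier :> category R ;
  g2act : functor (prod_category g2carrier (lie2group X)) g2carrier ;
  g2act_ob1 : forall x, fob g2act (x, 1) = x ;
  g2act_obM : forall x (g g' : cmG X),
    fob g2act (x, g * g') = fob g2act (fob g2act (x, g), g') ;
  g2act_mor1 : forall f, fmor g2act (f, (1, 1)) = f ;
  g2act_morM : forall f (a a' : cmH X * cmG X),
    fmor g2act (f, sdmul a a') = fmor g2act (fmor g2act (f, a), a') }.

Definition smooth_g2space (R : realType) (X : crossed_module R)
    (P : g2space X) : Prop :=
  smooth_2space P /\ smooth_functor (g2act P).

Section G2Morphisms.
Variables (R : realType) (X : crossed_module R).
Implicit Types P Q : g2space X.

Definition g2morphism P Q (F : functor P Q) : Prop :=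
  [/\ smooth_functor F,
      forall x g, fob F (fob (g2act P) (x, g)) = fob (g2act Q) (fob F x, g) &
      forall f a, fmor F (fmor (g2act P) (f, a)) = fmor (g2act Q) (fmor F f, a)].

Definition is_2morphism P Q (F F' : functor P Q) (tau : ob P -> mor Q) : Prop :=
  [/\ smooth tau,
      forall x, src (tau x) = fob F x /\ tgt (tau x) = fob F' x,
      forall f (e : src (tau (tgt f)) = tgt (fmor F f))
          (e' : src (fmor F' f) = tgt (tau (src f))),
        cmp (tau (tgt f)) (fmor F f) e = cmp (fmor F' f) (tau (src f)) e' &
      forall x g,
        tau (fob (g2act P) (x, g)) = fmor (g2act Q) (tau x, (1, g))].

Definition iso (C : category R) (f : mor C) : Prop :=
  exists (g : mor C) (e : src f = tgt g) (e' : src g = tgt f),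
    cmp f g e = idm (tgt f) /\ cmp g f e' = idm (src f).

Definition is_2isomorphism P Q (F F' : functor P Q) (tau : ob P -> mor Q) : Prop :=
  is_2morphism F F' tau /\ forall x, iso (tau x).

Definition weak_inverse P Q (F : functor P Q) (F' : functor Q P) : Prop :=
  [/\ g2morphism F',
      exists tau, is_2isomorphism (comp_functor F F') (id_functor Q) tau &
      exists tau, is_2isomorphism (comp_functor F' F) (id_functor P) tau].

End G2Morphisms.

Section TrivialG2Space.
Variables (R : realType) (X : crossed_module R) (M : chartedType R).

Let C := prod_category (disc M) (lie2group X).

Program Definition triv_act : functor (prod_category C (lie2group X)) C :=
  @Functor R (prod_category C (lie2group X)) C
    (fun y => (y.1.1, y.1.2 * y.2)) (fun f => (f.1.1, sdmul f.1.2 f.2))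
    _ _ _ _.
Next Obligation.
move=> [[x [h g]] [h' g']] /=; congr pair.
by rewrite cm_betaM cm_beta_act -!mulgA (mulgA g^-1) mulVg mul1g.
Qed.
Next Obligation. by move=> [[x g] g'] /=; rewrite /sdmul /= cm_actr1 mulg1. Qed.
Next Obligation.
move=> [[x [h g]] [k l]] [[y [h' g']] [k' l']] /= e e'.
move: (e) => [exy eg el]; rewrite /sdmul /=; congr (_, (_, _)).
by rewrite eg cm_actM cm_peiffer cm_actMr -!mulgA (mulgA h'^-1) mulVg mul1g.
Qed.

Program Definition triv_g2space : g2space X :=
  @G2Space R X C triv_act _ _ _ _.
Next Obligation. by move=> [x g] /=; rewrite mulg1. Qed.
Next Obligation. by move=> [x g] g1 g2 /=; rewrite mulgA. Qed.
Next Obligation.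
by move=> [x [h g]] /=; rewrite /sdmul /= cm_actr1 !mulg1.
Qed.
Next Obligation.
move=> [x [h g]] [h1 g1] [h2 g2] /=; rewrite /sdmul /=.
by rewrite cm_actMr cm_actM !mulgA.
Qed.

End TrivialG2Space.

(* [g2proj_act] makes the full preimages of open sets stable under the action,
   hence strict 2-spaces themselves. *)
Record over_g2space (R : realType) (X : crossed_module R) (M : manifoldType R) :=
  OverG2Space {
    g2total :> g2space X ;
    g2proj : functor g2total (disc M) ;
    g2proj_act : forall x g,
      fob g2proj (fob (g2act g2total) (x, g)) = fob g2proj x }.

Section Restriction.
Variables (R : realType) (X : crossed_module R) (M : manifoldType R).
Variables (P : over_g2space X M) (U : set M).

Let ob_U : set (ob P) := fob (g2proj P) @^-1` U.
Let mor_U : set (mor P) := fmor (g2proj P) @^-1` U.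

Lemma over_src (f : mor P) : fob (g2proj P) (src f) = fmor (g2proj P) f.
Proof. by rewrite -src_fmor. Qed.

Lemma over_tgt (f : mor P) : fob (g2proj P) (tgt f) = fmor (g2proj P) f.
Proof. by rewrite -tgt_fmor. Qed.

Lemma restr_src_subproof (f : set_type mor_U) : src (set_val f) \in ob_U.
Proof. by apply/mem_set; rewrite /ob_U /= over_src; exact: (set_valP f). Qed.

Lemma restr_tgt_subproof (f : set_type mor_U) : tgt (set_val f) \in ob_U.
Proof. by apply/mem_set; rewrite /ob_U /= over_tgt; exact: (set_valP f). Qed.

Lemma restr_idm_subproof (x : set_type ob_U) : idm (set_val x) \in mor_U.
Proof. by apply/mem_set; rewrite /mor_U /= -over_src src_idm; exact: (set_valP x). Qed.

Let restr_src (f : set_type mor_U) : set_type ob_U :=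
  exist _ (src (set_val f)) (restr_src_subproof f).

Let restr_tgt (f : set_type mor_U) : set_type ob_U :=
  exist _ (tgt (set_val f)) (restr_tgt_subproof f).

Lemma restr_cmp_subproof (f g : set_type mor_U)
    (e : src (set_val f) = tgt (set_val g)) :
  cmp (set_val f) (set_val g) e \in mor_U.
Proof.
by apply/mem_set; rewrite /mor_U /= -over_src src_cmp over_src; exact: (set_valP g).
Qed.

Let restr_cmp (f g : set_type mor_U) (e : restr_src f = restr_tgt g) :
    set_type mor_U :=
  exist _ (cmp (set_val f) (set_val g) (congr1 set_val e))
    (restr_cmp_subproof (congr1 set_val e)).

Program Definition restr_category : category R :=
  @Category R (set_type ob_U) (set_type mor_U) restr_src restr_tgt
    (fun x => exist _ (idm (set_val x)) (restr_idm_subproof x)) restr_cmp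
    _ _ _ _ _ _ _.
Next Obligation. by move=> x; apply: val_inj; rewrite /= src_idm. Qed.
Next Obligation. by move=> x; apply: val_inj; rewrite /= tgt_idm. Qed.
Next Obligation. by move=> f g e; apply: val_inj; rewrite /= src_cmp. Qed.
Next Obligation. by move=> f g e; apply: val_inj; rewrite /= tgt_cmp. Qed.
Next Obligation. by move=> f e; apply: val_inj; rewrite /= cmp_idl. Qed.
Next Obligation. by move=> f e; apply: val_inj; rewrite /= cmp_idr. Qed.
Next Obligation. by move=> f g h e1 e2 e3 e4; apply: val_inj; exact: cmpA. Qed.

Lemma restr_act_ob_subproof (y : set_type ob_U * cmG X) :
  fob (g2act P) (set_val y.1, y.2) \in ob_U.
Proof. by apply/mem_set; rewrite /ob_U /= g2proj_act; exact: (set_valP y.1). Qed.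

Lemma restr_act_mor_subproof (f : set_type mor_U * (cmH X * cmG X)) :
  fmor (g2act P) (set_val f.1, f.2) \in mor_U.
Proof.
apply/mem_set; rewrite /mor_U /= -over_src src_fmor g2proj_act over_src.
exact: (set_valP f.1).
Qed.

Program Definition restr_act :
    functor (prod_category restr_category (lie2group X)) restr_category :=
  @Functor R (prod_category restr_category (lie2group X)) restr_category
    (fun y => exist _ (fob (g2act P) (set_val y.1, y.2)) (restr_act_ob_subproof y))
    (fun f => exist _ (fmor (g2act P) (set_val f.1, f.2)) (restr_act_mor_subproof f))
    _ _ _ _.
Next Obligation. by move=> f; apply: val_inj; rewrite /= src_fmor. Qed.
Next Obligation. by move=> f; apply: val_inj; rewrite /= tgt_fmor. Qed.
Next Obligation. by move=> x; apply: val_inj; rewrite /= -fmor_idm. Qed.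
Next Obligation.
move=> [f a] [g b] e e'; apply: val_inj => /=.
have e1 : src (set_val f) = tgt (set_val g) by exact: (congr1 set_val (congr1 fst e)).
have e3 : @src R (prod_category P (lie2group X)) (set_val f, a) =
          tgt ((set_val g, b) : mor (prod_category P (lie2group X))).
  by rewrite /= e1; congr pair; exact: (congr1 snd e).
rewrite -(fmor_cmp e3) /=; congr fmor; congr pair; congr cmp.
exact: Prop_irrelevance.
Qed.

Program Definition restr : g2space X :=
  @G2Space R X restr_category restr_act _ _ _ _.
Next Obligation. by move=> x; apply: val_inj; rewrite /= g2act_ob1. Qed.
Next Obligation. by move=> x g g'; apply: val_inj; rewrite /= g2act_obM. Qed.
Next Obligation. by move=> f; apply: val_inj; rewrite /= g2act_mor1. Qed.
Next Obligation. by move=> f a a'; apply: val_inj; rewrite /= g2act_morM. Qed.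

End Restriction.

Section Bundles.
Variables (R : realType) (X : crossed_module R) (M : manifoldType R).
Implicit Types (P : over_g2space X M) (U : set M).

Definition trivialisation P U
    (Phi : functor (restr P U) (triv_g2space X (set_type U)))
    (Phi' : functor (triv_g2space X (set_type U)) (restr P U)) : Prop :=
  [/\ g2morphism Phi,
      weak_inverse Phi Phi',
      (forall p, set_val (fob Phi p).1 = fob (g2proj P) (set_val p)) /\
      (forall f, set_val (fmor Phi f).1 = fmor (g2proj P) (set_val f)) &
      (forall y, fob (g2proj P) (set_val (fob Phi' y)) = set_val y.1) /\
      (forall a, fmor (g2proj P) (set_val (fmor Phi' a)) = set_val a.1)].

Definition principal_2bundle P : Prop :=
  [/\ smooth_g2space P, smooth_functor (g2proj P) &
      exists (I : Type) (U : I -> set M), open_cover U /\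
        forall i, exists Phi Phi', @trivialisation P (U i) Phi Phi'].

Record bundle := Bundle {
  bundle_space :> over_g2space X M ;
  bundleP : principal_2bundle bundle_space }.

Definition bundle_morphism (P Q : bundle) (F : functor P Q) : Prop :=
  g2morphism F /\ eq_functor (comp_functor (g2proj Q) F) (g2proj P).

Definition morita_equivalent (P P' : bundle) : Prop :=
  exists Q : bundle,
    (exists F : functor Q P, bundle_morphism F) /\
    (exists F' : functor Q P', bundle_morphism F').

End Bundles.

Section Cocycles.
Variables (R : realType) (X : crossed_module R) (M : manifoldType R).

(* The values of [cc_g i j] and [cc_h i j k] outside of the double and triple
   intersections are irrelevant. *)
Record cocycle_data := CocycleData {
  cc_index : Type ;
  cc_cover : cc_index -> set M ;
  cc_g : cc_index -> cc_index -> M -> cmG X ;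
  cc_h : cc_index -> cc_index -> cc_index -> M -> cmH X }.

Definition is_cocycle (z : cocycle_data) : Prop :=
  let U := @cc_cover z in let g := @cc_g z in let h := @cc_h z in
  [/\ open_cover U,
      forall i j, smooth_on (U i `&` U j) (g i j),
      forall i j k, smooth_on (U i `&` U j `&` U k) (h i j k) &
      [/\ forall i j k x, (U i `&` U j `&` U k) x ->
            cm_beta (h i j k x) * g i j x * g j k x = g i k x,
          forall i j k l x, (U i `&` U j `&` U k `&` U l) x ->
            h i k l x * h i j k x = h i j l x * cm_act (g i j x) (h j k l x),
          forall i x, U i x -> g i i x = 1 &
          forall i j x, (U i `&` U j) x -> h i j j x = 1 /\ h j j i x = 1]].

Record cocycle := Cocycle {
  cocycle_val :> cocycle_data ;
  cocycleP : is_cocycle cocycle_val }.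

Definition cohomologous (z z' : cocycle) : Prop :=
  exists (J : Type) (V : J -> set M)
      (p : J -> cc_index z) (p' : J -> cc_index z')
      (gamma : J -> M -> cmG X) (eta : J -> J -> M -> cmH X),
    let g i j := cc_g (p i) (p j) in
    let h i j k := cc_h (p i) (p j) (p k) in
    let g' i j := cc_g (p' i) (p' j) in
    let h' i j k := cc_h (p' i) (p' j) (p' k) in
    [/\ open_cover V,
        forall i, V i `<=` cc_cover (p i) /\ V i `<=` cc_cover (p' i),
        forall i, smooth_on (V i) (gamma i),
        forall i j, smooth_on (V i `&` V j) (eta i j) &
        [/\ forall i j x, (V i `&` V j) x ->
              gamma i x * g' i j x = cm_beta (eta i j x) * g i j x * gamma j x,
            forall i j k x, (V i `&` V j `&` V k) x ->
              eta i k x * h i j k x =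
              cm_act (gamma i x) (h' i j k x) * eta i j x *
                cm_act (g i j x) (eta j k x) &
            forall i x, V i x -> eta i i x = 1]].

(* [z] is the cocycle z(P) for some choice of local data. Equations [set_val _ =
   set_val _] move a point, an object or a morphism from the restriction over
   one open set of the cover to the restriction over another one. *)
Definition cocycle_of (P : bundle X M) (z : cocycle_data) : Prop :=
  let U := @cc_cover z in
  open_cover U /\
  exists (Phi : forall i, functor (restr P (U i)) (triv_g2space X (set_type (U i))))
      (Phi' : forall i, functor (triv_g2space X (set_type (U i))) (restr P (U i)))
      (tau : forall i, ob (restr P (U i)) -> mor (restr P (U i))),
    [/\ forall i, trivialisation (Phi i) (Phi' i),
        forall i, eq_functor (comp_functor (Phi i) (Phi' i)) (id_functor _),
        forall i, is_2isomorphism (comp_functor (Phi' i) (Phi i)) (id_functor _) (tau i),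
        forall i p, fmor (Phi i) (tau i p) = idm (fob (Phi i) p) &
        (forall i j (xi : set_type (U i)) (xj : set_type (U j))
             (p : ob (restr P (U j))),
           set_val xj = set_val xi ->
           set_val p = set_val (fob (Phi' i) (xi, 1)) ->
           fob (Phi j) p = (xj, (cc_g i j (set_val xi))^-1)) /\
        (forall i j k (xi : set_type (U i)) (xk : set_type (U k))
             (p : ob (restr P (U j))) (m : mor (restr P (U k))),
           set_val xk = set_val xi ->
           set_val p = set_val (fob (Phi' i) (xi, 1)) ->
           set_val m = set_val (tau j p) ->
           let x := set_val xi in
           fmor (Phi k) m =
             (xk, (cm_act (cc_g i k x)^-1 (cc_h i j k x)^-1,
                   (cc_g i j x * cc_g j k x)^-1)))].

End Cocycles.

Definition classes (T : Type) (E : T -> T -> Prop) : Type :=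
  {A : T -> Prop | exists x, A = E x}.

Definition class (T : Type) (E : T -> T -> Prop) (x : T) : classes E :=
  exist _ (E x) (ex_intro _ x erefl).

Definition equivalence_relation (T : Type) (E : T -> T -> Prop) : Prop :=
  [/\ forall x, E x x, forall x y, E x y -> E y x &
      forall x y z, E x y -> E y z -> E x z].

(* Main.v *)
Require Import Defs.
From HB Require Import structures.
From mathcomp Require Import all_boot all_order all_algebra.
From mathcomp Require Import all_classical all_reals all_analysis.
From mathcomp Require Import ring.
Set Implicit Arguments.
Unset Strict Implicit.
Unset Printing Implicit Defensive.
Import Order.TTheory GRing.Theory Num.Theory.
Import numFieldNormedType.Exports.
Local Open Scope classical_set_scope.
Local Open Scope ring_scope.

(** The bridge between bundles and cocycles is the notion of a descent datum
    ([is_descent]): local sections [s i] of a bundle [P] over the members of the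
    cover of a cocycle [z], with morphisms [sg i j : s j -> s i . g_ij] whose
    composites are compared by the [h_ijk].  Write [descends P z] when [P] has
    such a datum.  The local data from which z(P) is defined give one, with
    [s i x = Phi'_i (x, e)] and [sg i j] the transformation tau_j at
    [s i . g_ij] ([framed_cocycle]); in particular z(P) is a cocycle.  The
    classification follows from four facts.

    - Every cocycle [z] has a bundle to which it descends.  Its objects over [x]
      are pairs [(i, k)], standing for [s_i(x) . k], and its morphisms are
      composites [(id . (a, g_ij k)) o (sg_ij . k)]; the composition law is
      dictated by this reading ([cocycle_bundle], [descends_cocycle_bundle]).

    - [descends P z] yields a bundle morphism from the bundle of [z] to [P],
      given by the same reading ([descends_bundle_morphism]), and bundle
      morphisms push descent data forward ([descends_morphism]).

    - If [z] and [z'] descend to the same bundle, they are cohomologous: a local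
      trivialisation compares the two families of sections by group elements
      gamma, and the failure of the comparison to respect the morphisms [sg] is
      measured by eta ([descends_cohomologous]).

    - If [z] and [z'] are cohomologous, then the refinement of [z] to the common
      cover descends to every bundle to which [z'] descends: twist the sections
      by gamma^-1 and their morphisms by eta^-1 ([cohomologous_descends]).

    Hence [P] and [P'] are Morita equivalent iff their cocycles are cohomologous
    ([morita_descends]): two bundle morphisms out of one bundle push one of its
    descent data to both ends, and conversely the bundle of the common refinement
    maps to both.  That the two relations are equivalence relations comes out of
    the same facts.

    Identities between morphisms of a bundle are checked in a local
    trivialisation.  It is faithful, so that each of them becomes an identity in
    the crossed module ([triangleP]).  Local trivialisations are used in the
    coordinate form of a [frame]: a G-valued function on objects, an H-valued
    function on morphisms, a section and a transformation.  Any of them can be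
    made strict, with [Phi o Phi' = id] and [Phi (tau p)] an identity
    ([strictify]), whence the existence of z(P).  Inverses are only ever formed in
    [G] and [H], where inversion is smooth, never in the space of morphisms of a
    bundle, where inversion is not assumed to be smooth.

    Smoothness is in the sense of Michal and Bastiani.  The chain rule rests on a
    mean value theorem with values in convex open sets, and smoothness is
    handled pointwise ([smooth_at]), which lets maps defined on an open
    set be treated as total functions. *)

(** * Mean value theorem and chain rule in locally convex spaces *)

Section MeanValue.
Variables (R : realType) (F : tvsType R).

Definition convex_comb_closed (A : set F) :=
  forall x y (l : R), A x -> A y -> 0 <= l -> l <= 1 ->
    A (l *: x + (1 - l) *: y).

Lemma nbhs_convex_open (x : F) (A : set F) : nbhs x A ->
  exists B : set F, [/\ open B, B x, B `<=` A & convex_comb_closed B].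
Proof.
move=> xA; have [Bs cB [oB nB]] := @locally_convex R F.
have [B [BsB Bx] BA] := nB x A xA; exists B; split => //; first exact: oB.
move=> y z l By Bz l0 l1; apply/set_mem.
exact: (cB B (mem_set BsB) y z (Itv01 l0 l1) (mem_set By) (mem_set Bz)).
Qed.

(** If the slope over [a, t] lies in the convex set [A] and the slope over
    [t, u] does too, then so does the slope over [a, u], a convex combination of
    both.  As [A] is open, it contains the slopes over all short intervals
    issued from a given point on either side; hence the supremum of the [t] for
    which the slope over [a, t] lies in [A] is attained and equals [b]. *)
Lemma convex_mean_value (A : set F) (c dc : R -> F) (a b : R) :
  open A -> convex_comb_closed A -> a < b ->
  (forall r, a <= r <= b ->
     (fun t => t^-1 *: (c (r + t) - c r)) @ 0^' --> dc r) ->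
  (forall r, a <= r <= b -> A (dc r)) ->
  A ((b - a)^-1 *: (c b - c a)).
Proof.
move=> oA cA ab dcP Adc; pose slope s t := (t - s)^-1 *: (c t - c s).
have local r : a <= r <= b -> exists2 d, 0 < d &
    forall t, t != r -> `|t - r| < d -> A (slope r t).
  move=> rab; have := dcP r rab A (open_nbhs_nbhs (conj oA (Adc r rab))).
  move=> [d /= d0 dA]; exists d => // t tr td.
  have := dA (t - r); rewrite /= sub0r normrN subr_eq0 => /(_ td tr).
  by rewrite /= addrCA subrr addr0.
have slopeC s t : slope s t = slope t s.
  by rewrite /slope -[t - s]opprB invrN scaleNr -scalerN opprB.
have glue t u : a < t -> t < u -> A (slope a t) -> A (slope t u) ->
    A (slope a u).
  move=> a_t tu Aat Atu; pose l := (t - a) / (u - a).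
  have ta0 : t - a != 0 by rewrite subr_eq0 gt_eqF.
  have ut0 : u - t != 0 by rewrite subr_eq0 gt_eqF.
  have ua : 0 < u - a by rewrite subr_gt0 (lt_trans a_t).
  have -> : slope a u = l *: slope a t + (1 - l) *: slope t u.
    rewrite /slope !scalerA /l.
    have -> : (t - a) / (u - a) * (t - a)^-1 = (u - a)^-1.
      by field; rewrite gt_eqF.
    have -> : (1 - (t - a) / (u - a)) * (u - t)^-1 = (u - a)^-1.
      by field; rewrite ut0 gt_eqF.
    by rewrite -scalerDr; congr (_ *: _); rewrite [RHS]addrC subrKA.
  apply: cA => //; first by rewrite divr_ge0 ?subr_ge0 ?ltW// -subr_gt0.
  by rewrite /l ler_pdivrMr// mul1r lerD2r ltW.
(* The case t = a is listed apart because slope a a = 0 need not lie in A. *)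
pose S := [set t | a <= t <= b /\ (t = a \/ A (slope a t))].
have Sa : S a by split; [rewrite lexx ltW|left].
have ubS : ubound S b by move=> t [/andP[_ ?] _].
have hS : has_sup S by split; [exists a|exists b].
set s := sup S.
have s_ab : a <= s <= b.
  by rewrite sup_upper_bound //= ge_sup //; exists a.
have [d d0 dA] := local s s_ab.
have [t St std] := sup_adherent d0 hS.
have ts : t <= s by exact: sup_upper_bound.
have Ss : S s.
  split => //; move: St => [/andP[a_t _] tA].
  have [ts'|ts'] := eqVneq t s; first by rewrite -ts'.
  right; have tsA : A (slope t s).
    rewrite slopeC; apply: dA => //; rewrite ler0_norm ?subr_le0// opprB.
    by rewrite ltrBlDr -ltrBlDl.
  case: tA => [<-//|tA].
  have [->//|a_t'] := eqVneq a t.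
  by apply: glue tA tsA; rewrite lt_neqAle ?a_t' ?ts'.
have [sb|sb] := eqVneq s b.
  by case: Ss => _ []; rewrite sb // => ba; rewrite ba ltxx in ab.
have {}sb : s < b by rewrite lt_neqAle sb; case/andP: s_ab.
pose u := Num.min b (s + d / 2).
have su : s < u by rewrite lt_min sb ltrDl divr_gt0.
have ub : u <= b by rewrite ge_min lexx.
have suA : A (slope s u).
  apply: dA; first by rewrite gt_eqF.
  rewrite ger0_norm ?subr_ge0 ?ltW// ltrBlDl.
  rewrite (@le_lt_trans _ _ (s + d / 2))//; first by rewrite ge_min lexx orbT.
  by rewrite ltrD2l ltr_pdivrMr// ltr_pMr// ltr1n.
suff : S u by move/(sup_upper_bound hS); rewrite leNgt su.
split; first by rewrite ub (le_trans _ (ltW su))//; case/andP: s_ab.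
right; case: Ss => _ [<-//|sA].
have [->//|sa] := eqVneq a s.
by apply: glue sA suA; rewrite // lt_neqAle sa; case/andP: s_ab.
Qed.

End MeanValue.

Section ChainRule.
Variables (R : realType).

Lemma scale_cvg (T : Type) (E : tvsType R) (Fl : set_system T) (FFl : Filter Fl)
    (k : T -> R) (f : T -> E) (k0 : R) (f0 : E) :
  k @ Fl --> k0 -> f @ Fl --> f0 -> (fun t => k t *: f t) @ Fl --> k0 *: f0.
Proof.
move=> kk ff; apply: (cvg_comp (fun t => (k t, f t)) (fun z : R^o * E => z.1 *: z.2)).
  exact: (cvg_pair kk ff).
exact: (@scale_continuous R E (k0, f0)).
Qed.

Lemma add_cvg (T : Type) (E : tvsType R) (Fl : set_system T) (FFl : Filter Fl)
    (f g : T -> E) (f0 g0 : E) :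
  f @ Fl --> f0 -> g @ Fl --> g0 -> (fun t => f t + g t) @ Fl --> f0 + g0.
Proof.
move=> kk ff; apply: (cvg_comp (fun t => (f t, g t)) (fun z : E * E => z.1 + z.2)).
  exact: (cvg_pair kk ff).
exact: (@add_continuous E (f0, g0)).
Qed.

(** Since the direction [k t] varies with [t], differentiability along lines is
    not enough.  The difference quotient is the mean slope of
    [r |-> g (y + r *: k t)] between 0 and [t], whose derivative
    [dg (y + r *: k t, k t)] stays in a convex neighbourhood of [dg (y, k0)]. *)
Lemma directional_chain_rule (E F : tvsType R) (V : set E) (g : E -> F)
    (dg : E * E -> F) (y k0 : E) (k : R -> E) :
  open V -> V y ->
  (forall x v, V x ->
     (fun t : R => t^-1 *: (g (x + t *: v) - g x)) @ 0^' --> dg (x, v)) ->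
  {for (y, k0), continuous dg} ->
  k @ 0^' --> k0 ->
  (fun t : R => t^-1 *: (g (y + t *: k t) - g y)) @ 0^' --> dg (y, k0).
Proof.
move=> oV Vy dgP cdg kk0 W0 /nbhs_convex_open[W [oW Wx WW0 cW]].
have cdg' : nbhs (y, k0) (dg @^-1` W) by apply: cdg; exact: open_nbhs_nbhs.
have [[A B] /= [yA kB] ABW] := cdg'.
have yAV : nbhs y (A `&` V) by apply: filterI => //; exact: open_nbhs_nbhs.
have line : (fun z : R^o * E => y + z.1 *: z.2) @ nbhs (0 : R^o, k0) --> y.
  rewrite -[X in _ --> X]addr0 -[X in y + X](scale0r k0).
  apply: add_cvg; first exact: cvg_cst.
  exact: (@scale_continuous R E (0, k0)).
have [[C D] /= [C0 Dk] CDA] := line _ yAV.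
have [e e0 eC] : exists2 e : R, 0 < e & forall t : R, `|t| < e -> C t.
  case: C0 => e /= e0 eC; exists e => // t te; apply: eC.
  by rewrite /= sub0r normrN.
have kBD : \forall t \near 0^', (B `&` D) (k t).
  by apply: (kk0 (B `&` D)); exact: filterI.
have te : \forall t \near (0 : R)^', `|t| < e.
  by apply: nbhs_dnbhs; exists e => //= t; rewrite /= sub0r normrN.
have tN0 : \forall t \near (0 : R)^', t != 0 by exact: nbhs_dnbhs_neq.
change (\forall t \near (0 : R)^', W0 (t^-1 *: (g (y + t *: k t) - g y))).
near=> t; apply: WW0.
have [Bk Dkt] : (B `&` D) (k t) by near: t.
have {}te' : `|t| < e by near: t.
have t0 : t != 0 by near: t.
pose c r := g (y + r *: k t); pose dc r := dg (y + r *: k t, k t).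
have inAV r : `|r| <= `|t| -> (A `&` V) (y + r *: k t).
  move=> rt; apply: (CDA (r, k t)); split => //=.
  by apply: eC; exact: le_lt_trans te'.
have dcP r : `|r| <= `|t| -> (fun t => t^-1 *: (c (r + t) - c r)) @ 0^' --> dc r.
  move=> rt; have := dgP (y + r *: k t) (k t) (inAV r rt).2.
  rewrite /c; under [in X in _ -> X]eq_fun do rewrite scalerDl addrA.
  by [].
have Wdc r : `|r| <= `|t| -> W (dc r).
  by move=> rt; apply: (ABW (_, _)); split => //=; exact: (inAV r rt).1.
have c0 : c 0 = g y by rewrite /c scale0r addr0.
have [tp|tn|t00] := ltgtP 0 t; last by rewrite -t00 eqxx in t0.
  have := @convex_mean_value R F W c dc 0 t oW cW tp.
  rewrite subr0 c0; apply => r /andP[r0 rt]; [apply: dcP|apply: Wdc];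
    by rewrite !ger0_norm// ltW.
have := @convex_mean_value R F W c dc t 0 oW cW tn.
rewrite sub0r c0 invrN scaleNr -scalerN opprB.
by apply => r /andP[r0 rt]; [apply: dcP|apply: Wdc];
  rewrite !ler0_norm ?lerN2// ltW.
Unshelve. all: by end_near. Qed.

End ChainRule.

(** * Michal-Bastiani C^n maps *)

Lemma open_setX (S T : topologicalType) (A : set S) (B : set T) :
  open A -> open B -> open (A `*` B).
Proof.
move=> oA oB; rewrite openE => -[x y] [/= Ax By].
by exists (A, B) => //; split; exact: open_nbhs_nbhs.
Qed.

Section CnTheory.
Variables (R : realType).

Lemma Cn_on_continuous (E F : tvsType R) n (U : set E) (f : E -> F) :
  Cn_on n U f -> forall x, U x -> {for x, continuous f}.
Proof. by case: n => [|n] []. Qed.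

Lemma Cn_on_sub (E F : tvsType R) n (U U' : set E) (f : E -> F) :
  U' `<=` U -> Cn_on n U f -> Cn_on n U' f.
Proof.
elim: n E F U U' f => [|n IH] E F U U' f UU' [cf].
  by split=> // x /UU'; exact: cf.
move=> [df dfP Cdf]; split; first by move=> x /UU'; exact: cf.
exists df; first by move=> x v /UU'; exact: dfP.
by apply: IH Cdf => -[x v] [/UU' Ux _].
Qed.

Lemma Cn_onW (E F : tvsType R) n (U : set E) (f : E -> F) :
  Cn_on n.+1 U f -> Cn_on n U f.
Proof.
elim: n E F U f => [|n IH] E F U f [cf [df dfP Cdf]]; first by split.
by split => //; exists df => //; exact: IH.
Qed.

Lemma direction_cvg (E : tvsType R) (x v : E) :
  (fun t : R => x + t *: v) @ 0^' --> x.
Proof.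
rewrite -[X in _ --> X]addr0 -[X in x + X](scale0r v).
apply: add_cvg; first exact: cvg_cst.
apply: scale_cvg; last exact: cvg_cst.
by apply: nbhs_dnbhs.
Qed.

Lemma difference_quotient_local (E F : tvsType R) (V : set E) (f g : E -> F)
    (x v : E) (l : F) : open V -> V x -> (forall y, V y -> g y = f y) ->
  (fun t : R => t^-1 *: (g (x + t *: v) - g x)) @ 0^' --> l ->
  (fun t : R => t^-1 *: (f (x + t *: v) - f x)) @ 0^' --> l.
Proof.
move=> oV Vx gf; apply: cvg_trans; apply: near_eq_cvg.
have Vt : \forall t \near (0 : R)^', V (x + t *: v).
  exact: (@direction_cvg E x v V (open_nbhs_nbhs (conj oV Vx))).
by apply: filterS Vt => t Vt; rewrite !gf.
Qed.

(** The derivative at [(x, v)] is taken from a local model around [x].  Limits in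
    [F] being unique, the models around different points have the same
    derivatives on overlaps, so the glued derivative is locally C^n. *)
Lemma Cn_on_local (E F : tvsType R) n (U : set E) (f : E -> F) :
  hausdorff_space F -> open U ->
  (forall x, U x -> exists (V : set E) (g : E -> F),
    [/\ open V, V x, forall y, V y -> g y = f y & Cn_on n V g]) ->
  Cn_on n U f.
Proof.
elim: n E F U f => [|n IH] E F U f hF oU loc.
  split => // x Ux; have [V [g [oV Vx gf /Cn_on_continuous/(_ x Vx) cg]]] := loc x Ux.
  have := cg; rewrite /prop_for /continuous_at gf//; apply: cvg_trans.
  have nV : \forall y \near x, V y by exact: open_nbhs_nbhs.
  by apply: near_eq_cvg; apply: filterS nV => y /gf.
split.
  move=> x Ux; have [V [g [oV Vx gf /Cn_on_continuous/(_ x Vx) cg]]] := loc x Ux.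
  have := cg; rewrite /prop_for /continuous_at gf//; apply: cvg_trans.
  have nV : \forall y \near x, V y by exact: open_nbhs_nbhs.
  by apply: near_eq_cvg; apply: filterS nV => y /gf.
have loc' : forall x, exists p : set E * (E * E -> F), U x ->
    [/\ open p.1, p.1 x, forall y v, (p.1 `&` U) y ->
     (fun t : R => t^-1 *: (f (y + t *: v) - f y)) @ 0^' --> p.2 (y, v) &
     Cn_on n (p.1 `*` setT) p.2].
  move=> x; have [Ux|nUx] := pselect (U x); last by exists (setT, fun=> 0).
  have [V [g [oV Vx gf [_ [dg dgP Cdg]]]]] := loc x Ux.
  exists (V, dg) => _; split => //= y v [Vy Uy].
  exact: (difference_quotient_local oV Vy gf (dgP y v Vy)).
have [p pP] := choice loc'.
have dfP x v : U x ->
    (fun t : R => t^-1 *: (f (x + t *: v) - f x)) @ 0^' --> (p x).2 (x, v).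
  by move=> Ux; have [_ px + _] := pP x Ux; apply.
exists (fun z => (p z.1).2 z) => //.
apply: IH => //; first exact: open_setX oU openT.
move=> [x v] [/= Ux _]; have [opx px dpx Cpx] := pP x Ux.
exists (((p x).1 `&` U) `*` setT), (p x).2; split => //.
- by apply: open_setX openT; exact: openI.
- move=> [y w] [/= [py Uy] _].
  by apply: (cvg_unique hF (dpx y w (conj py Uy)) (dfP y w Uy)).
- by apply: Cn_on_sub Cpx => -[y w] [/= [py _] _].
Qed.

Lemma Cn_on_linear (E F : tvsType R) n (U : set E) (f : E -> F) :
  continuous f -> (forall x t v, f (x + t *: v) = f x + t *: f v) ->
  Cn_on n U f.
Proof.
elim: n E F U f => [|n IH] E F U f cf lf; first by split => // x _; exact: cf.
split; first by move=> x _; exact: cf.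
exists (f \o snd).
  move=> x v _; apply: cvg_near_cst.
  have := nbhs_dnbhs_neq (0 : R); apply: filterS => t t0.
  by rewrite lf addrAC subrr add0r scalerA mulVf// scale1r.
apply: IH; first by move=> p; apply: continuous_comp; [exact: cvg_snd|exact: cf].
by move=> [x1 x2] t [v1 v2] /=; exact: lf.
Qed.

Lemma Cn_on_cst (E F : tvsType R) n (U : set E) (y : F) :
  Cn_on n U (fun _ : E => y).
Proof.
elim: n E F U y => [|n IH] E F U y; first by split => // x _; exact: cst_continuous.
split; first by move=> x _; exact: cst_continuous.
exists (fun=> 0); last exact: IH.
by move=> x v _; apply: cvg_near_cst; apply: nearW => t; rewrite subrr scaler0.
Qed.

Lemma Cn_on_fst (E F : tvsType R) n (U : set (E * F)) : Cn_on n U fst.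
Proof. by apply: Cn_on_linear => // x; exact: cvg_fst. Qed.

Lemma Cn_on_snd (E F : tvsType R) n (U : set (E * F)) : Cn_on n U snd.
Proof. by apply: Cn_on_linear => // x; exact: cvg_snd. Qed.

Lemma Cn_on_pair (E F G : tvsType R) n (U : set E) (f : E -> F) (g : E -> G) :
  Cn_on n U f -> Cn_on n U g -> Cn_on n U (fun x => (f x, g x)).
Proof.
elim: n E F G U f g => [|n IH] E F G U f g [cf Cf] [cg Cg].
  by split => // x Ux; apply: cvg_pair; [exact: cf|exact: cg].
split; first by move=> x Ux; apply: cvg_pair; [exact: cf|exact: cg].
move: Cf Cg => [df dfP Cdf] [dg dgP Cdg].
exists (fun z => (df z, dg z)); last exact: IH.
by move=> x v Ux; exact: (cvg_pair (dfP x v Ux) (dgP x v Ux)).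
Qed.

(** [d(g \o f) (x, v) = dg (f x, df (x, v))] is again a composite of C^n maps,
    which allows an induction on [n]. *)
Lemma Cn_on_comp (E F G : tvsType R) n (U : set E) (V : set F)
    (f : E -> F) (g : F -> G) :
  open U -> open V -> (forall x, U x -> V (f x)) ->
  Cn_on n U f -> Cn_on n V g -> Cn_on n U (g \o f).
Proof.
elim: n E F G U V f g => [|n IH] E F G U V f g oU oV UV Cf Cg.
  split => // x Ux; apply: continuous_comp; first exact: (Cn_on_continuous Cf).
  by apply: (Cn_on_continuous Cg); exact: UV.
split.
  move=> x Ux; apply: continuous_comp; first exact: (Cn_on_continuous Cf).
  by apply: (Cn_on_continuous Cg); exact: UV.
have Cfn := Cn_onW Cf.
move: Cf Cg => [cf [df dfP Cdf]] [cg [dg dgP Cdg]].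
exists (dg \o (fun z => (f z.1, df z))).
  move=> x v Ux /=.
  have := @directional_chain_rule R F G V g dg (f x) (df (x, v))
    (fun t => t^-1 *: (f (x + t *: v) - f x)) oV (UV x Ux) dgP.
  have cdg : {for (f x, df (x, v)), continuous dg}.
    by apply: (Cn_on_continuous Cdg); split => //=; exact: UV.
  move=> /(_ cdg (dfP x v Ux)); apply: cvg_trans; apply: near_eq_cvg.
  have := nbhs_dnbhs_neq (0 : R); apply: filterS => t t0 /=.
  by rewrite scalerA mulfV// scale1r subrKC.
apply: (IH _ _ _ (U `*` setT) (V `*` setT)) => //.
- exact: open_setX oU openT.
- exact: open_setX oV openT.
- by move=> [x v] [/= Ux _]; split => //=; exact: UV.
apply: Cn_on_pair => //.
apply: (IH _ _ _ (U `*` setT) U fst f) => //; first exact: open_setX oU openT.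
  by move=> x [].
exact: Cn_on_fst.
Qed.

End CnTheory.

(** * Smoothness at a point of a manifold *)

Lemma open_preimage_on (S T : topologicalType) (U : set S) (V : set T) (f : S -> T) :
  open U -> (forall x, U x -> {for x, continuous f}) -> open V ->
  open (U `&` f @^-1` V).
Proof.
move=> oU cf oV; rewrite openE => x [Ux Vfx].
apply: filterI; first exact: open_nbhs_nbhs.
by apply: (cf x Ux V); exact: open_nbhs_nbhs.
Qed.

Lemma nbhs_everywhere (T : topologicalType) (P : set T) (x : T) :
  (forall y, P y) -> nbhs x P.
Proof. by move=> PT; apply: filterS filterT => y _. Qed.

Lemma nbhs_setI (T : topologicalType) (A B : set T) (x : T) :
  nbhs x A -> nbhs x B -> nbhs x (A `&` B).
Proof. exact: filterI. Qed.

Section Cinfty_germs.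
Variable R : realType.

Definition Cinfty_at (E F : tvsType R) (f : E -> F) (x : E) : Prop :=
  exists W : set E, [/\ open W, W x & Cinfty_on W f].

Lemma Cinfty_at_comp (E F G : tvsType R) (f : E -> F) (g : F -> G) x :
  Cinfty_at f x -> Cinfty_at g (f x) -> Cinfty_at (g \o f) x.
Proof.
move=> [W [oW Wx Cf]] [W' [oW' Wx' Cg]].
have oWW : open (W `&` f @^-1` W').
  by apply: open_preimage_on => // y Wy; exact: (Cn_on_continuous (Cf 0%N)).
exists (W `&` f @^-1` W'); split => // n.
apply: (Cn_on_comp oWW oW') (Cg n); first by move=> y [].
by apply: Cn_on_sub (Cf n) => y [].
Qed.

Lemma Cinfty_at_pair (E F G : tvsType R) (f : E -> F) (g : E -> G) x :
  Cinfty_at f x -> Cinfty_at g x -> Cinfty_at (fun y => (f y, g y)) x.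
Proof.
move=> [W [oW Wx Cf]] [W' [oW' Wx' Cg]].
exists (W `&` W'); split => //; first exact: openI.
move=> n; apply: Cn_on_pair.
  by apply: Cn_on_sub (Cf n) => y [].
by apply: Cn_on_sub (Cg n) => y [].
Qed.

Lemma Cinfty_at_fst (E F : tvsType R) (x : E * F) : Cinfty_at fst x.
Proof. by exists setT; split => //; [exact: openT|move=> n; exact: Cn_on_fst]. Qed.

Lemma Cinfty_at_snd (E F : tvsType R) (x : E * F) : Cinfty_at snd x.
Proof. by exists setT; split => //; [exact: openT|move=> n; exact: Cn_on_snd]. Qed.

Lemma Cinfty_at_cst (E F : tvsType R) (y : F) (x : E) : Cinfty_at (fun=> y) x.
Proof. by exists setT; split => //; [exact: openT|move=> n; exact: Cn_on_cst]. Qed.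

Lemma Cinfty_at_id (E : tvsType R) (x : E) : Cinfty_at id x.
Proof.
exists setT; split => //; first exact: openT.
by move=> n; apply: Cn_on_linear => // y.
Qed.

End Cinfty_germs.

(** The carriers of a bundle are charted types together with a proof that they are
    manifolds, not instances of [manifoldType]; a class finds this proof. *)
Class is_manifold (R : realType) (M : chartedType R) : Prop :=
  is_manifoldP : smooth_manifold M.

Section Manifolds.
Variable R : realType.
Implicit Types M N L : chartedType R.

#[global] Instance manifoldType_is_manifold (M : manifoldType R) : is_manifold M.
Proof. exact: manifoldP. Qed.

#[global] Instance lieGroupType_is_manifold (M : lieGroupType R) : is_manifold M.
Proof. exact: manifoldP. Qed.

Lemma chart_at M {mM : is_manifold M} (x : M) :
  exists2 c : chart R M, atlas c & chart_dom c x.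
Proof. by case: mM => _ _ + _; apply. Qed.

Lemma atlas_axiom M {mM : is_manifold M} (c : chart R M) : atlas c -> chart_axiom c.
Proof. by case: mM => _ + _ _; apply. Qed.

Lemma transition M {mM : is_manifold M} (c d : chart R M) :
  atlas c -> atlas d -> smooth_in_charts c d id.
Proof. by case: mM => _ _ _; apply. Qed.

Lemma manifold_hausdorff M {mM : is_manifold M} : hausdorff_space M.
Proof. by case: mM. Qed.

Lemma chart_open_dom M {mM : is_manifold M} (c : chart R M) : atlas c -> open (chart_dom c).
Proof. by move/atlas_axiom => []. Qed.

Lemma chart_open_image M {mM : is_manifold M} (c : chart R M) V : atlas c ->
  V `<=` chart_dom c -> open V -> open (c @` V).
Proof. by move/atlas_axiom => [_ _ _ _]; apply. Qed.

Lemma chart_continuous M {mM : is_manifold M} (c : chart R M) x : atlas c ->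
  chart_dom c x -> {for x, continuous (c : M -> _)}.
Proof. by move/atlas_axiom => [_ _ _ + _]; apply. Qed.

Lemma chart_hausdorff M {mM : is_manifold M} (c : chart R M) : atlas c ->
  hausdorff_space (chart_model c).
Proof. by move/atlas_axiom => []. Qed.

Lemma chart_inj M {mM : is_manifold M} (c : chart R M) : atlas c ->
  set_inj (chart_dom c) c.
Proof. by move/atlas_axiom => []. Qed.

Definition local_rep M N (c : chart R M) (d : chart R N) (f : M -> N) (x : M) : Prop :=
  exists F : chart_model c -> chart_model d,
    Cinfty_at F (c x) /\ \forall y \near x, F (c y) = d (f y).

(** The local representative is required in one pair of charts only;
    [smooth_at_rep] passes to any other. *)
Definition smooth_at M N (f : M -> N) (x : M) : Prop :=
  (\forall y \near x, {for y, continuous f}) /\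
  exists (c : chart R M) (d : chart R N),
    [/\ atlas c, chart_dom c x, atlas d, chart_dom d (f x) & local_rep c d f x].

Lemma smooth_at_continuous M N (f : M -> N) x : smooth_at f x -> {for x, continuous f}.
Proof. by move=> [/nbhs_singleton]. Qed.

Lemma local_rep_comp M N L (c : chart R M) (d : chart R N) (e : chart R L)
    (f : M -> N) (g : N -> L) x :
  {for x, continuous f} ->
  local_rep c d f x -> local_rep d e g (f x) -> local_rep c e (g \o f) x.
Proof.
move=> cf [F [CF Ff]] [G [CG Gg]]; exists (G \o F); split.
  by apply: Cinfty_at_comp CF _; rewrite (nbhs_singleton Ff).
have Ggf : \forall y \near x, G (d (f y)) = e (g (f y)) by exact: cf Gg.
by apply: filterS2 Ff Ggf => y /= -> ->.
Qed.

Lemma smooth_in_charts_rep M N {mM : is_manifold M} {mN : is_manifold N}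
    (c : chart R M) (d : chart R N) f x :
  continuous f -> atlas c -> atlas d -> smooth_in_charts c d f ->
  chart_dom c x -> chart_dom d (f x) -> local_rep c d f x.
Proof.
move=> cf ac ad [F Ff CF] cx dfx; pose D := chart_dom c `&` f @^-1` chart_dom d.
have oD : open D.
  apply: open_preimage_on; [exact: chart_open_dom| |exact: chart_open_dom].
  by move=> y _; exact: cf.
exists F; split.
  exists (c @` D); split => //; last by exists x.
  by apply: chart_open_image => // y [].
have nD : \forall y \near x, D y by exact: open_nbhs_nbhs.
by apply: filterS nD => y /Ff.
Qed.

(** The representative in other charts is obtained by composing with transition
    maps on both sides. *)
Lemma smooth_at_rep M N {mM : is_manifold M} {mN : is_manifold N}
    (c : chart R M) (d : chart R N) (f : M -> N) x :
  smooth_at f x -> atlas c -> chart_dom c x -> atlas d -> chart_dom d (f x) ->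
  local_rep c d f x.
Proof.
move=> [nf [c' [d' [ac' c'x ad' d'fx rep]]]] ac cx ad dfx.
have cid (T : topologicalType) : continuous (@id T) by move=> ? ?.
have r1 : local_rep c c' id x.
  by apply: smooth_in_charts_rep => //; exact: transition.
have r2 : local_rep d' d id (f x).
  by apply: smooth_in_charts_rep => //; exact: transition.
have := local_rep_comp (f := id) (@cid M x) r1 rep.
move=> r3; exact: (local_rep_comp (f := f) (nbhs_singleton nf) r3 r2).
Qed.

Lemma smooth_at_nbhs M N {mM : is_manifold M} {mN : is_manifold N}
  (f : M -> N) x : smooth_at f x -> \forall y \near x, smooth_at f y.
Proof.
move=> [nf [c [d [ac cx ad dx [F [[W [oW Wx CF]] Ff]]]]]].
have cf := nbhs_singleton nf.
have nc : \forall y \near x, chart_dom c y.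
  by apply: open_nbhs_nbhs; split => //; exact: chart_open_dom.
have nd : \forall y \near x, chart_dom d (f y).
  by apply: cf; apply: open_nbhs_nbhs; split => //; exact: chart_open_dom.
have nW : \forall y \near x, W (c y).
  by apply: (chart_continuous ac cx); exact: open_nbhs_nbhs.
have n1 := nbhs_setI (nbhs_interior nf) (nbhs_interior Ff).
have n := nbhs_setI n1 (nbhs_setI nW (nbhs_setI nc nd)).
apply: filterS n.
move=> y [[nfy Ffy] [Wy [cy dy]]].
split => //; exists c, d; split => //; exists F; split => //.
by exists W.
Qed.

Lemma smooth_smooth_at M N {mM : is_manifold M} {mN : is_manifold N}
  (f : M -> N) x : smooth f -> smooth_at f x.
Proof.
move=> [cf sf]; split; first exact: nbhs_everywhere.
have [c ac cx] := chart_at x; have [d ad dx] := chart_at (f x).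
by exists c, d; split => //; apply: smooth_in_charts_rep => //; exact: sf.
Qed.

(** In given charts, [F] is forced on the image of [c] by [F (c x) = d (f x)],
    consistently as [c] is injective; it agrees locally with the
    representatives at points. *)
Lemma smooth_at_smooth M N {mM : is_manifold M} {mN : is_manifold N}
  (f : M -> N) : (forall x, smooth_at f x) -> smooth f.
Proof.
move=> sf; have cf : continuous f by move=> x; exact: smooth_at_continuous.
split => // c d ac ad; pose D := chart_dom c `&` f @^-1` chart_dom d.
have oD : open D.
  apply: open_preimage_on; [exact: chart_open_dom| |exact: chart_open_dom].
  by move=> y _; exact: cf.
have [F Ff] : exists F : chart_model c -> chart_model d,
    forall x, D x -> F (c x) = d (f x).
  have : forall u, exists w, forall x, D x -> c x = u -> d (f x) = w.
    move=> u; have [[x Dx cxu]|nx] := pselect (exists2 x, D x & c x = u).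
      exists (d (f x)) => y Dy cyu; congr (d (f _)).
      by apply: (chart_inj ac); rewrite ?cyu ?cxu//; apply/mem_set;
        [case: Dy|case: Dx].
    by exists 0 => x Dx cxu; case: nx; exists x.
  by case/choice => F FP; exists F => x Dx; rewrite -(FP _ x).
exists F => // n; apply: Cn_on_local; first exact: chart_hausdorff.
  by apply: chart_open_image => // y [].
move=> _ [x [cx dfx] <-].
have [F' [[W [oW Wx CF']] F'f]] := smooth_at_rep (sf x) ac cx ad dfx.
have : nbhs x (D `&` [set y | F' (c y) = d (f y)]).
  by apply: filterI => //; exact: open_nbhs_nbhs.
rewrite nbhsE => -[A [oA Ax] AD].
have oV : open (W `&` c @` A).
  by apply: openI => //; apply: chart_open_image => // y /AD[[]].
exists (W `&` c @` A), F'; split => //.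
- by move=> _ [_ [y /AD[Dy F'y] <-]]; rewrite F'y Ff.
- by apply: Cn_on_sub (CF' n) => y [].
Qed.

Lemma smooth_at_comp M N L {mM : is_manifold M} {mN : is_manifold N}
    {mL : is_manifold L} (f : M -> N) (g : N -> L) x :
  smooth_at g (f x) -> smooth_at f x -> smooth_at (fun y => g (f y)) x.
Proof.
move=> sg sf; have cf := smooth_at_continuous sf.
split.
  have Hg : \forall y \near x, {for f y, continuous g} by case: sg => + _; exact: cf.
  case: sf => Hf _; apply: filterS2 Hf Hg => y.
  exact: continuous_comp.
have [c ac cx] := chart_at x; have [d ad dx] := chart_at (f x).
have [e ae ex] := chart_at (g (f x)).
exists c, e; split => //; apply: (@local_rep_comp _ _ _ c d e f g) => //.
  exact: smooth_at_rep.
exact: smooth_at_rep.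
Qed.

Lemma continuous_near (S T : topologicalType) (f g : S -> T) x :
  (\forall y \near x, f y = g y) -> {for x, continuous f} -> {for x, continuous g}.
Proof.
move=> fg; rewrite /prop_for /continuous_at (nbhs_singleton fg); apply: cvg_trans.
by apply: near_eq_cvg; apply: filterS fg => y ->.
Qed.

Lemma smooth_at_near M N (f g : M -> N) x :
  (\forall y \near x, f y = g y) -> smooth_at f x -> smooth_at g x.
Proof.
move=> fg [cf [c [d [ac cx ad dx [F [CF Ff]]]]]]; split.
  by apply: filterS2 cf (nbhs_interior fg) => y cfy /continuous_near; apply.
exists c, d; split => //; first by rewrite -(nbhs_singleton fg).
by exists F; split => //; apply: filterS2 Ff fg => y -> ->.
Qed.

Lemma smooth_at_id M {mM : is_manifold M} (x : M) : smooth_at (fun y => y) x.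
Proof.
split; first by apply: nbhs_everywhere => y ?.
have [c ac cx] := chart_at x; exists c, c; split => //.
by exists id; split; [exact: Cinfty_at_id|exact: nbhs_everywhere].
Qed.

Lemma smooth_at_cst M N {mM : is_manifold M} {mN : is_manifold N} (y : N) (x : M) :
  smooth_at (fun=> y) x.
Proof.
split; first by apply: nbhs_everywhere => z; exact: cst_continuous.
have [c ac cx] := chart_at x; have [d ad dx] := chart_at y.
exists c, d; split => //.
by exists (fun=> d y); split; [exact: Cinfty_at_cst|exact: nbhs_everywhere].
Qed.

Lemma smooth_at_fst M N {mM : is_manifold M} {mN : is_manifold N} (x : M * N) :
  smooth_at fst x.
Proof.
have cfst : continuous (@fst M N) by move=> z; exact: cvg_fst.
split; first exact: nbhs_everywhere.
have [c ac cx] := chart_at x.1; have [d ad dx] := chart_at x.2.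
exists (prod_chart c d), c; split => //; first by exists c, d.
by exists fst; split; [exact: Cinfty_at_fst|exact: nbhs_everywhere].
Qed.

Lemma smooth_at_snd M N {mM : is_manifold M} {mN : is_manifold N} (x : M * N) :
  smooth_at snd x.
Proof.
have csnd : continuous (@snd M N) by move=> z; exact: cvg_snd.
split; first exact: nbhs_everywhere.
have [c ac cx] := chart_at x.1; have [d ad dx] := chart_at x.2.
exists (prod_chart c d), d; split => //; first by exists c, d.
by exists snd; split; [exact: Cinfty_at_snd|exact: nbhs_everywhere].
Qed.

Lemma smooth_at_pair M N L {mM : is_manifold M} {mN : is_manifold N}
    {mL : is_manifold L} (f : M -> N) (g : M -> L) x :
  smooth_at f x -> smooth_at g x -> smooth_at (fun y => (f y, g y)) x.
Proof.
move=> sf sg; split.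
  by case: sf sg => + _ [+ _]; apply: filterS2 => y cf cg; exact: cvg_pair.
have [c ac cx] := chart_at x.
have [d ad dx] := chart_at (f x); have [e ae ex] := chart_at (g x).
exists c, (prod_chart d e); split => //; first by exists d, e.
have [F [CF Ff]] := smooth_at_rep sf ac cx ad dx.
have [G [CG Gg]] := smooth_at_rep sg ac cx ae ex.
exists (fun u => (F u, G u)); split; first exact: Cinfty_at_pair.
by apply: filterS2 Ff Gg => y /= -> ->.
Qed.

Lemma set_val_continuous (T : topologicalType) (U : set T) :
  continuous (set_val : set_type U -> T).
Proof. exact: initial_continuous. Qed.

Lemma smooth_at_set_val M (U : set M) {mM : is_manifold M} (x : set_type U) :
  smooth_at (set_val : set_type U -> M) x.
Proof.
split; first by apply: nbhs_everywhere; exact: set_val_continuous.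
have [c ac cx] := chart_at (set_val x).
exists (sub_chart U c), c; split => //; first by exists c.
by exists id; split; [exact: Cinfty_at_id|exact: nbhs_everywhere].
Qed.

Lemma continuous_into_set_type (S T : topologicalType) (U : set T)
    (f : S -> set_type U) x :
  {for x, continuous (set_val \o f)} -> {for x, continuous f}.
Proof.
move=> cf W [_ [[B oB <-] Bfx] BW].
have : nbhs x ((set_val \o f) @^-1` B) by apply: cf; exact: open_nbhs_nbhs.
by apply: filterS => y By; exact: BW.
Qed.

(** Charts of a subset are restrictions of charts of the ambient manifold. *)
Lemma smooth_at_into_set_type M N (U : set N) (f : M -> set_type U) x :
  smooth_at (fun y => set_val (f y)) x -> smooth_at f x.
Proof.
move=> [cf [c [d [ac cx ad dx [F [CF Ff]]]]]]; split.
  by apply: filterS cf => y; exact: continuous_into_set_type.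
exists c, (sub_chart U d); split => //; first by exists d.
by exists F; split.
Qed.

Lemma nbhs_set_type (T : topologicalType) (U : set T) (x : set_type U) (A : set T) :
  open U -> nbhs x (set_val @^-1` A) -> nbhs (set_val x) A.
Proof.
move=> oU [_ [[B oB <-] Bx] BA].
have : nbhs (set_val x) (B `&` U).
  by apply: open_nbhs_nbhs; split; [exact: openI|split => //; exact: set_valP].
apply: filterS => y [By Uy].
exact: (BA (exist _ y (mem_set Uy))).
Qed.

Lemma continuous_set_type (S T : topologicalType) (U : set S) (f : S -> T)
    (x : set_type U) : open U ->
  {for x, continuous (fun y : set_type U => f (set_val y))} ->
  {for set_val x, continuous f}.
Proof. by move=> oU cf W /cf; exact: nbhs_set_type. Qed.

Lemma smooth_at_set_type M N (U : set M) (f : M -> N) (x : set_type U) :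
  open U -> smooth_at (fun y : set_type U => f (set_val y)) x ->
  smooth_at f (set_val x).
Proof.
move=> oU [cf [c [d [[c' ac' ->] cx ad dx [F [CF Ff]]]]]]; split.
  apply: (@nbhs_set_type _ _ _ [set y | {for y, continuous f}] oU).
  by apply: filterS cf => y; exact: continuous_set_type.
exists c', d; split => //; exists F; split => //.
exact: (@nbhs_set_type _ _ _ [set y | F (c' y) = d (f y)] oU).
Qed.

Lemma cluster_continuous (S T : topologicalType) (f : S -> T) (p q : S) :
  continuous f -> cluster (nbhs p) q -> cluster (nbhs (f p)) (f q).
Proof.
by move=> cf pq A B /cf Ap /cf Bq; have [x [Ax Bx]] := pq _ _ Ap Bq; exists (f x).
Qed.

#[global] Instance prod_is_manifold M N {mM : is_manifold M} {mN : is_manifold N} :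
  is_manifold (M * N)%type.
Proof.
split.
- move=> p q pq; rewrite [p]surjective_pairing [q]surjective_pairing.
  congr pair; apply: manifold_hausdorff; apply: cluster_continuous pq.
    by move=> z; exact: cvg_fst.
  by move=> z; exact: cvg_snd.
- move=> _ [c [d [ac ad ->]]]; split => /=.
  + move=> p q pq; rewrite [p]surjective_pairing [q]surjective_pairing.
    congr pair.
      apply: (chart_hausdorff ac); apply: cluster_continuous pq.
      by move=> z; exact: cvg_fst.
    apply: (chart_hausdorff ad); apply: cluster_continuous pq.
    by move=> z; exact: cvg_snd.
  + by apply: open_setX; exact: chart_open_dom.
  + move=> [x y] [x' y'] /set_mem[/= cx dy] /set_mem[/= cx' dy'] [].
    move=> /(chart_inj ac (mem_set cx) (mem_set cx')) ->.
    by move=> /(chart_inj ad (mem_set dy) (mem_set dy')) ->.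
  + move=> [x y] [/= cx dy].
    apply: cvg_pair.
      by apply: (cvg_comp _ _ cvg_fst); exact: chart_continuous.
    by apply: (cvg_comp _ _ cvg_snd); exact: chart_continuous.
  + move=> V VD oV; rewrite openE => _ [[x y] Vxy <-].
    have [cx dy] := VD _ Vxy.
    have [[A B] /= [Ax By] ABV] : nbhs (x, y) V by exact: open_nbhs_nbhs.
    have : nbhs x (A `&` chart_dom c).
      by apply: filterI => //; apply: open_nbhs_nbhs; split => //; exact: chart_open_dom.
    have : nbhs y (B `&` chart_dom d).
      by apply: filterI => //; apply: open_nbhs_nbhs; split => //; exact: chart_open_dom.
    rewrite !nbhsE => -[B' [oB' B'y] B'B] [A' [oA' A'x] A'A].
    exists (c @` A', d @` B').
      split; apply: open_nbhs_nbhs; split => /=; [|by exists x| |by exists y].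
        by apply: chart_open_image => // z /A'A[].
      by apply: chart_open_image => // z /B'B[].
    move=> [_ _] [/= [x' /A'A[Ax' _] <-] [y' /B'B[By' _] <-]].
    by exists (x', y') => //; exact: (ABV (x', y')).
- move=> [x y]; have [c ac cx] := chart_at x; have [d ad dy] := chart_at y.
  by exists (prod_chart c d) => //; exists c, d.
- move=> _ _ [c [d [ac ad ->]]] [c' [d' [ac' ad' ->]]].
  have [F Ff CF] := transition ac ac'; have [G Gg CG] := transition ad ad'.
  exists (fun p => (F p.1, G p.2)).
    by move=> [x y] [[/= cx dy] [/= c'x d'y]]; rewrite Ff ?Gg.
  set A := c @` _ in CF; set B := d @` _ in CG.
  have oA : open A.
    by apply: chart_open_image => //; apply: openI; exact: chart_open_dom.
  have oB : open B.
    by apply: chart_open_image => //; apply: openI; exact: chart_open_dom.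
  move=> n; apply: (@Cn_on_sub _ _ _ _ (A `*` B)).
    move=> _ [[x y] [[/= cx dy] [/= c'x d'y]] <-].
    by split => /=; [exists x|exists y].
  have oAB := open_setX oA oB.
  apply: Cn_on_pair.
    apply: (@Cn_on_comp _ _ _ _ n (A `*` B) A fst F) => //; first by move=> z [].
    exact: Cn_on_fst.
  apply: (@Cn_on_comp _ _ _ _ n (A `*` B) B snd G) => //; first by move=> z [].
  exact: Cn_on_snd.
Qed.

Lemma open_is_manifold M {mM : is_manifold M} (U : set M) :
  open U -> is_manifold (set_type U).
Proof.
move=> oU; split.
- move=> p q pq; apply: val_inj; apply: (@manifold_hausdorff M).
  by apply: (cluster_continuous (f := set_val)) pq; exact: set_val_continuous.
- move=> _ [c ac ->]; split => /=.
  + exact: chart_hausdorff.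
  + by exists (chart_dom c) => //; exact: chart_open_dom.
  + move=> x y /set_mem cx /set_mem cy cxy; apply: val_inj.
    exact: (chart_inj ac (mem_set cx) (mem_set cy)).
  + move=> x cx; apply: (@continuous_comp _ _ _ set_val c); last exact: chart_continuous.
    exact: set_val_continuous.
  + move=> V VD [B oB BV]; subst V.
    have -> : (fun x : set_type U => c (set_val x)) @` (set_val @^-1` B) = c @` (B `&` U).
      apply/seteqP; split => [_ [x Bx <-]|_ [x [Bx Ux] <-]].
        by exists (set_val x) => //; split => //; exact: set_valP.
      by exists (exist _ x (mem_set Ux)).
    apply: chart_open_image => //; last exact: openI.
    by move=> x [Bx Ux]; exact: (VD (exist _ x (mem_set Ux))).
- by move=> x; have [c ac cx] := chart_at (set_val x); exists (sub_chart U c) => //; exists c.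
- move=> _ _ [c ac ->] [d ad ->]; have [F Ff CF] := transition ac ad.
  exists F; first by move=> x [cx dx]; exact: (Ff (set_val x)).
  move=> n; apply: Cn_on_sub (CF n) => _ [x [cx dx] <-].
  by exists (set_val x).
Qed.

Lemma smooth_onP M N {mM : is_manifold M} {mN : is_manifold N} (U : set M)
    (f : M -> N) : open U ->
  smooth_on U f <-> forall x, U x -> smooth_at f x.
Proof.
move=> oU; have mU := open_is_manifold oU; split => [sf x Ux|sf].
  pose x' : set_type U := exist _ x (mem_set Ux).
  by apply: (@smooth_at_set_type _ _ U f x') => //; exact: smooth_smooth_at.
apply: smooth_at_smooth => x; apply: smooth_at_comp; last exact: smooth_at_set_val.
by apply: sf; exact: set_valP.
Qed.

End Manifolds.

(** * Discrete index sets *)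

(** The disjoint union of open subsets [U i] of [M] is an open subset of
    [discrete_index I * M]; this gives it a smooth structure from products and
    open subsets. *)
Definition discrete_index (I : Type) : Type := I.

HB.instance Definition _ (I : Type) := gen_eqMixin (discrete_index I).
HB.instance Definition _ (I : Type) := gen_choiceMixin (discrete_index I).
HB.instance Definition _ (I : Type) :=
  hasNbhs.Build (discrete_index I) principal_filter.
HB.instance Definition _ (I : Type) :=
  Discrete_ofNbhs.Build (discrete_index I) erefl.

(** Points of a discrete space are open, so its model has dimension zero. *)
Definition point_chart (R : realType) (I : Type) (i : I) :
    chart R (discrete_index I) :=
  @Chart R (discrete_index I) 'rV[R]_0 [set i] (fun=> 0).

HB.instance Definition _ (R : realType) (I : Type) :=
  hasAtlas.Build R (discrete_index I) (fun c => exists i : I, c = point_chart R i).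

Section Discrete.
Variables (R : realType) (I : Type).

Lemma nbhs_discrete (i : discrete_index I) (A : set (discrete_index I)) : A i -> nbhs i A.
Proof. by move=> Ai; apply/principal_filterP. Qed.

Lemma open_discrete (A : set (discrete_index I)) : open A.
Proof. by rewrite openE => i Ai; exact: nbhs_discrete. Qed.

Lemma continuous_discrete (T : topologicalType) (f : discrete_index I -> T) : continuous f.
Proof. by move=> i A Afi; apply: (@nbhs_discrete i (f @^-1` A)); exact: (nbhs_singleton Afi). Qed.

#[global] Instance discrete_is_manifold : is_manifold (discrete_index I : chartedType R).
Proof.
have rv0 (u v : 'rV[R]_0) : u = v by apply/matrixP => i [].
split.
- exact: discrete_hausdorff.
- move=> _ [i ->]; split => /=.
  + exact: norm_hausdorff.
  + exact: open_discrete.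
  + by move=> j k /set_mem ji /set_mem ki _; rewrite [j]ji [k]ki.
  + by move=> j _; exact: continuous_discrete.
  + move=> V _ _; have [[j Vj]|nV] := pselect (exists j, V j).
      suff -> : (fun=> 0) @` V = [set: 'rV[R]_0] by exact: openT.
      by apply/seteqP; split => // u _; exists j => //; exact: rv0.
    suff -> : (fun=> 0) @` V = (set0 : set 'rV[R]_0) by exact: open0.
    by apply/seteqP; split => // u [j Vj _]; case: nV; exists j.
- by move=> i; exists (point_chart R i) => //; exists i.
- move=> _ _ [i ->] [j ->]; exists (fun=> 0) => // n; exact: Cn_on_cst.
Qed.

Lemma near_discrete (T : topologicalType) (f : T -> discrete_index I) (x : T) :
  {for x, continuous f} -> \forall y \near x, f y = f x.
Proof. by move=> cf; apply: (cf [set i | i = f x]); exact: nbhs_discrete. Qed.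

End Discrete.

Local Close Scope ring_scope.
Local Open Scope group_scope.

(** * Crossed modules, composition of morphisms and actions *)

Section CrossedModule.
Variables (R : realType) (X : crossed_module R).
Implicit Types (g k : cmG X) (h l : cmH X).

Lemma cm_actK g : cancel (cm_act g) (@cm_act R X g^-1).
Proof. by move=> h; rewrite -cm_actM mulVg cm_act1. Qed.

Lemma cm_actVK g : cancel (cm_act g^-1) (@cm_act R X g).
Proof. by move=> h; rewrite -cm_actM mulgV cm_act1. Qed.

Lemma cm_act_inj g : injective (@cm_act R X g).
Proof. exact: can_inj (cm_actK g). Qed.

Lemma cm_actV g h : cm_act g h^-1 = (cm_act g h)^-1.
Proof. by apply/esym/mulg1_eq; rewrite -cm_actMr mulgV cm_actr1. Qed.

Lemma cm_betaV h : cm_beta h^-1 = (cm_beta h)^-1.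
Proof. by apply/esym/mulg1_eq; rewrite -cm_betaM mulgV cm_beta1. Qed.

Lemma cm_act_beta h l : cm_act (cm_beta h) l * h = h * l.
Proof. by rewrite cm_peiffer mulgVK. Qed.

End CrossedModule.

Definition open_manifold (R : realType) (M : chartedType R) (mM : is_manifold M)
    (U : set M) (oU : open U) : manifoldType R :=
  HB.pack_for (manifoldType R) (set_type U)
    (Charted_isManifold.Build R (set_type U) (open_is_manifold oU)).

Section TotalComposition.
Variables (R : realType) (C : category R).
Implicit Types f g h : mor C.

(** Composition as a total operation, so that terms do not contain proofs of
    composability; the value on a pair that is not composable is arbitrary. *)
Definition compm f g : mor C :=
  if pselect (src f = tgt g) is left e then cmp f g e else f.

Lemma compmE f g (e : src f = tgt g) : compm f g = cmp f g e.
Proof.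
rewrite /compm; case: pselect => // e'; congr cmp; exact: Prop_irrelevance.
Qed.

Lemma src_compm f g : src f = tgt g -> src (compm f g) = src g.
Proof. by move=> e; rewrite (compmE e) src_cmp. Qed.

Lemma tgt_compm f g : src f = tgt g -> tgt (compm f g) = tgt f.
Proof. by move=> e; rewrite (compmE e) tgt_cmp. Qed.

Lemma compm_idl f x : tgt f = x -> compm (idm x) f = f.
Proof.
move=> <-; have e : src (idm (tgt f)) = tgt f by rewrite src_idm.
by rewrite (compmE e) cmp_idl.
Qed.

Lemma compm_idr f x : src f = x -> compm f (idm x) = f.
Proof.
move=> <-; have e : src f = tgt (idm (src f)) by rewrite tgt_idm.
by rewrite (compmE e) cmp_idr.
Qed.

Lemma compmA f g h : src f = tgt g -> src g = tgt h ->
  compm f (compm g h) = compm (compm f g) h.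
Proof.
move=> e1 e2; rewrite (compmE e2) (compmE e1).
have e3 : src f = tgt (cmp g h e2) by rewrite tgt_cmp.
have e4 : src (cmp f g e1) = tgt h by rewrite src_cmp.
by rewrite (compmE e3) (compmE e4); exact: cmpA.
Qed.

Lemma isoP f : iso f <->
  exists g, [/\ src f = tgt g, src g = tgt f, compm f g = idm (tgt f) &
                compm g f = idm (src f)].
Proof.
split.
  by move=> [g [e [e' [eq eq']]]]; exists g; split; rewrite ?(compmE e) ?(compmE e').
by move=> [g [e e']]; rewrite (compmE e) (compmE e') => eq eq'; exists g, e, e'.
Qed.

Lemma iso_compm f g : src f = tgt g -> iso f -> iso g -> iso (compm f g).
Proof.
move=> fg /isoP[f' [e1 e2 e3 e4]] /isoP[g' [k1 k2 k3 k4]]; apply/isoP.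
have gf : src g' = tgt f' by rewrite k2 -fg e1.
exists (compm g' f'); rewrite !src_compm ?tgt_compm //; split => //.
- rewrite -compmA ?tgt_compm// (compmA k1 gf) k3.
  by rewrite (@compm_idl f') ?e3// -e1.
- rewrite -compmA ?tgt_compm// (compmA e2 fg) e4.
  by rewrite (@compm_idl g) ?k4// -fg.
Qed.

Lemma compm_iso_injr f g g' : iso f -> src g = tgt f -> src g' = tgt f ->
  compm g f = compm g' f -> g = g'.
Proof.
move=> /isoP[k [e1 e2 e3 e4]] fg fg' eq.
rewrite -[g](@compm_idr _ (tgt f))// -[g'](@compm_idr _ (tgt f))// -e3.
by rewrite !compmA// eq.
Qed.

(** Near [x] the pair [(f, g)] is a map into the manifold of composable pairs,
    smooth by the universal property of the latter. *)
Lemma smooth_at_compm_2space (mC : smooth_2space C) (N : chartedType R)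
    {mN : is_manifold N} (f g : N -> mor C) x :
  (\forall y \near x, src (f y) = tgt (g y)) ->
  smooth_at f x -> smooth_at g x -> smooth_at (fun y => compm (f y) (g y)) x.
Proof.
case: mC => -[mo mm ss st si] [D [p [q [e [Dex sp sq Duniv Dcmp]]]]].
have mmor : is_manifold (mor C) := mm.
move=> fg sf sg.
have := nbhs_setI fg (nbhs_setI (smooth_at_nbhs sf) (smooth_at_nbhs sg)).
rewrite nbhsE => -[W [oW Wx] WP].
have mW : is_manifold (set_type W) by exact: open_is_manifold.
pose W' : manifoldType R := open_manifold mN oW.
have /choice[k kP] : forall y : W', exists d, p d = f (set_val y) /\ q d = g (set_val y).
  move=> y; have [fgy _] := WP _ (set_valP y).
  by have [d [dP _]] := Dex _ _ fgy; exists d.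
have sk : smooth (k : W' -> D).
  apply: Duniv.
    suff : smooth (fun y : set_type W => f (set_val y)).
      by congr smooth; apply: funext => y /=; case: (kP y).
    apply/smooth_onP => // y /WP[_ []//].
  suff : smooth (fun y : set_type W => g (set_val y)).
    by congr smooth; apply: funext => y /=; case: (kP y).
  by apply/smooth_onP => // y /WP[_ []].
have xW : W x by [].
pose x' : set_type W := exist _ x (mem_set xW).
apply: (@smooth_at_set_type _ _ _ W _ x') => //.
have : smooth_at (fun y : W' => cmp (p (k y)) (q (k y)) (e (k y))) x'.
  apply: (@smooth_at_comp _ W' D _ _ _ _ k (fun d => cmp (p d) (q d) (e d))).
    exact: smooth_smooth_at.
  exact: smooth_smooth_at.
congr smooth_at; apply: funext => y; rewrite -(compmE (e (k y))).
by case: (kP y) => -> ->.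
Qed.

End TotalComposition.

Lemma smooth_at_smooth_comp (R : realType) (M N L : chartedType R) {mM : is_manifold M}
    {mN : is_manifold N} {mL : is_manifold L} (g : N -> L) (f : M -> N) x :
  smooth g -> smooth_at f x -> smooth_at (fun y => g (f y)) x.
Proof. by move=> sg; apply: smooth_at_comp; exact: smooth_smooth_at. Qed.

Section SmoothRules.
Variables (R : realType) (X : crossed_module R) (N : chartedType R).
Context {mN : is_manifold N}.
Implicit Types (x : N).

Lemma smooth_at_mulg (G : lieGroupType R) (f g : N -> G) x :
  smooth_at f x -> smooth_at g x -> smooth_at (fun y => f y * g y) x.
Proof.
move=> sf sg; exact: (smooth_at_smooth_comp (@mulg_smooth _ G) (smooth_at_pair sf sg)).
Qed.

Lemma smooth_at_invg (G : lieGroupType R) (f : N -> G) x :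
  smooth_at f x -> smooth_at (fun y => (f y)^-1) x.
Proof.
exact: (smooth_at_smooth_comp (@invg_smooth _ G)).
Qed.

Lemma smooth_at_beta (f : N -> cmH X) x :
  smooth_at f x -> smooth_at (fun y => cm_beta (f y)) x.
Proof.
exact: (smooth_at_smooth_comp (@cm_beta_smooth _ X)).
Qed.

Lemma smooth_at_act (f : N -> cmG X) (g : N -> cmH X) x :
  smooth_at f x -> smooth_at g x -> smooth_at (fun y => cm_act (f y) (g y)) x.
Proof.
move=> sf sg; exact: (smooth_at_smooth_comp (@cm_act_smooth _ X) (smooth_at_pair sf sg)).
Qed.

End SmoothRules.

Section Action.
Variables (R : realType) (X : crossed_module R) (P : g2space X).
Implicit Types (p q : ob P) (f g : mor P) (k : cmG X) (a : cmH X * cmG X).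

Definition actO p k : ob P := fob (g2act P) (p, k).
Definition actM f a : mor P := fmor (g2act P) (f, a).

Lemma actO1 p : actO p 1 = p.
Proof. exact: g2act_ob1. Qed.

Lemma actOM p k k' : actO p (k * k') = actO (actO p k) k'.
Proof. exact: g2act_obM. Qed.

Lemma actMM f a a' : actM (actM f a) a' = actM f (sdmul a a').
Proof. by rewrite /actM g2act_morM. Qed.

Lemma src_actM f a : src (actM f a) = actO (src f) a.2.
Proof. exact: (src_fmor (g2act P)). Qed.

Lemma tgt_actM f a : tgt (actM f a) = actO (tgt f) (cm_beta a.1 * a.2).
Proof. exact: (tgt_fmor (g2act P)). Qed.

Lemma actM_idm p k : actM (idm p) (1, k) = idm (actO p k).
Proof. exact: (fmor_idm (g2act P) (p, k)). Qed.

(** Functoriality of the action on a composite of pairs. *)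
Lemma actM_compm f f' h h' k k' : src f = tgt f' -> k = cm_beta h' * k' ->
  actM (compm f f') (h * h', k') = compm (actM f (h, k)) (actM f' (h', k')).
Proof.
move=> e ek.
have e2 : @src R (prod_category P (lie2group X)) (f, (h, k)) =
          tgt ((f', (h', k')) : mor (prod_category P (lie2group X))).
  by rewrite /= e ek.
have e3 : src (actM f (h, k)) = tgt (actM f' (h', k')).
  by rewrite src_actM tgt_actM e ek.
rewrite (compmE e) (compmE e3) -(fmor_cmp e2 e3) /=.
by rewrite /actM; congr fmor; congr pair; congr cmp; exact: Prop_irrelevance.
Qed.

End Action.

(** * Local trivialisations as frames *)

Lemma fmor_compm (R : realType) (C D : category R) (F : functor C D) (f g : mor C) :
  src f = tgt g -> fmor F (compm f g) = compm (fmor F f) (fmor F g).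
Proof.
move=> e; have e' : src (fmor F f) = tgt (fmor F g) by rewrite src_fmor tgt_fmor e.
by rewrite (compmE e) (compmE e') (fmor_cmp e e').
Qed.

Lemma total_extension (S T : Type) (A : set S) (f : set_type A -> T) (d : S -> T) :
  exists F : S -> T, forall x : set_type A, F (set_val x) = f x.
Proof.
exists (fun x => if pselect (A x) is left u then f (exist _ x (mem_set u)) else d x).
move=> x; case: pselect => [u|nu]; last by case: nu; exact: set_valP.
by congr f; exact: val_inj.
Qed.

Section SmoothTotal.
Variables (R : realType) (X : crossed_module R) (M : manifoldType R).

(** What a bundle is apart from local triviality.  The 2-space of a cocycle must be
    known to have it before local trivialisations of it make sense. *)
Class smooth_over (P : over_g2space X M) : Prop :=
  smooth_overP : smooth_g2space P /\ smooth_functor (g2proj P).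

Context (P : over_g2space X M) {sP : smooth_over P}.

Definition proj (p : ob P) : M := fob (g2proj P) p.

#[global] Instance ob_is_manifold : is_manifold (ob P).
Proof. by case: sP => -[[[]]]. Qed.

#[global] Instance mor_is_manifold : is_manifold (mor P).
Proof. by case: sP => -[[[]]]. Qed.

Lemma proj_tgt (f : mor P) : proj (tgt f) = proj (src f).
Proof. by rewrite /proj over_tgt over_src. Qed.

Lemma proj_actO (p : ob P) k : proj (actO p k) = proj p.
Proof. exact: g2proj_act. Qed.

Variables (N : chartedType R).
Context {mN : is_manifold N}.

Lemma smooth_at_src (f : N -> mor P) x :
  smooth_at f x -> smooth_at (fun y => src (f y)) x.
Proof. by apply: smooth_at_smooth_comp; case: sP => -[[[]]]. Qed.

Lemma smooth_at_idm (f : N -> ob P) x :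
  smooth_at f x -> smooth_at (fun y => idm (f y)) x.
Proof. by apply: smooth_at_smooth_comp; case: sP => -[[[]]]. Qed.

Lemma smooth_at_proj (f : N -> ob P) x :
  smooth_at f x -> smooth_at (fun y => proj (f y)) x.
Proof. by apply: smooth_at_smooth_comp; case: sP => _ []. Qed.

Lemma smooth_at_actO (f : N -> ob P) (g : N -> cmG X) x :
  smooth_at f x -> smooth_at g x -> smooth_at (fun y => actO (f y) (g y)) x.
Proof.
move=> sf sg; have sm : smooth (fob (g2act P)) by case: sP => -[_ []].
exact: (smooth_at_smooth_comp sm (smooth_at_pair sf sg)).
Qed.

Lemma smooth_at_actM (f : N -> mor P) (a : N -> cmH X * cmG X) x :
  smooth_at f x -> smooth_at a x -> smooth_at (fun y => actM (f y) (a y)) x.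
Proof.
move=> sf sg; have sm : smooth (fmor (g2act P)) by case: sP => -[_ []].
exact: (smooth_at_smooth_comp sm (smooth_at_pair sf sg)).
Qed.

Lemma smooth_at_compm (f g : N -> mor P) x :
  (\forall y \near x, src (f y) = tgt (g y)) ->
  smooth_at f x -> smooth_at g x -> smooth_at (fun y => compm (f y) (g y)) x.
Proof. by apply: smooth_at_compm_2space; case: sP => -[]. Qed.

End SmoothTotal.
Arguments proj {R X M P}.

Section Frames.
Variables (R : realType) (X : crossed_module R) (M : manifoldType R).
Implicit Types (P : over_g2space X M) (U : set M).

(** A local trivialisation in coordinates: it stands for
    [Phi p = (proj p, fr_ob p)] on objects,
    [Phi f = (proj f, (fr_mor f, fr_ob (src f)))] on morphisms,
    [Phi' (x, k) = fr_sec x . k] and for the transformation [fr_iso] from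
    [Phi' \o Phi] to the identity.  All four are total functions whose values
    away from the open set of the trivialisation are arbitrary. *)
Record frame P := Frame {
  fr_ob : ob P -> cmG X ;
  fr_mor : mor P -> cmH X ;
  fr_sec : M -> ob P ;
  fr_iso : ob P -> mor P }.

(** Faithfulness, [fr_faithful], takes the place of naturality of [fr_iso], from
    which it follows; it is what comparing morphisms requires. *)
Record is_frame P U (t : frame P) : Prop := IsFrame {
  fr_ob_smooth : forall p, U (proj p) -> smooth_at (fr_ob t) p ;
  fr_mor_smooth : forall f, U (proj (src f)) -> smooth_at (fr_mor t) f ;
  fr_sec_smooth : forall x, U x -> smooth_at (fr_sec t) x ;
  fr_iso_smooth : forall p, U (proj p) -> smooth_at (fr_iso t) p ;
  fr_ob_act : forall p g, U (proj p) -> fr_ob t (actO p g) = fr_ob t p * g ;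
  fr_mor_act : forall f a, U (proj (src f)) ->
    fr_mor t (actM f a) = fr_mor t f * cm_act (fr_ob t (src f)) a.1 ;
  fr_ob_tgt : forall f, U (proj (src f)) ->
    fr_ob t (tgt f) = cm_beta (fr_mor t f) * fr_ob t (src f) ;
  fr_mor_idm : forall p, U (proj p) -> fr_mor t (idm p) = 1 ;
  fr_mor_compm : forall f g, U (proj (src g)) -> src f = tgt g ->
    fr_mor t (compm f g) = fr_mor t f * fr_mor t g ;
  proj_fr_sec : forall x, U x -> proj (fr_sec t x) = x ;
  src_fr_iso : forall p, U (proj p) ->
    src (fr_iso t p) = actO (fr_sec t (proj p)) (fr_ob t p) ;
  tgt_fr_iso : forall p, U (proj p) -> tgt (fr_iso t p) = p ;
  iso_fr_iso : forall p, U (proj p) -> iso (fr_iso t p) ;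
  fr_faithful : forall f f', U (proj (src f)) -> src f = src f' ->
    tgt f = tgt f' -> fr_mor t f = fr_mor t f' -> f = f' }.

(** The two conditions say that [Phi \o Phi'] is the identity and that
    [Phi (fr_iso p)] is an identity morphism. *)
Definition strict_frame P U (t : frame P) : Prop :=
  [/\ is_frame U t, forall x, U x -> fr_ob t (fr_sec t x) = 1 &
      forall p, U (proj p) -> fr_mor t (fr_iso t p) = 1].

End Frames.

Section Restriction.
Variables (R : realType) (X : crossed_module R) (M : manifoldType R).
Variables (P : over_g2space X M) (sP : smooth_over P) (U : set M) (oU : open U).

Lemma open_over : open (proj @^-1` U : set (ob P)).
Proof.
apply: open_comp => // p _; apply: smooth_at_continuous.
by apply: smooth_at_proj; exact: smooth_at_id.
Qed.

Lemma open_over_mor : open (fmor (g2proj P) @^-1` U : set (mor P)).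
Proof.
apply: open_comp => // p _; apply: (@smooth_at_continuous _ (mor P) M).
apply: smooth_smooth_at; by case: sP => _ [].
Qed.

#[local] Instance restr_ob_manifold : is_manifold (ob (restr P U)).
Proof. exact: (open_is_manifold open_over). Qed.

#[local] Instance restr_mor_manifold : is_manifold (mor (restr P U)).
Proof. exact: (open_is_manifold open_over_mor). Qed.

#[local] Instance U_manifold : is_manifold (set_type U).
Proof. exact: open_is_manifold. Qed.

Lemma over_mem (p : ob P) : U (proj p) -> exists p' : ob (restr P U), set_val p' = p.
Proof. by move=> Up; exists (exist _ p (mem_set Up)). Qed.

Lemma over_mem_mor (f : mor P) : U (proj (src f)) ->
  exists f' : mor (restr P U), set_val f' = f.
Proof. by rewrite /proj over_src => Uf; exists (exist _ f (mem_set Uf)). Qed.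

Lemma over_val (p : ob (restr P U)) : U (proj (set_val p)).
Proof. exact: (set_valP p). Qed.

Lemma over_val_mor (f : mor (restr P U)) : U (proj (src (set_val f))).
Proof. by rewrite /proj over_src; exact: (set_valP f). Qed.

Lemma compm_val (f g : mor (restr P U)) : src f = tgt g ->
  set_val (compm f g) = compm (set_val f) (set_val g).
Proof. by move=> e; rewrite (compmE e) (compmE (congr1 set_val e)). Qed.

Lemma iso_val (f : mor (restr P U)) : iso f -> iso (set_val f).
Proof.
move=> /isoP[g [e1 e2 e3 e4]]; apply/isoP; exists (set_val g); split.
- exact: (congr1 set_val e1).
- exact: (congr1 set_val e2).
- by rewrite -compm_val// e3.
- by rewrite -compm_val// e4.
Qed.

Lemma val_iso (f : mor (restr P U)) : iso (set_val f) -> iso f.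
Proof.
move=> /isoP[g [e1 e2 e3 e4]].
have Ug : U (proj (src g)) by rewrite e2 proj_tgt; exact: over_val_mor.
have [g' g'g] := over_mem_mor Ug; rewrite -g'g in e1 e2 e3 e4.
have k1 : src f = tgt g' by apply: val_inj.
have k2 : src g' = tgt f by apply: val_inj.
apply/isoP; exists g'; split => //.
- by apply: val_inj; rewrite [LHS]compm_val// e3.
- by apply: val_inj; rewrite [LHS]compm_val// e4.
Qed.

End Restriction.

Section Unpack.
Variables (R : realType) (X : crossed_module R) (M : manifoldType R).
Variables (P : over_g2space X M) (sP : smooth_over P) (U : set M) (oU : open U).
Variables (Phi : functor (restr P U) (triv_g2space X (set_type U)))
  (Phi' : functor (triv_g2space X (set_type U)) (restr P U))
  (tau : ob (restr P U) -> mor (restr P U)).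

Definition frame_of (t : frame P) : Prop :=
  [/\ forall p, fr_ob t (set_val p) = (fob Phi p).2,
      forall f, fr_mor t (set_val f) = (fmor Phi f).2.1,
      forall x, fr_sec t (set_val x) = set_val (fob Phi' (x, 1)) &
      forall p, fr_iso t (set_val p) = set_val (tau p)].

(** A map into the objects of [P] has no natural value off [U]; [s0] provides one. *)
Lemma exists_frame (s0 : M -> ob P) : exists t, frame_of t.
Proof.
have [f0 f0P] := total_extension (fun p => (fob Phi p).2) (fun=> 1).
have [f1 f1P] := total_extension (fun f => (fmor Phi f).2.1) (fun=> 1).
have [s sE] := total_extension (fun x => set_val (fob Phi' (x, 1))) s0.
have [i iE] := total_extension (fun p => set_val (tau p)) (fun p => idm p).
by exists (Frame f0 f1 s i).
Qed.

Hypothesis triv : trivialisation Phi Phi'.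
Hypothesis tau2 : is_2isomorphism (comp_functor Phi' Phi) (id_functor _) tau.

(** Faithfulness: by naturality, composing [f] with the isomorphism
    [tau (src f)] gives [tau (tgt f)] composed with [Phi' (Phi f)], so [f] is
    determined by [Phi f]. *)
Lemma frame_of_is_frame t : frame_of t -> is_frame U t.
Proof.
move=> [obE morE secE isoE].
have [[[sPhi0 sPhi1] PhiO PhiM] [[[sPhi'0 sPhi'1] Phi'O Phi'M] _ _]
  [prO prM] [pr'O pr'M]] := triv.
have [[stau tauE taunat tauact] tauiso] := tau2.
have mo := restr_ob_manifold sP oU.
have mm := restr_mor_manifold sP oU.
have mU := U_manifold oU.
have oO := open_over sP oU; have oM := open_over_mor sP oU.
have srcE (f : mor (restr P U)) :
    (fmor Phi f).2.2 = fr_ob t (src (set_val f)).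
  have /(congr1 snd) /= -> := src_fmor Phi f.
  by rewrite -obE.
have PhiE (p : ob (restr P U)) (x : set_type U) : set_val x = proj (set_val p) ->
    fob Phi p = (x, fr_ob t (set_val p)).
  move=> xp; rewrite obE [LHS]surjective_pairing; congr pair.
  by apply: val_inj; exact: (etrans (prO p) (esym xp)).
have Phi'E y : set_val (fob Phi' y) = actO (fr_sec t (set_val y.1)) y.2.
  rewrite secE; have := Phi'O (y.1, 1) y.2.
  by rewrite /= mul1g -surjective_pairing => ->.
have sobE : (fun y : set_type (proj @^-1` U) => fr_ob t (set_val y)) =
    (fun y => snd (fob Phi y)) by apply: funext => y; rewrite obE.
have smorE : (fun y : mor (restr P U) => fr_mor t (set_val y)) =
    (fun y => fst (snd (fmor Phi y))) by apply: funext => y; rewrite morE.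
have ssecE : (fun x : set_type U => fr_sec t (set_val x)) =
    (fun x => set_val (fob Phi' (x, 1))) by apply: funext => y; rewrite secE.
have sisoE : (fun y : ob (restr P U) => fr_iso t (set_val y)) =
    (fun y => set_val (tau y)) by apply: funext => y; rewrite isoE.
split.
- move=> p /over_mem[p' <-]; apply: smooth_at_set_type => //; rewrite sobE.
  apply: smooth_at_comp; first exact: smooth_at_snd.
  exact: smooth_smooth_at.
- move=> f /over_mem_mor[f' <-]; apply: (@smooth_at_set_type _ (mor P)) => //.
  rewrite smorE; apply: smooth_at_comp; first exact: smooth_at_fst.
  apply: smooth_at_comp; first exact: smooth_at_snd.
  exact: smooth_smooth_at.
- move=> x Ux; pose x' : set_type U := exist _ x (mem_set Ux).
  apply: (@smooth_at_set_type _ _ _ U _ x') => //; rewrite ssecE.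
  apply: smooth_at_comp; first exact: smooth_at_set_val.
  apply: smooth_at_comp; first exact: smooth_smooth_at.
  by apply: smooth_at_pair; [exact: smooth_at_id|exact: smooth_at_cst].
- move=> p /over_mem[p' <-]; apply: smooth_at_set_type => //; rewrite sisoE.
  apply: smooth_at_comp; first exact: smooth_at_set_val.
  exact: smooth_smooth_at.
- move=> p g /over_mem[p' <-]; rewrite obE.
  apply: etrans (obE (@actO _ _ (restr P U) p' g)) _.
  by rewrite [fob Phi _](PhiO p' g).
- move=> f a /over_mem_mor[f' <-]; rewrite morE -srcE.
  apply: etrans (morE (@actM _ _ (restr P U) f' a)) _.
  by rewrite [fmor Phi _](PhiM f' a).
- move=> f /over_mem_mor[f' <-]; rewrite morE -srcE.
  apply: etrans (obE (tgt f')) _.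
  by rewrite -tgt_fmor.
- move=> p /over_mem[p' <-]; apply: etrans (morE (idm p')) _.
  by rewrite fmor_idm.
- move=> f g Ug fg; have Uf : U (proj (src f)) by rewrite fg proj_tgt.
  have [f' f'f] := over_mem_mor Uf; have [g' g'g] := over_mem_mor Ug.
  have e : src f' = tgt g' by apply: val_inj; rewrite /= f'f g'g.
  rewrite -f'f -g'g -compm_val// !morE fmor_compm//.
  have e' : src (fmor Phi f') = tgt (fmor Phi g') by rewrite src_fmor tgt_fmor e.
  by rewrite (compmE e').
- move=> x Ux; pose x' : set_type U := exist _ x (mem_set Ux).
  by have := secE x'; rewrite /= => ->; rewrite /proj pr'O.
- move=> p /over_mem[p' <-]; rewrite isoE.
  apply: etrans (congr1 set_val (tauE p').1) _; apply: etrans (Phi'E _) _.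
  by rewrite -obE; congr (actO (fr_sec t _) _); exact: prO.
- move=> p /over_mem[p' <-]; rewrite isoE.
  exact: (congr1 set_val (tauE p').2).
- by move=> p /over_mem[p' <-]; rewrite isoE; apply: iso_val.
- move=> f g Uf sfg tfg mfg.
  have Ug : U (proj (src g)) by rewrite -sfg.
  have [f' f'f] := over_mem_mor Uf; have [g' g'g] := over_mem_mor Ug.
  have Phifg : fmor Phi f' = fmor Phi g'.
    rewrite [LHS]surjective_pairing [RHS]surjective_pairing; congr pair.
      apply: val_inj; apply: etrans (prM _) (etrans _ (esym (prM _))).
      by rewrite -!over_src f'f g'g sfg.
    rewrite [LHS]surjective_pairing [RHS]surjective_pairing; congr pair.
      by rewrite -!morE f'f g'g.
    by rewrite !srcE f'f g'g sfg.
  have sfg' : src f' = src g' by apply: val_inj; rewrite /= f'f g'g.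
  have tfg' : tgt f' = tgt g' by apply: val_inj; rewrite /= f'f g'g.
  have nat (h : mor (restr P U)) : compm h (tau (src h)) =
      compm (tau (tgt h)) (fmor Phi' (fmor Phi h)).
    have e1 : src (tau (tgt h)) = tgt (fmor Phi' (fmor Phi h)).
      by rewrite (tauE _).1 !tgt_fmor.
    have e2 : src h = tgt (tau (src h)) by rewrite (tauE _).2.
    by rewrite (compmE e1) (compmE e2); exact/esym/taunat.
  rewrite -f'f -g'g; congr set_val.
  apply: (@compm_iso_injr _ _ (tau (src f'))) => //.
  - by rewrite (tauE _).2.
  - by rewrite (tauE _).2 -sfg'.
  - by rewrite nat sfg' nat tfg' Phifg.
Qed.

End Unpack.

(** * From strict frames to local trivialisations *)

Section FrameFaithful.
Variables (R : realType) (X : crossed_module R) (M : manifoldType R).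
Variables (P : over_g2space X M) (U : set M) (t : frame P).
Hypothesis tP : strict_frame U t.

(** Both sides have the same endpoints and trivial coordinate, hence agree by
    faithfulness. *)
Lemma fr_iso_act p k : U (proj p) ->
  fr_iso t (actO p k) = actM (fr_iso t p) (1, k).
Proof.
move=> Up; have [tF t1 tm1] := tP; have Upk : U (proj (actO p k)) by rewrite proj_actO.
have Us : U (proj (fr_sec t (proj p))) by rewrite (proj_fr_sec tF).
apply: (fr_faithful tF).
- by rewrite (src_fr_iso tF)// proj_actO proj_actO (proj_fr_sec tF).
- rewrite src_actM !(src_fr_iso tF)// proj_actO (fr_ob_act tF)//.
  by rewrite actOM.
- by rewrite tgt_actM !(tgt_fr_iso tF)//= cm_beta1 mul1g.
- rewrite (fr_mor_act tF) ?(src_fr_iso tF)// ?proj_actO ?(proj_fr_sec tF)//.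
  by rewrite !tm1// mul1g cm_actr1.
Qed.

(** Naturality is recovered from faithfulness, as the coordinates of
    [fr_iso] are trivial. *)
Lemma fr_iso_natural f : U (proj (src f)) ->
  compm f (fr_iso t (src f)) =
  compm (fr_iso t (tgt f))
    (actM (idm (fr_sec t (proj (src f)))) (fr_mor t f, fr_ob t (src f))).
Proof.
move=> Uf; have [tF t1 tm1] := tP.
have Utf : U (proj (tgt f)) by rewrite proj_tgt.
have Us : U (proj (fr_sec t (proj (src f)))) by rewrite (proj_fr_sec tF).
set s := fr_sec t _ in Us *; set a := (_, _).
have sa : src (actM (idm s) a) = actO s (fr_ob t (src f)).
  by rewrite src_actM src_idm.
have Usa : U (proj (src (actM (idm s) a))) by rewrite sa proj_actO.
have ta : tgt (actM (idm s) a) = actO s (fr_ob t (tgt f)).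
  by rewrite tgt_actM tgt_idm (fr_ob_tgt tF).
have e1 : src f = tgt (fr_iso t (src f)) by rewrite (tgt_fr_iso tF).
have e2 : src (fr_iso t (tgt f)) = tgt (actM (idm s) a).
  by rewrite ta (src_fr_iso tF)// proj_tgt.
have si : src (fr_iso t (src f)) = actO s (fr_ob t (src f)) by rewrite (src_fr_iso tF).
apply: (fr_faithful tF).
- by rewrite src_compm// si proj_actO.
- by rewrite !src_compm// si sa.
- by rewrite !tgt_compm// (tgt_fr_iso tF).
- rewrite !(fr_mor_compm tF)// ?si ?proj_actO// !tm1// mulg1 mul1g.
  rewrite (fr_mor_act tF) ?src_idm//.
  by rewrite (fr_mor_idm tF)// mul1g t1// cm_act1.
Qed.

End FrameFaithful.

Section Pack.
Variables (R : realType) (X : crossed_module R) (M : manifoldType R).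
Variables (P : over_g2space X M) (sP : smooth_over P) (U : set M) (oU : open U).
Variables (t : frame P) (tP : strict_frame U t).

Let tF : is_frame U t. Proof. by case: tP. Qed.
Let t1 x : U x -> fr_ob t (fr_sec t x) = 1. Proof. by case: tP => _ + _; apply. Qed.
Let tm1 p : U (proj p) -> fr_mor t (fr_iso t p) = 1. Proof. by case: tP => _ _; apply. Qed.

Let base (p : ob (restr P U)) : set_type U :=
  exist _ (proj (set_val p)) (mem_set (over_val p)).

Definition frame_functor_ob (p : ob (restr P U)) : ob (triv_g2space X (set_type U)) :=
  (base p, fr_ob t (set_val p)).
Definition frame_functor_mor (f : mor (restr P U)) : mor (triv_g2space X (set_type U)) :=
  (base (src f), (fr_mor t (set_val f), fr_ob t (src (set_val f)))).

#[local] Obligation Tactic := idtac.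

Program Definition frame_functor : functor (restr P U) (triv_g2space X (set_type U)) :=
  @Functor R (restr P U) (triv_g2space X (set_type U))
    frame_functor_ob frame_functor_mor _ _ _ _.
Next Obligation. by []. Qed.
Next Obligation.
move=> f; rewrite /frame_functor_ob /= (fr_ob_tgt tF); last exact: over_val_mor.
by congr pair; apply: val_inj; rewrite /= proj_tgt.
Qed.
Next Obligation.
move=> x; rewrite /frame_functor_mor /= (fr_mor_idm tF); last exact: over_val.
by congr (_, (_, _)); [apply: val_inj; exact: (congr1 proj (src_idm _))|rewrite src_idm].
Qed.
Next Obligation.
move=> f g e e'; have e2 : src (set_val f) = tgt (set_val g) := congr1 set_val e.
congr (_, (_, _)).
- apply: val_inj.
  change (proj (src (cmp (set_val f) (set_val g) (congr1 set_val e))) =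
          proj (src (set_val f))).
  by rewrite src_cmp e2 proj_tgt.
- apply: etrans (congr1 (fr_mor t) (esym (compmE (congr1 set_val e)))) _.
  by rewrite (fr_mor_compm tF)//; exact: over_val_mor.
- apply: etrans (congr1 (fun h => fr_ob t (src h)) (esym (compmE (congr1 set_val e)))) _.
  by rewrite src_compm.
Qed.

Lemma frame_inverse_ob_subproof (y : set_type U * cmG X) :
  actO (fr_sec t (set_val y.1)) y.2 \in fob (g2proj P) @^-1` U.
Proof.
have Uy := set_valP y.1.
by apply/mem_set; rewrite /= [fob _ _]proj_actO (proj_fr_sec tF).
Qed.

Lemma frame_inverse_mor_subproof (y : set_type U * (cmH X * cmG X)) :
  actM (idm (fr_sec t (set_val y.1))) y.2 \in fmor (g2proj P) @^-1` U.
Proof.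
have Uy := set_valP y.1.
apply/mem_set; rewrite /= -over_src src_actM src_idm.
by rewrite [fob _ _]proj_actO (proj_fr_sec tF).
Qed.

Definition frame_inverse_ob (y : ob (triv_g2space X (set_type U))) : ob (restr P U) :=
  exist _ (actO (fr_sec t (set_val y.1)) y.2) (frame_inverse_ob_subproof y).
Definition frame_inverse_mor (y : mor (triv_g2space X (set_type U))) : mor (restr P U) :=
  exist _ (actM (idm (fr_sec t (set_val y.1))) y.2) (frame_inverse_mor_subproof y).

Program Definition frame_inverse : functor (triv_g2space X (set_type U)) (restr P U) :=
  @Functor R (triv_g2space X (set_type U)) (restr P U)
    frame_inverse_ob frame_inverse_mor _ _ _ _.
Next Obligation. by move=> [x a]; apply: val_inj; rewrite /= src_actM src_idm. Qed.
Next Obligation. by move=> [x a]; apply: val_inj; rewrite /= tgt_actM tgt_idm. Qed.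
Next Obligation. by move=> [x k]; apply: val_inj; rewrite /= actM_idm. Qed.
Next Obligation.
move=> [x [h k]] [y [h' k']] e e'; apply: val_inj.
have exy : x = y := congr1 fst e.
have ek : k = cm_beta h' * k' := congr1 snd e.
rewrite /= -[RHS](compmE (congr1 set_val e')) /=.
rewrite -actM_compm ?src_idm ?tgt_idm ?exy//.
by rewrite (compm_idl (tgt_idm _)).
Qed.

Lemma frame_iso_subproof (p : ob (restr P U)) :
  fr_iso t (set_val p) \in fmor (g2proj P) @^-1` U.
Proof.
have Up := over_val p; apply/mem_set; rewrite /= -over_tgt (tgt_fr_iso tF)//.
Qed.

(** The transformation from [frame_inverse \o frame_functor] to the identity. *)
Definition frame_iso (p : ob (restr P U)) : mor (restr P U) :=
  exist _ (fr_iso t (set_val p)) (frame_iso_subproof p).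

Lemma frame_functorK_ob y : frame_functor_ob (frame_inverse_ob y) = y.
Proof.
case: y => y k; have Uy := set_valP y.
rewrite /frame_functor_ob /= (fr_ob_act tF) ?(proj_fr_sec tF)// t1// mul1g.
by congr pair; apply: val_inj; rewrite /= proj_actO (proj_fr_sec tF).
Qed.

Lemma frame_functorK_mor y : frame_functor_mor (frame_inverse_mor y) = y.
Proof.
case: y => y [h k]; have Uy := set_valP y.
have Us : U (proj (fr_sec t (set_val y))) by rewrite (proj_fr_sec tF).
have sE : src (actM (idm (fr_sec t (set_val y))) (h, k)) = actO (fr_sec t (set_val y)) k.
  by rewrite src_actM src_idm.
congr (_, (_, _)).
- apply: val_inj; apply: etrans (congr1 proj sE) _.
  by rewrite proj_actO (proj_fr_sec tF).
- apply: etrans (fr_mor_act tF (h, k) _) _; first by rewrite src_idm.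
  by rewrite src_idm t1// cm_act1 (fr_mor_idm tF)// mul1g.
- apply: etrans (congr1 (fr_ob t) sE) _.
  by rewrite (fr_ob_act tF)// t1// mul1g.
Qed.

Let mo : is_manifold (ob (restr P U)). Proof. exact: restr_ob_manifold. Qed.
Let mm : is_manifold (mor (restr P U)). Proof. exact: restr_mor_manifold. Qed.
Let mU : is_manifold (set_type U). Proof. exact: U_manifold. Qed.
#[local] Existing Instance mo.
#[local] Existing Instance mm.
#[local] Existing Instance mU.

Lemma smooth_frame_functor : smooth_functor frame_functor.
Proof.
have sbase p : smooth_at base p.
  apply: smooth_at_into_set_type; apply: smooth_at_proj.
  exact: smooth_at_set_val.
have sob p : smooth_at (fun p : ob (restr P U) => fr_ob t (set_val p)) p.
  apply: smooth_at_comp; last exact: smooth_at_set_val.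
  by apply: (fr_ob_smooth tF); exact: over_val.
have ssrc (f : mor (restr P U)) : smooth_at (fun f : mor (restr P U) => src f) f.
  apply: smooth_at_into_set_type; apply: smooth_at_src.
  exact: smooth_at_set_val.
split; apply: smooth_at_smooth => p.
  by apply: smooth_at_pair.
apply: smooth_at_pair; first exact: (smooth_at_comp (sbase _) (ssrc p)).
apply: smooth_at_pair; last exact: (smooth_at_comp (sob _) (ssrc p)).
apply: smooth_at_comp; last exact: smooth_at_set_val.
by apply: (fr_mor_smooth tF); exact: over_val_mor.
Qed.

Lemma smooth_frame_inverse : smooth_functor frame_inverse.
Proof.
have ssec (N : chartedType R) (mN : is_manifold N) (f : N -> set_type U) y :
    smooth_at f y -> smooth_at (fun z => fr_sec t (set_val (f z))) y.
  move=> sf; have Uf : U (set_val (f y)) by exact: set_valP.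
  apply: (smooth_at_comp (f := fun z => set_val (f z))).
    exact: (fr_sec_smooth tF Uf).
  by apply: smooth_at_comp sf; exact: smooth_at_set_val.
split; apply: smooth_at_smooth => y; apply: smooth_at_into_set_type.
  apply: smooth_at_actO; last exact: smooth_at_snd.
  by apply: ssec; exact: smooth_at_fst.
apply: smooth_at_actM; last exact: smooth_at_snd.
by apply: smooth_at_idm; apply: ssec; exact: smooth_at_fst.
Qed.

Lemma smooth_frame_iso : smooth frame_iso.
Proof.
apply: smooth_at_smooth => p; apply: smooth_at_into_set_type.
apply: (smooth_at_comp (f := set_val) (g := fr_iso t)); last exact: smooth_at_set_val.
by apply: (fr_iso_smooth tF); exact: over_val.
Qed.

Lemma frame_functor_g2morphism : g2morphism frame_functor.
Proof.
split=> [|p k|f a]; first exact: smooth_frame_functor.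
- rewrite /= /frame_functor_ob /=; congr pair.
    by apply: val_inj; rewrite /= [LHS]proj_actO.
  by rewrite -[fob _ _]/(actO (set_val p) k) (fr_ob_act tF)//; exact: over_val.
- have sE : src (fmor (g2act P) (set_val f, a)) = actO (src (set_val f)) a.2.
    exact: src_actM.
  have Uf : U (proj (src (set_val f))) by exact: over_val_mor.
  rewrite /= /frame_functor_mor /=; congr (_, (_, _)).
  + by apply: val_inj; apply: etrans (congr1 proj sE) _; rewrite proj_actO.
  + exact: (fr_mor_act tF).
  + by rewrite sE (fr_ob_act tF).
Qed.

Lemma frame_inverse_g2morphism : g2morphism frame_inverse.
Proof.
split=> [|[x k] k'|[x a] a']; first exact: smooth_frame_inverse.
  by apply: val_inj; rewrite /= actOM.
by apply: val_inj; apply: esym; rewrite /= -actMM.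
Qed.

(** [frame_functor] and [frame_inverse] are strictly inverse in one order, so the
    transformation in that order is the identity; naturality and equivariance in
    the other order are [fr_iso_natural] and [fr_iso_act]. *)
Lemma frame_trivialisation :
  [/\ trivialisation frame_functor frame_inverse,
      eq_functor (comp_functor frame_functor frame_inverse) (id_functor _),
      is_2isomorphism (comp_functor frame_inverse frame_functor) (id_functor _)
        frame_iso &
      forall p, fmor frame_functor (frame_iso p) = idm (fob frame_functor p)].
Proof.
have tau2 : is_2isomorphism (comp_functor frame_inverse frame_functor)
    (id_functor _) frame_iso.
  split; last by move=> p; apply: val_iso; apply: (iso_fr_iso tF); exact: over_val.
  split.
  - exact: smooth_frame_iso.
  - by move=> p; have Up := over_val p; split; apply: val_inj;
      [exact: (src_fr_iso tF)|exact: (tgt_fr_iso tF)].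
  - move=> f e e'; apply: val_inj => /=.
    have Uf := over_val_mor f.
    rewrite -[LHS](compmE (congr1 set_val e)) -[RHS](compmE (congr1 set_val e')) /=.
    by rewrite (fr_iso_natural tP).
  - move=> p k; apply: val_inj; rewrite /=.
    by apply: (fr_iso_act tP); exact: over_val.
have FK : eq_functor (comp_functor frame_functor frame_inverse) (id_functor _).
  by split; [exact: frame_functorK_ob|exact: frame_functorK_mor].
split => //; last first.
  move=> p; have Up := over_val p.
  congr (_, (_, _)).
  - apply: val_inj; apply: etrans (congr1 proj (src_fr_iso tF Up)) _.
    by rewrite proj_actO (proj_fr_sec tF).
  - exact: tm1.
  - apply: etrans (congr1 (fr_ob t) (src_fr_iso tF Up)) _.
    by rewrite (fr_ob_act tF) ?(proj_fr_sec tF)// t1// mul1g.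
split.
- exact: frame_functor_g2morphism.
- split; [exact: frame_inverse_g2morphism| |by exists frame_iso].
  exists (fun y => idm y); split.
    split.
    + apply: smooth_at_smooth => y.
      apply: smooth_at_pair; first exact: smooth_at_fst.
      by apply: smooth_at_pair; [exact: smooth_at_cst|exact: smooth_at_snd].
    + move=> y; split; first by case: FK => /(_ y) -> _; case: y.
      by case: y => y k; rewrite /= cm_beta1 mul1g.
    + move=> f e e'; rewrite -!compmE (FK.2 f) /=.
      by rewrite (compm_idl (f := f) erefl) (compm_idr (f := f) erefl).
    + by move=> [x k] k'; rewrite /= /sdmul /= cm_actr1 mulg1.
  move=> y; exists (idm y).
  have e : src (idm y) = tgt (idm y) by rewrite src_idm tgt_idm.
  exists e, e; split; rewrite -compmE (compm_idl (tgt_idm y)).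
    by rewrite tgt_idm.
  by rewrite src_idm.
- by split => // f; rewrite /= -over_src.
- split => [y|a].
    by rewrite /= [LHS]proj_actO (proj_fr_sec tF)//; exact: set_valP.
  rewrite /= -over_src src_actM src_idm [LHS]proj_actO (proj_fr_sec tF)//.
  exact: set_valP.
Qed.

End Pack.

(** * Strict frames and the cocycle of a family of strict frames *)

Lemma smooth_at_open_eq (R : realType) (M N : chartedType R) (U : set M)
    (f g : M -> N) x : open U -> U x -> (forall y, U y -> f y = g y) ->
  smooth_at f x -> smooth_at g x.
Proof.
move=> oU Ux fg; apply: smooth_at_near.
have nU : \forall y \near x, U y by exact: open_nbhs_nbhs.
by apply: filterS nU.
Qed.

Lemma iso_actM_idm (R : realType) (X : crossed_module R) (P : g2space X)
  (p : ob P) (h : cmH X) (k : cmG X) : iso (actM (idm p) (h, k)).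
Proof.
apply/isoP; exists (actM (idm p) (h^-1, cm_beta h * k)).
have idp : compm (idm p) (idm p) = idm p by rewrite (compm_idl (tgt_idm p)).
rewrite !src_actM !tgt_actM !src_idm !tgt_idm /= cm_betaV mulKg; split => //.
- rewrite -actM_compm ?src_idm ?tgt_idm ?cm_betaV ?mulKg// idp mulgV.
  exact: actM_idm.
- rewrite -actM_compm ?src_idm ?tgt_idm// idp mulVg.
  exact: actM_idm.
Qed.

Section Strictify.
Variables (R : realType) (X : crossed_module R) (M : manifoldType R).
Variables (P : over_g2space X M) (sP : smooth_over P) (U : set M) (oU : open U).
Variables (t : frame P) (tF : is_frame U t).

Let a (x : M) : cmG X := fr_ob t (fr_sec t x).
Let c (p : ob P) : cmH X := (cm_act (a (proj p))^-1 (fr_mor t (fr_iso t p)))^-1.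
Let mu (p : ob P) : mor P :=
  actM (idm (fr_sec t (proj p))) (c p, (a (proj p))^-1 * fr_ob t p).

(** Translating the section by [a^-1], where [a x = fr_ob (fr_sec x)], gives it
    coordinate 1.  The old [fr_iso p] starts at the old section; [mu p] leads
    there from the new one, and its H-component is chosen to cancel the
    coordinate of [fr_iso p]. *)
Definition strictify : frame P :=
  Frame (fr_ob t) (fr_mor t) (fun x => actO (fr_sec t x) (a x)^-1)
    (fun p => compm (fr_iso t p) (mu p)).

Lemma strictify_src_iso p : U (proj p) -> src (fr_iso t p) = tgt (mu p).
Proof.
move=> Up; have Us : U (proj (fr_sec t (proj p))) by rewrite (proj_fr_sec tF).
rewrite tgt_actM tgt_idm (src_fr_iso tF)//=; congr actO.
have Usi : U (proj (src (fr_iso t p))).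
  by rewrite (src_fr_iso tF)// proj_actO.
have := fr_ob_tgt tF Usi.
rewrite (tgt_fr_iso tF)// (src_fr_iso tF)// (fr_ob_act tF)// -/(a (proj p)).
rewrite /c cm_betaV cm_beta_act invgK !invgM invgK -!mulgA => E.
by rewrite mulVKg {2}E !mulKg.
Qed.

Lemma strictify_mor_mu p : U (proj p) -> fr_mor t (mu p) = (fr_mor t (fr_iso t p))^-1.
Proof.
move=> Up; have Us : U (proj (fr_sec t (proj p))) by rewrite (proj_fr_sec tF).
rewrite (fr_mor_act tF) ?src_idm// (fr_mor_idm tF)// mul1g /= /c cm_actV.
by rewrite -/(a (proj p)) cm_actVK.
Qed.

Lemma strictifyP : strict_frame U strictify.
Proof.
have Us p : U (proj p) -> U (proj (fr_sec t (proj p))) by move=> ?; rewrite (proj_fr_sec tF).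
have srcmu p : src (mu p) = actO (fr_sec t (proj p)) ((a (proj p))^-1 * fr_ob t p).
  by rewrite src_actM src_idm.
have sa x : U x -> smooth_at a x.
  move=> Ux; apply: (smooth_at_comp (g := fr_ob t)).
    by apply: (fr_ob_smooth tF); rewrite (proj_fr_sec tF).
  exact: (fr_sec_smooth tF).
have sproj p : smooth_at (fun q : ob P => proj q) p.
  by apply: smooth_at_proj; exact: smooth_at_id.
have sap p : U (proj p) -> smooth_at (fun q : ob P => a (proj q)) p.
  by move=> Up; apply: (smooth_at_comp (sa _ Up)).
have U1 p : U (proj p) -> U (proj (src (fr_iso t p))).
  by move=> Up; rewrite (src_fr_iso tF)// proj_actO; exact: Us.
split; last first.
- move=> p Up; rewrite /= (fr_mor_compm tF) ?srcmu ?proj_actO ?strictify_src_iso//.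
    by rewrite strictify_mor_mu// mulgV.
  exact: Us.
- move=> x Ux; rewrite /= (fr_ob_act tF) ?(proj_fr_sec tF)//.
  by rewrite -/(a x) mulgV.
split => //=.
- exact: fr_ob_smooth tF.
- exact: fr_mor_smooth tF.
- move=> x Ux; apply: smooth_at_actO; first exact: (fr_sec_smooth tF).
  by apply: smooth_at_invg; exact: sa.
- move=> p Up; apply: smooth_at_compm.
  + have nU : \forall q \near p, U (proj q).
      by apply: open_nbhs_nbhs; split => //; exact: open_over.
    by apply: filterS nU => q; exact: strictify_src_iso.
  + exact: (fr_iso_smooth tF).
  + apply: smooth_at_actM.
      apply: smooth_at_idm; apply: (smooth_at_comp (f := proj) (g := fr_sec t)) => //.
      exact: (fr_sec_smooth tF).
    apply: smooth_at_pair.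
      apply: smooth_at_invg; apply: smooth_at_act.
        by apply: smooth_at_invg; exact: sap.
      apply: (smooth_at_comp (g := fr_mor t)); last exact: (fr_iso_smooth tF).
      by apply: (fr_mor_smooth tF); exact: U1.
    apply: smooth_at_mulg; last exact: (fr_ob_smooth tF).
    by apply: smooth_at_invg; exact: sap.
- exact: fr_ob_act tF.
- exact: fr_mor_act tF.
- exact: fr_ob_tgt tF.
- exact: fr_mor_idm tF.
- exact: fr_mor_compm tF.
- by move=> x Ux; rewrite proj_actO (proj_fr_sec tF).
- by move=> p Up; rewrite src_compm ?strictify_src_iso// srcmu actOM.
- by move=> p Up; rewrite tgt_compm ?strictify_src_iso// (tgt_fr_iso tF).
- move=> p Up; apply: iso_compm; first exact: strictify_src_iso.
    exact: (iso_fr_iso tF).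
  exact: iso_actM_idm.
- exact: fr_faithful tF.
Qed.

End Strictify.

Section CocycleOfFrames.
Variables (R : realType) (X : crossed_module R) (M : manifoldType R).

#[global] Instance bundle_smooth_over (P : bundle X M) : smooth_over P.
Proof. by case: (bundleP P) => sm sp _; split. Qed.

Lemma cover_at (I : Type) (U : I -> set M) x : open_cover U -> exists i, U i x.
Proof. by move=> [_ UT]; have : [set: M] x by []; rewrite -UT => -[i _]; exists i. Qed.

Lemma exists_strict_frames (P : bundle X M) :
  exists (I : Type) (U : I -> set M), open_cover U /\
    exists t : I -> frame P, forall i, strict_frame (U i) (t i).
Proof.
have [_ _ [I [U [cU triv]]]] := bundleP P; exists I, U; split => //.
have s0 : forall x : M, exists p : ob P, True.
  move=> x; have [i Ux] := cover_at x cU; have [Phi [Phi' _]] := triv i.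
  by exists (set_val (fob Phi' (exist _ x (mem_set Ux), 1))).
have [s0' _] := choice s0.
suff /choice[t tP] : forall i, exists t : frame P, strict_frame (U i) t by exists t.
move=> i; have [Phi [Phi' trivi]] := triv i.
have [_ [_ _ [tau tau2]] _ _] := trivi.
have [t tE] := exists_frame Phi Phi' tau s0'.
have oUi : open (U i) by case: cU => + _; apply.
have tF := frame_of_is_frame (bundle_smooth_over P) oUi trivi tau2 tE.
by exists (strictify t); apply: strictifyP => //; exact: bundle_smooth_over.
Qed.

(** The local data defining z(P), expressed by strict frames. *)
Definition framed (P : over_g2space X M) (z : cocycle_data X M) : Prop :=
  let U := @cc_cover _ _ _ z in let g := @cc_g _ _ _ z in let h := @cc_h _ _ _ z in
  open_cover U /\ exists t : cc_index z -> frame P,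
  [/\ forall i, strict_frame (U i) (t i),
      forall i j x, U i x -> U j x -> fr_ob (t j) (fr_sec (t i) x) = (g i j x)^-1 &
      forall i j k x, U i x -> U j x -> U k x ->
        fr_mor (t k) (fr_iso (t j) (fr_sec (t i) x)) =
        cm_act (g i k x)^-1 (h i j k x)^-1].

Lemma cocycle_of_framed (P : bundle X M) z : cocycle_of P z -> framed P z.
Proof.
move=> [cU [Phi [Phi' [tau [triv PhiK tau2 taun [gE hE]]]]]]; split => //.
have s0 : forall x : M, exists p : ob P, True.
  move=> x; have [i Ux] := cover_at x cU.
  by exists (set_val (fob (Phi' i) (exist _ x (mem_set Ux), 1))).
have [s0' _] := choice s0.
have /choice[t tE] : forall i, exists t : frame P, frame_of (Phi i) (Phi' i) (tau i) t.
  by move=> i; exact: exists_frame.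
have oU (i : cc_index z) : open (cc_cover i) by case: cU => + _; apply.
have tF i := frame_of_is_frame (bundle_smooth_over P) (oU i) (triv i) (tau2 i) (tE i).
have secU (i : cc_index z) x : cc_cover i x -> exists x' : set_type (cc_cover i), set_val x' = x.
  by move=> Ux; exists (exist _ x (mem_set Ux)).
exists t; split.
- move=> i; have [obE morE secE isoE] := tE i; split => //.
    move=> x /secU[x' <-]; rewrite secE obE.
    by have [/(_ (x', 1)) /= -> _] := PhiK i.
  move=> p /over_mem[p' <-]; rewrite isoE morE.
  by rewrite (congr1 (fun z => z.2.1) (taun i p')).
- move=> i j x /secU[xi <-] Uj; have [xj xjE] := secU _ _ Uj.
  have [_ _ secE _] := tE i; have [obE _ _ _] := tE j.
  have Us : cc_cover j (proj (fr_sec (t i) (set_val xi))).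
    by rewrite (proj_fr_sec (tF i))//; exact: set_valP.
  have [p pE] := over_mem Us.
  by rewrite -pE obE (gE i j xi xj p)// pE secE.
- move=> i j k x /secU[xi <-] Uj Uk; have [xk xkE] := secU _ _ Uk.
  have [_ _ secE _] := tE i; have [_ _ _ isoE] := tE j.
  have [_ morE _ _] := tE k.
  have Us : cc_cover j (proj (fr_sec (t i) (set_val xi))).
    by rewrite (proj_fr_sec (tF i))//; exact: set_valP.
  have [p pE] := over_mem Us.
  have Um : cc_cover k (proj (src (fr_iso (t j) (set_val p)))).
    rewrite pE (src_fr_iso (tF j))// proj_actO (proj_fr_sec (tF j))//.
    by rewrite (proj_fr_sec (tF i))//; exact: set_valP.
  have [m mE] := over_mem_mor Um.
  by rewrite -pE -mE morE (hE i j k xi xk p m)// ?pE ?secE// mE isoE.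
Qed.

Lemma framed_cocycle_of (P : bundle X M) z : framed P z -> cocycle_of P z.
Proof.
move=> [cU [t [tP gE hE]]]; split => //.
have oU (i : cc_index z) : open (cc_cover i) by case: cU => + _; apply.
have T i := frame_trivialisation (bundle_smooth_over P) (oU i) (tP i).
exists (fun i => frame_functor (tP i)), (fun i => frame_inverse (tP i)),
  (fun i => frame_iso (tP i)).
split; try by move=> i; case: (T i).
have tF i : is_frame (cc_cover i) (t i) by case: (tP i).
split.
- move=> i j xi xj p xjE pE.
  have Ui : cc_cover i (set_val xi) by exact: set_valP.
  have Uj : cc_cover j (set_val xi) by rewrite -xjE; exact: set_valP.
  have {}pE : set_val p = fr_sec (t i) (set_val xi) by rewrite pE -[RHS]actO1.
  congr pair.
    by apply: val_inj; rewrite /= pE (proj_fr_sec (tF i)).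
  by rewrite /= pE gE.
- move=> i j k xi xk p m xkE pE mE.
  have Ui : cc_cover i (set_val xi) by exact: set_valP.
  have Uk : cc_cover k (set_val xi) by rewrite -xkE; exact: set_valP.
  have {}pE : set_val p = fr_sec (t i) (set_val xi) by rewrite pE -[RHS]actO1.
  have Uj : cc_cover j (set_val xi).
    by have := over_val p; rewrite pE (proj_fr_sec (tF i)).
  have {}mE : set_val m = fr_iso (t j) (fr_sec (t i) (set_val xi)) by rewrite -pE mE.
  have Up : cc_cover j (proj (fr_sec (t i) (set_val xi))) by rewrite (proj_fr_sec (tF i)).
  have sm : src (set_val m) = actO (fr_sec (t j) (set_val xi)) (cc_g i j (set_val xi))^-1.
    by rewrite mE (src_fr_iso (tF j))// (proj_fr_sec (tF i))// gE.
  congr (_, (_, _)).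
  + apply: val_inj; apply: etrans (congr1 proj sm) _.
    by rewrite proj_actO (proj_fr_sec (tF j)).
  + by rewrite mE hE.
  + rewrite sm (fr_ob_act (tF k)) ?(proj_fr_sec (tF j))// gE//.
    by rewrite invgM.
Qed.

Lemma exists_cocycle_of (P : bundle X M) : exists z : cocycle_data X M, cocycle_of P z.
Proof.
have [I [U [cU [t tP]]]] := exists_strict_frames P.
pose g i j x := (fr_ob (t j) (fr_sec (t i) x))^-1.
pose h i j k x := (cm_act (g i k x) (fr_mor (t k) (fr_iso (t j) (fr_sec (t i) x))))^-1.
exists (CocycleData U g h); apply: framed_cocycle_of; split => //.
exists t; split => //= [i j x _ _|i j k x _ _ _]; first by rewrite invgK.
by rewrite [in RHS](invgK (cm_act _ _)) cm_actK.
Qed.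

End CocycleOfFrames.

(** * Descent data *)

Section Descent.
Variables (R : realType) (X : crossed_module R) (M : manifoldType R).
Implicit Types (P : over_g2space X M) (z : cocycle_data X M).

(** A descent datum of type [z] in [P].  It amounts to a morphism to [P] from the
    bundle of [z], see [descent_functor]. *)
Record is_descent P z (s : cc_index z -> M -> ob P)
    (sg : cc_index z -> cc_index z -> M -> mor P) : Prop := IsDescent {
  ds_sec_smooth : forall i x, cc_cover i x -> smooth_at (s i) x ;
  ds_proj : forall i x, cc_cover i x -> proj (s i x) = x ;
  ds_mor_smooth : forall i j x, cc_cover i x -> cc_cover j x -> smooth_at (sg i j) x ;
  ds_src : forall i j x, cc_cover i x -> cc_cover j x -> src (sg i j x) = s j x ;
  ds_tgt : forall i j x, cc_cover i x -> cc_cover j x ->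
    tgt (sg i j x) = actO (s i x) (cc_g i j x) ;
  ds_triangle : forall i j k x, cc_cover i x -> cc_cover j x -> cc_cover k x ->
    sg i k x = compm (actM (idm (s i x)) (cc_h i j k x, cc_g i j x * cc_g j k x))
                 (compm (actM (sg i j x) (1, cc_g j k x)) (sg j k x)) }.

Definition descends P z : Prop := exists s sg, @is_descent P z s sg.

Lemma frame_mor_cod P (U : set M) (t : frame P) (tF : is_frame U t) p q k f :
  U (proj p) -> src f = p -> tgt f = actO q k ->
  fr_ob t q * k = cm_beta (fr_mor t f) * fr_ob t p.
Proof.
move=> Up fp fq; have Uq : U (proj q) by rewrite -(proj_actO q k) -fq proj_tgt fp.
by rewrite -(fr_ob_act tF)// -fq (fr_ob_tgt tF) ?fp.
Qed.

(** The composite has the endpoints of [s13], so the two are equal iff their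
    coordinates are, in any one frame.  Using one direction in one frame and the
    other direction in another frame carries an identity between coordinates
    from frame to frame. *)
Lemma triangleP P (U : set M) (t : frame P) (tF : is_frame U t)
    (p1 p2 p3 : ob P) (g12 g23 g13 : cmG X) (h : cmH X) (s12 s23 s13 : mor P) :
  src s12 = p2 -> tgt s12 = actO p1 g12 ->
  src s23 = p3 -> tgt s23 = actO p2 g23 -> src s13 = p3 -> tgt s13 = actO p1 g13 ->
  U (proj p3) -> cm_beta h * g12 * g23 = g13 ->
  s13 = compm (actM (idm p1) (h, g12 * g23)) (compm (actM s12 (1, g23)) s23) <->
  fr_mor t s13 = cm_act (fr_ob t p1) h * fr_mor t s12 * fr_mor t s23.
Proof.
move=> e1 e2 e3 e4 e5 e6 U3 hE.
have U2 : U (proj p2) by rewrite -(proj_actO p2 g23) -e4 proj_tgt e3.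
have U1 : U (proj p1) by rewrite -(proj_actO p1 g12) -e2 proj_tgt e1.
have k1 : src (actM s12 (1, g23)) = tgt s23 by rewrite src_actM e1 e4.
have k2 : src (actM (idm p1) (h, g12 * g23)) = tgt (compm (actM s12 (1, g23)) s23).
  by rewrite tgt_compm// src_actM src_idm tgt_actM e2 /= cm_beta1 mul1g actOM.
have mE : fr_mor t (compm (actM (idm p1) (h, g12 * g23))
            (compm (actM s12 (1, g23)) s23)) =
          cm_act (fr_ob t p1) h * fr_mor t s12 * fr_mor t s23.
  rewrite (fr_mor_compm tF) ?src_compm ?e3// (fr_mor_compm tF) ?e3//.
  rewrite !(fr_mor_act tF) ?src_idm ?e1//.
  by rewrite (fr_mor_idm tF)// mul1g cm_actr1 mulg1 mulgA.
split => [->//|sE].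
apply: (fr_faithful tF); rewrite ?mE// ?e5// ?src_compm// ?e3//.
by rewrite tgt_compm// tgt_actM tgt_idm e6 /= -hE mulgA.
Qed.

Section DescentFrame.
Variables (P : over_g2space X M) (z : cocycle_data X M).
Hypothesis zP : is_cocycle z.
Variables (s : cc_index z -> M -> ob P) (sg : cc_index z -> cc_index z -> M -> mor P).
Hypothesis sP : is_descent s sg.
Variables (W : set M) (t : frame P) (x : M).
Hypotheses (tF : is_frame W t) (Wx : W x).
Local Notation a i := (fr_ob t (s i x)).
Local Notation b i j := (fr_mor t (sg i j x)).

Lemma descent_frame_ob i j : cc_cover i x -> cc_cover j x ->
  a i * cc_g i j x = cm_beta (b i j) * a j.
Proof.
move=> Ui Uj; apply: (frame_mor_cod tF) (ds_src sP Ui Uj) (ds_tgt sP Ui Uj).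
by rewrite (ds_proj sP).
Qed.

Lemma descent_frame_mor i j k : cc_cover i x -> cc_cover j x -> cc_cover k x ->
  b i k = cm_act (a i) (cc_h i j k x) * b i j * b j k.
Proof.
move=> Ui Uj Uk; case: zP => _ _ _ [gE _ _ _].
apply/(triangleP tF (ds_src sP Ui Uj) (ds_tgt sP Ui Uj) (ds_src sP Uj Uk)
  (ds_tgt sP Uj Uk) (ds_src sP Ui Uk) (ds_tgt sP Ui Uk)).
- by rewrite (ds_proj sP).
- by apply: gE.
- exact: (ds_triangle sP).
Qed.

(** The triangle with three equal indices says that [b i i] is idempotent. *)
Lemma descent_frame_id i : cc_cover i x -> b i i = 1.
Proof.
move=> Ui; have := descent_frame_mor Ui Ui Ui.
case: zP => _ _ _ [_ _ _ /(_ i i x (conj Ui Ui))[-> _]].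
rewrite cm_actr1 mul1g -[X in X = _]mulg1 => /mulgI; exact: esym.
Qed.

End DescentFrame.

(** Both decompositions of [b14] end in [b12 * b23 * b34], once [b12] has been moved
    to the right of [h234] by the Peiffer identity; cancelling it leaves the
    cocycle identity. *)
Lemma cocycle_associativity (a1 a2 g12 : cmG X) (h123 h134 h124 h234 b12 b23 b34 b13 b24 b14 : cmH X) :
  a1 * g12 = cm_beta b12 * a2 ->
  b13 = cm_act a1 h123 * b12 * b23 -> b14 = cm_act a1 h134 * b13 * b34 ->
  b14 = cm_act a1 h124 * b12 * b24 -> b24 = cm_act a2 h234 * b23 * b34 ->
  h134 * h123 = h124 * cm_act g12 h234.
Proof.
move=> gE e1 e2 e3 e4; apply: (@cm_act_inj _ X a1); rewrite !cm_actMr -cm_actM gE cm_actM.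
move: e3; rewrite {}e2 {}e1 {}e4 !mulgA => /mulIg/mulIg.
rewrite -[X in _ = X -> _]mulgA -(cm_act_beta b12) [X in _ = X -> _]mulgA => /mulIg.
by [].
Qed.

Lemma smooth_section_frame (P : over_g2space X M) {sP : smooth_over P}
    (U : set M) (t : frame P) (tF : is_frame U t) (N : chartedType R)
    {mN : is_manifold N} (f : N -> ob P) y :
  smooth_at f y -> U (proj (f y)) -> smooth_at (fun w => fr_ob t (f w)) y.
Proof. by move=> sf Uf; apply: smooth_at_comp sf; exact: (fr_ob_smooth tF). Qed.

Lemma smooth_mor_frame (P : over_g2space X M) {sP : smooth_over P}
    (U : set M) (t : frame P) (tF : is_frame U t) (N : chartedType R)
    {mN : is_manifold N} (f : N -> mor P) y :
  smooth_at f y -> U (proj (src (f y))) -> smooth_at (fun w => fr_mor t (f w)) y.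
Proof. by move=> sf Uf; apply: smooth_at_comp sf; exact: (fr_mor_smooth tF). Qed.

Lemma smooth_iso_frame (P : over_g2space X M) {sP : smooth_over P}
    (U : set M) (t : frame P) (tF : is_frame U t) (N : chartedType R)
    {mN : is_manifold N} (f : N -> ob P) y :
  smooth_at f y -> U (proj (f y)) -> smooth_at (fun w => fr_iso t (f w)) y.
Proof. by move=> sf Uf; apply: smooth_at_comp sf; exact: (fr_iso_smooth tF). Qed.

(** The datum is [s i = fr_sec (t i)] and [sg i j x], the transformation of the
    frame [t j] at [s i x . g_ij x].  In the frame [t k], the coordinates of
    [sg i k] and [sg j k] are trivial and that of [sg i j] is
    [g_ik^-1 . h_ijk^-1], which is the triangle identity; the conditions on
    [g] and [h] follow from it. *)
Lemma framed_cocycle (P : over_g2space X M) {sP : smooth_over P} z :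
  framed P z -> is_cocycle z /\ descends P z.
Proof.
move=> [cU [t [tP gE hE]]].
have oU (i : cc_index z) : open (cc_cover i) by case: cU => + _; apply.
have tF i : is_frame (cc_cover i) (t i) by case: (tP i).
have secP i x : cc_cover i x -> proj (fr_sec (t i) x) = x by exact: proj_fr_sec.
pose s i x := fr_sec (t i) x; pose g := @cc_g _ _ _ z; pose h := @cc_h _ _ _ z.
pose sg i j x := fr_iso (t j) (actO (s i x) (g i j x)).
have ssec i x : cc_cover i x -> smooth_at (s i) x by exact: fr_sec_smooth (tF i) x.
have isosrc i j x : cc_cover i x -> cc_cover j x ->
    src (fr_iso (t j) (s i x)) = actO (s j x) (g i j x)^-1.
  by move=> Ui Uj; rewrite (src_fr_iso (tF j)) ?secP// gE.
have sg_g i j x : cc_cover i x -> cc_cover j x -> smooth_at (g i j) x.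
  move=> Ui Uj; apply: (smooth_at_open_eq (U := cc_cover i `&` cc_cover j)
    (f := fun y => (fr_ob (t j) (s i y))^-1)).
  - exact: openI.
  - by [].
  - by move=> y [Uiy Ujy]; rewrite gE// invgK.
  - apply: smooth_at_invg; apply: (smooth_section_frame (tF j)); first exact: ssec.
    by rewrite secP.
have hE' i j k x : cc_cover i x -> cc_cover j x -> cc_cover k x ->
    h i j k x = (cm_act (g i k x) (fr_mor (t k) (fr_iso (t j) (s i x))))^-1.
  by move=> Ui Uj Uk; rewrite hE// cm_actVK invgK.
have sg_h i j k x : cc_cover i x -> cc_cover j x -> cc_cover k x ->
    smooth_at (h i j k) x.
  move=> Ui Uj Uk; apply: (smooth_at_open_eq
    (U := cc_cover i `&` cc_cover j `&` cc_cover k)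
    (f := fun y => (cm_act (g i k y) (fr_mor (t k) (fr_iso (t j) (s i y))))^-1)).
  - by apply: openI => //; exact: openI.
  - by [].
  - by move=> y [[Uiy Ujy] Uky]; rewrite hE'.
  - apply: smooth_at_invg; apply: smooth_at_act; first exact: sg_g.
    apply: (smooth_mor_frame (tF k)).
      by apply: (smooth_iso_frame (tF j)); rewrite ?secP//; exact: ssec.
    by rewrite isosrc// proj_actO secP.
have gEE i j k x : cc_cover i x -> cc_cover j x -> cc_cover k x ->
    cm_beta (h i j k x) * g i j x * g j k x = g i k x.
  move=> Ui Uj Uk.
  have /(fr_ob_tgt (tF k)) : cc_cover k (proj (src (fr_iso (t j) (s i x)))).
    by rewrite isosrc// proj_actO secP.
  rewrite isosrc// (fr_ob_act (tF k)) ?secP// (tgt_fr_iso (tF j)) ?secP//.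
  rewrite !gE// hE// cm_beta_act cm_betaV invgK -!mulgA -invgM.
  rewrite -[X in X = _]mulg1 => /mulgI /esym /mulg1_eq; rewrite invgK => bE.
  by rewrite /h bE mulgVK.
have isojj j x : cc_cover j x -> fr_iso (t j) (s j x) = idm (s j x).
  move=> Uj; have [_ t1 tm1] := tP j.
  have gjj : g j j x = 1 by apply: invg_inj; rewrite -gE// t1// invg1.
  apply: (fr_faithful (tF j)).
  - by rewrite isosrc// proj_actO secP.
  - by rewrite isosrc// src_idm gjj invg1 actO1.
  - by rewrite (tgt_fr_iso (tF j)) ?secP// tgt_idm.
  - by rewrite tm1 ?secP// (fr_mor_idm (tF j)) ?secP.
have sgm i j k x : cc_cover i x -> cc_cover j x -> cc_cover k x ->
    fr_mor (t k) (sg i j x) = cm_act (g i k x)^-1 (h i j k x)^-1.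
  move=> Ui Uj Uk; rewrite /sg (fr_iso_act (tP j)) ?secP//.
  rewrite (fr_mor_act (tF k)) ?isosrc ?proj_actO ?secP//.
  by rewrite cm_actr1 mulg1 hE.
have sgsrc i j x : cc_cover i x -> cc_cover j x -> src (sg i j x) = s j x.
  move=> Ui Uj; rewrite (src_fr_iso (tF j)) ?proj_actO ?secP//.
  by rewrite (fr_ob_act (tF j)) ?secP// gE// mulVg actO1.
have sgtgt i j x : cc_cover i x -> cc_cover j x ->
    tgt (sg i j x) = actO (s i x) (g i j x).
  by move=> Ui Uj; rewrite (tgt_fr_iso (tF j)) ?proj_actO ?secP.
have sgk i k x : cc_cover i x -> cc_cover k x -> fr_mor (t k) (sg i k x) = 1.
  by move=> Ui Uk; have [_ _] := tP k; apply; rewrite proj_actO secP.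
have tri i j k x : cc_cover i x -> cc_cover j x -> cc_cover k x ->
    sg i k x = compm (actM (idm (s i x)) (h i j k x, g i j x * g j k x))
                 (compm (actM (sg i j x) (1, g j k x)) (sg j k x)).
  move=> Ui Uj Uk; apply/(triangleP (tF k)); rewrite ?sgsrc ?sgtgt ?secP ?gEE//.
  by rewrite !sgk// gE// sgm// cm_actV mulgV mulg1.
have trik i j k l x : cc_cover i x -> cc_cover j x -> cc_cover k x -> cc_cover l x ->
    fr_mor (t l) (sg i k x) = cm_act (fr_ob (t l) (s i x)) (h i j k x) *
      fr_mor (t l) (sg i j x) * fr_mor (t l) (sg j k x).
  move=> Ui Uj Uk Ul; apply/(triangleP (tF l)); rewrite ?sgsrc ?sgtgt ?secP ?gEE//.
  exact: tri.
split; last first.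
  exists s, sg; split => //.
  move=> i j x Ui Uj; apply: (smooth_iso_frame (tF j)); last by rewrite proj_actO secP.
  by apply: smooth_at_actO; [exact: ssec|exact: sg_g].
split => //.
- move=> i j; apply/smooth_onP; first exact: openI.
  by move=> x [Ui Uj]; exact: sg_g.
- move=> i j k; apply/smooth_onP; first by apply: openI => //; exact: openI.
  by move=> x [[Ui Uj] Uk]; exact: sg_h.
split.
- by move=> i j k x [[Ui Uj] Uk]; exact: gEE.
- move=> i j k l x [[[Ui Uj] Uk] Ul].
  have gE' : fr_ob (t l) (s i x) * g i j x =
      cm_beta (fr_mor (t l) (sg i j x)) * fr_ob (t l) (s j x).
    by apply: (frame_mor_cod (tF l)) (sgsrc _ _ _ Ui Uj) (sgtgt _ _ _ Ui Uj); rewrite secP.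
  exact: (cocycle_associativity gE' (trik _ _ _ _ _ Ui Uj Uk Ul)
    (trik _ _ _ _ _ Ui Uk Ul Ul) (trik _ _ _ _ _ Ui Uj Ul Ul)
    (trik _ _ _ _ _ Uj Uk Ul Ul)).
- move=> i x Ui; have [_ t1 _] := tP i.
  by apply: invg_inj; rewrite -gE// t1// invg1.
- move=> i j x [Ui Uj]; have [_ _ tm1] := tP j; split; rewrite -/h hE'//.
    by rewrite tm1 ?secP// cm_actr1 invg1.
  by rewrite isojj// (fr_mor_idm (tF i)) ?secP// cm_actr1 invg1.
Qed.

End Descent.

(** * Descent data of one bundle have cohomologous cocycles *)

Section CrossedModuleAlgebra.
Variables (R : realType) (X : crossed_module R).

Lemma coboundary_beta (a1 a2 a1' a2' g12 g12' c1 c2 : cmG X) (b12 b12' r1 r2 e : cmH X) :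
  a1 * g12 = cm_beta b12 * a2 -> a1' * g12' = cm_beta b12' * a2' ->
  a1 * c1 = cm_beta r1 * a1' -> a2 * c2 = cm_beta r2 * a2' ->
  r1 * b12' = cm_act a1 e * b12 * r2 ->
  c1 * g12' = cm_beta e * g12 * c2.
Proof.
move=> gE gE' e1 e2 eE; apply: (@mulgI _ a1).
rewrite mulgA e1 -mulgA gE' mulgA -cm_betaM eE !cm_betaM cm_beta_act.
by rewrite -!mulgA -e2 (mulgA (cm_beta b12)) -gE !mulgA mulgVK.
Qed.

(** Moved by [a1] and multiplied by [b12 * b23 * r3], both sides become
    [r1 * b13']. *)
Lemma coboundary_relation (a1 a2 a1' c1 g12 : cmG X)
    (b12 b23 b13 b12' b23' b13' r1 r2 r3 h h' e12 e23 e13 : cmH X) :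
  a1 * g12 = cm_beta b12 * a2 -> a1 * c1 = cm_beta r1 * a1' ->
  b13 = cm_act a1 h * b12 * b23 -> b13' = cm_act a1' h' * b12' * b23' ->
  r1 * b12' = cm_act a1 e12 * b12 * r2 ->
  r2 * b23' = cm_act a2 e23 * b23 * r3 ->
  r1 * b13' = cm_act a1 e13 * b13 * r3 ->
  e13 * h = cm_act c1 h' * e12 * cm_act g12 e23.
Proof.
move=> gE cE bE bE' e12E e23E e13E; apply: (@cm_act_inj _ X a1).
rewrite !cm_actMr -!cm_actM gE cE !cm_actM.
apply: (@mulIg _ b12); apply: (@mulIg _ b23); apply: (@mulIg _ r3).
transitivity (r1 * b13').
  by rewrite e13E bE !mulgA.
rewrite bE' !mulgA -(cm_act_beta r1) -(mulgA _ r1) e12E !mulgA.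
rewrite -(mulgA _ r2) e23E !mulgA.
by rewrite -[in RHS](mulgA _ _ b12) (cm_act_beta b12) !mulgA.
Qed.

(** The coordinates of twisted morphisms again satisfy the triangle identity, now
    for [h] instead of [h']. *)
Lemma twisted_relation (a1' a2' c1 c2 g12 g12' : cmG X)
    (b12' b23' b13' h h' e12 e23 e13 : cmH X) :
  a1' * g12' = cm_beta b12' * a2' -> c1 * g12' = cm_beta e12 * g12 * c2 ->
  b13' = cm_act a1' h' * b12' * b23' ->
  e13 * h = cm_act c1 h' * e12 * cm_act g12 e23 ->
  cm_act (a1' * c1^-1) e13^-1 * b13' =
  cm_act (a1' * c1^-1) h * (cm_act (a1' * c1^-1) e12^-1 * b12') *
    (cm_act (a2' * c2^-1) e23^-1 * b23').
Proof.
move=> gE cE bE eE.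
have -> : h = e13^-1 * cm_act c1 h' * e12 * cm_act g12 e23.
  by rewrite -!mulgA (mulgA (cm_act c1 h')) -eE mulKg.
have kE : a1' * c1^-1 * g12 = cm_beta (cm_act (a1' * c1^-1) e12^-1 * b12') * (a2' * c2^-1).
  rewrite cm_betaM cm_beta_act cm_betaV -!mulgA; congr (_ * _).
  rewrite (mulgA (cm_beta b12')) -gE -!mulgA.
  rewrite invgM invgK -!mulgA mulKg (mulgA c1) cE.
  by rewrite -!mulgA mulgV mulg1 mulKg.
set k1 := a1' * c1^-1 in kE *; set k2 := a2' * c2^-1 in kE *.
rewrite bE !cm_actMr -[cm_act k1 (cm_act c1 h')]cm_actM -[cm_act k1 (cm_act g12 e23)]cm_actM.
rewrite kE [k1 * c1]mulgVK cm_actM.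
set d := cm_act k1 e12^-1 * b12'; rewrite -!mulgA; congr (_ * (_ * _)).
rewrite [X in _ = _ * (_ * X)]mulgA -/d (mulgA (cm_act (cm_beta d) _)) (cm_act_beta d).
rewrite -(mulgA d) (mulgA (cm_act k2 _)) cm_actV mulgV mul1g.
by rewrite /d cm_actV !mulgA mulgV mul1g.
Qed.

End CrossedModuleAlgebra.

Section DescentComparison.
Variables (R : realType) (X : crossed_module R) (M : manifoldType R).
Implicit Types (z : cocycle X M).

Lemma descends_morphism (P Q : bundle X M) (F : functor P Q) z :
  bundle_morphism F -> descends P z -> descends Q z.
Proof.
move=> [[[sF0 sF1] FO FM] [Fpr _]] [s [sg [d1 d2 d3 d4 d5 d6]]].
exists (fun i x => fob F (s i x)), (fun i j x => fmor F (sg i j x)).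
have FactO p k : fob F (actO p k) = actO (fob F p) k by exact: FO.
have FactM f a : fmor F (actM f a) = actM (fmor F f) a by exact: FM.
split.
- by move=> i x Ui; apply: smooth_at_smooth_comp => //; exact: d1.
- by move=> i x Ui; rewrite -[RHS](d2 i)//; exact: Fpr.
- by move=> i j x Ui Uj; apply: smooth_at_smooth_comp => //; exact: d3.
- by move=> i j x Ui Uj; rewrite src_fmor d4.
- by move=> i j x Ui Uj; rewrite tgt_fmor d5// FactO.
- move=> i j k x Ui Uj Uk; rewrite (d6 i j k)//.
  have e : src (actM (sg i j x) (1, cc_g j k x)) = tgt (sg j k x).
    by rewrite src_actM d4// d5.
  rewrite fmor_compm; last first.
    rewrite tgt_compm// src_actM src_idm tgt_actM d5//= cm_beta1 mul1g.
    by rewrite actOM.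
  by rewrite fmor_compm// !FactM fmor_idm.
Qed.

(** The isomorphism goes through [fr_sec].  Its coordinate in any frame is computed
    from coordinates of [fr_iso] by operations of [H]; it therefore
    depends smoothly on [p] and [q] even where inversion of morphisms does not. *)
Lemma framed_iso_mor (P : over_g2space X M) (U : set M) (t : frame P) p q :
  is_frame U t -> U (proj p) -> U (proj q) ->
  proj p = proj q -> fr_ob t p = fr_ob t q ->
  exists f, [/\ src f = p, tgt f = q & forall V l', is_frame V l' -> V (proj p) ->
    fr_mor l' f = fr_mor l' (fr_iso t q) * (fr_mor l' (fr_iso t p))^-1].
Proof.
move=> tF Up Uq pq tpq.
have [k [e1 e2 e3 e4]] := (isoP _).1 (iso_fr_iso tF Up).
rewrite (tgt_fr_iso tF) // in e2 e3.
have e5 : src (fr_iso t q) = tgt k.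
  by rewrite -e1 !(src_fr_iso tF)// pq tpq.
exists (compm (fr_iso t q) k); split.
- by rewrite src_compm.
- by rewrite tgt_compm// (tgt_fr_iso tF).
- move=> V l' l'F Vp; rewrite (fr_mor_compm l'F) ?e2//; congr (_ * _).
  have := fr_mor_compm l'F (f := fr_iso t p) (g := k).
  rewrite e1 e2 e3 => /(_ Vp erefl); rewrite (fr_mor_idm l'F)// => /esym.
  by move=> /mulg1_eq.
Qed.

(** The cover is indexed by triples [j = (i, i', k)] with [k] the index of a
    frame, which provides over [V j] an isomorphism [rho] from [s' i'] to
    [s i . c j].  The element [e j1 j2] compares the two ways from [s' i2'] to
    [s i1 . c j1 g'] through [rho] at either end. *)
Lemma descends_cohomologous (P : bundle X M) z z' :
  descends P z -> descends P z' -> cohomologous z z'.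
Proof.
move=> [s [sg sP]] [s' [sg' s'P]].
have [I [W [cW [t tP]]]] := exists_strict_frames P.
have tF k : is_frame (W k) (t k) by case: (tP k).
have [[oU _] _ _ [gE hE g1 h1]] := cocycleP z.
have [[oU' _] _ _ [gE' hE' g1' h1']] := cocycleP z'.
have sP' := ds_proj sP; have s'P' := ds_proj s'P.
pose J := (cc_index z * cc_index z' * I)%type.
pose V (j : J) := cc_cover j.1.1 `&` cc_cover j.1.2 `&` W j.2.
(* gamma: the quotient of the coordinates of the two sections. *)
pose c (j : J) x := (fr_ob (t j.2) (s j.1.1 x))^-1 * fr_ob (t j.2) (s' j.1.2 x).
(* The coordinate of rho in the frame l. *)
pose r (l : I) (j : J) x :=
  fr_mor (t l) (fr_iso (t j.2) (actO (s j.1.1 x) (c j x))) *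
  (fr_mor (t l) (fr_iso (t j.2) (s' j.1.2 x)))^-1.
(* eta: read off in the frame of j1, where it is visibly smooth; eframe shows
that it solves the same equation in every frame. *)
pose e (j1 j2 : J) x :=
  cm_act (fr_ob (t j1.2) (s j1.1.1 x))^-1
    (r j1.2 j1 x * fr_mor (t j1.2) (sg' j1.1.2 j2.1.2 x) * (r j1.2 j2 x)^-1 *
     (fr_mor (t j1.2) (sg j1.1.1 j2.1.1 x))^-1).
have oV j : open (V j).
  by apply: openI; [apply: openI|case: cW => + _; apply].
have cV : open_cover V.
  split => //; apply/seteqP; split => // x _.
  have [i Ui] := cover_at x (let: And4 c _ _ _ := cocycleP z in c).
  have [i' Ui'] := cover_at x (let: And4 c _ _ _ := cocycleP z' in c).
  have [k Wk] := cover_at x cW.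
  by exists ((i, i'), k).
have rho j x : V j x -> exists f, [/\ src f = s' j.1.2 x,
    tgt f = actO (s j.1.1 x) (c j x) &
    forall l, W l x -> fr_mor (t l) f = r l j x].
  move=> [[Ui Ui'] Wk].
  have q1 : proj (s' j.1.2 x) = x by rewrite s'P'.
  have q2 : proj (actO (s j.1.1 x) (c j x)) = x by rewrite proj_actO sP'.
  have [||||f [f1 f2 f3]] := framed_iso_mor (p := s' j.1.2 x)
    (q := actO (s j.1.1 x) (c j x)) (tF j.2).
  - by rewrite q1.
  - by rewrite q2.
  - by rewrite q1 q2.
  - by rewrite (fr_ob_act (tF _)) ?sP'// mulVKg.
  exists f; split => // l Wl; apply: (f3 _ _ (tF l)); by rewrite s'P'.
have ebeta j1 j2 x : V j1 x -> V j2 x ->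
    c j1 x * cc_g j1.1.2 j2.1.2 x = cm_beta (e j1 j2 x) * cc_g j1.1.1 j2.1.1 x * c j2 x.
  move=> V1 V2; have [f1 [sf1 tf1 mf1]] := rho j1 x V1; have [f2 [sf2 tf2 mf2]] := rho j2 x V2.
  move: (V1) (V2) => [[U1 U1'] W1] [[U2 U2'] W2].
  apply: (@coboundary_beta _ _ (fr_ob (t j1.2) (s j1.1.1 x)) (fr_ob (t j1.2) (s j2.1.1 x))
    (fr_ob (t j1.2) (s' j1.1.2 x)) (fr_ob (t j1.2) (s' j2.1.2 x)) _ _ _ _
    (fr_mor (t j1.2) (sg j1.1.1 j2.1.1 x)) (fr_mor (t j1.2) (sg' j1.1.2 j2.1.2 x))
    (r j1.2 j1 x) (r j1.2 j2 x)).
  - exact: (descent_frame_ob sP (tF j1.2)).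
  - exact: (descent_frame_ob s'P (tF j1.2)).
  - by rewrite -mf1//; apply: (frame_mor_cod (tF _)) sf1 tf1; rewrite s'P'.
  - by rewrite -mf2//; apply: (frame_mor_cod (tF _)) sf2 tf2; rewrite s'P'.
  - by rewrite /e cm_actVK !mulgVK.
have eframe l j1 j2 x : W l x -> V j1 x -> V j2 x ->
    r l j1 x * fr_mor (t l) (sg' j1.1.2 j2.1.2 x) =
    cm_act (fr_ob (t l) (s j1.1.1 x)) (e j1 j2 x) *
      fr_mor (t l) (sg j1.1.1 j2.1.1 x) * r l j2 x.
  move=> Wl V1 V2; have [f1 [sf1 tf1 mf1]] := rho j1 x V1; have [f2 [sf2 tf2 mf2]] := rho j2 x V2.
  have bE := ebeta _ _ _ V1 V2.
  move: (V1) (V2) => [[U1 U1'] W1] [[U2 U2'] W2].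
  have k1 : src (actM f1 (1, cc_g j1.1.2 j2.1.2 x)) = tgt (sg' j1.1.2 j2.1.2 x).
    by rewrite src_actM sf1 (ds_tgt s'P).
  pose f := compm (actM f1 (1, cc_g j1.1.2 j2.1.2 x)) (sg' j1.1.2 j2.1.2 x).
  have sf : src f = s' j2.1.2 x by rewrite src_compm// (ds_src s'P).
  have tf : tgt f = actO (s j1.1.1 x) (c j1 x * cc_g j1.1.2 j2.1.2 x).
    by rewrite tgt_compm// tgt_actM tf1 /= cm_beta1 mul1g -actOM.
  have mf l' : W l' x -> fr_mor (t l') f = r l' j1 x * fr_mor (t l') (sg' j1.1.2 j2.1.2 x).
    move=> Wl'; rewrite (fr_mor_compm (tF l')) ?(ds_src s'P) ?s'P'//.
    by rewrite (fr_mor_act (tF l')) ?sf1 ?s'P'//= cm_actr1 mulg1 mf1.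
  have U3 l' : W l' x -> W l' (proj (s' j2.1.2 x)) by rewrite s'P'.
  have T l' := triangleP (tF l') (ds_src sP U1 U2) (ds_tgt sP U1 U2) sf2 tf2 sf tf.
  rewrite -mf// -mf2//.
  apply/(T (e j1 j2 x) l (U3 _ Wl)) => //; apply/(T (e j1 j2 x) _ (U3 _ W1)) => //.
  by rewrite mf// mf2// /e cm_actVK !mulgVK.
exists J, V, (fun j => j.1.1), (fun j => j.1.2), c, e; split => //.
- by move=> j; split; [move=> x [[]]|move=> x [[]]].
- move=> j; apply/smooth_onP => // x [[Ui Ui'] Wk]; apply: smooth_at_mulg.
    apply: smooth_at_invg; apply: (smooth_section_frame (tF _)); rewrite ?sP'//.
    exact: (ds_sec_smooth sP).
  by apply: (smooth_section_frame (tF _)); rewrite ?s'P'//; exact: (ds_sec_smooth s'P).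
- move=> j1 j2; apply/smooth_onP; first exact: openI.
  move=> x [V1 V2]; move: (V1) (V2) => [[U1 U1'] W1] [[U2 U2'] W2].
  have sc j y : V j y -> smooth_at (c j) y.
    move=> [[Ui Ui'] Wk]; apply: smooth_at_mulg.
      apply: smooth_at_invg; apply: (smooth_section_frame (tF _)); rewrite ?sP'//.
      exact: (ds_sec_smooth sP).
    by apply: (smooth_section_frame (tF _)); rewrite ?s'P'//; exact: (ds_sec_smooth s'P).
  have sr l j : V j x -> W l x -> smooth_at (r l j) x.
    move=> Vj Wl; move: (Vj) => [[Ui Ui'] Wk]; apply: smooth_at_mulg.
      apply: (smooth_mor_frame (tF l)); last first.
        by rewrite (src_fr_iso (tF _)) ?proj_actO ?(proj_fr_sec (tF _)) ?sP'.
      apply: (smooth_iso_frame (tF _)); last by rewrite proj_actO sP'.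
      by apply: smooth_at_actO; [exact: (ds_sec_smooth sP)|exact: sc].
    apply: smooth_at_invg; apply: (smooth_mor_frame (tF l)); last first.
      by rewrite (src_fr_iso (tF _)) ?proj_actO ?(proj_fr_sec (tF _)) ?s'P'.
    by apply: (smooth_iso_frame (tF _)); rewrite ?s'P'//; exact: (ds_sec_smooth s'P).
  apply: smooth_at_act.
    apply: smooth_at_invg; apply: (smooth_section_frame (tF _)); rewrite ?sP'//.
    exact: (ds_sec_smooth sP).
  apply: smooth_at_mulg; [apply: smooth_at_mulg; [apply: smooth_at_mulg|]|].
  + exact: sr.
  + by apply: (smooth_mor_frame (tF _)); rewrite ?(ds_src s'P) ?s'P'//; exact: (ds_mor_smooth s'P).
  + by apply: smooth_at_invg; exact: sr.
  + apply: smooth_at_invg; apply: (smooth_mor_frame (tF _)).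
      exact: (ds_mor_smooth sP).
    by rewrite (ds_src sP)// sP'.
split.
- by move=> j1 j2 x [V1 V2]; exact: ebeta.
- move=> j1 j2 j3 x [[V1 V2] V3].
  have [f1 [sf1 tf1 mf1]] := rho j1 x V1.
  move: (V1) (V2) (V3) => [[U1 U1'] W1] [[U2 U2'] W2] [[U3 U3'] W3].
  apply: coboundary_relation (eframe _ _ _ _ W1 V1 V2) (eframe _ _ _ _ W1 V2 V3)
    (eframe _ _ _ _ W1 V1 V3).
  + exact: (descent_frame_ob sP (tF j1.2)).
  + rewrite -mf1//; apply: (frame_mor_cod (tF _)) sf1 tf1; by rewrite s'P'.
  + exact: (descent_frame_mor (cocycleP z) sP (tF _)).
  + exact: (descent_frame_mor (cocycleP z') s'P (tF _)).
- move=> j x Vj; move: (Vj) => [[Ui Ui'] Wk].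
  have := eframe _ _ _ _ Wk Vj Vj.
  rewrite (descent_frame_id (cocycleP z) sP (tF _) Wk Ui).
  rewrite (descent_frame_id (cocycleP z') s'P (tF _) Wk Ui') !mulg1.
  rewrite -[X in X = _ -> _]mul1g => /mulIg/esym E.
  by apply: (@cm_act_inj _ X (fr_ob (t j.2) (s j.1.1 x))); rewrite E cm_actr1.
Qed.

End DescentComparison.

(** * Refinement of cocycles *)

Section Refinement.
Variables (R : realType) (X : crossed_module R) (M : manifoldType R).
Implicit Types (z : cocycle X M).

Definition refine_data z (J : Type) (V : J -> set M) (p : J -> cc_index z) :
    cocycle_data X M :=
  CocycleData V (fun i j => cc_g (p i) (p j)) (fun i j k => cc_h (p i) (p j) (p k)).

Lemma refine_is_cocycle z (J : Type) (V : J -> set M) (p : J -> cc_index z) :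
  open_cover V -> (forall i, V i `<=` cc_cover (p i)) -> is_cocycle (refine_data V p).
Proof.
move=> cV VU; have [[oU _] sg sh [gE hE g1 h1]] := cocycleP z.
have oV i : open (V i) by case: cV => + _; apply.
split => //=.
- move=> i j; apply/smooth_onP; first exact: openI.
  move=> x [/VU Ui /VU Uj]; have /smooth_onP := sg (p i) (p j); apply => //.
  exact: openI.
- move=> i j k; apply/smooth_onP; first by apply: openI => //; exact: openI.
  move=> x [[/VU Ui /VU Uj] /VU Uk]; have /smooth_onP := sh (p i) (p j) (p k).
  by apply => //; apply: openI => //; exact: openI.
split.
- by move=> i j k x [[/VU Ui /VU Uj] /VU Uk]; exact: gE.
- by move=> i j k l x [[[/VU Ui /VU Uj] /VU Uk] /VU Ul]; exact: hE.
- by move=> i x /VU; exact: g1.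
- by move=> i j x [/VU Ui /VU Uj]; exact: h1.
Qed.

Definition refine z (J : Type) (V : J -> set M) (p : J -> cc_index z)
    (cV : open_cover V) (VU : forall i, V i `<=` cc_cover (p i)) : cocycle X M :=
  Cocycle (refine_is_cocycle cV VU).

Section Refine.
Variables (z : cocycle X M) (J : Type) (V : J -> set M) (p : J -> cc_index z).
Variables (cV : open_cover V) (VU : forall i, V i `<=` cc_cover (p i)).

Lemma descends_refine (P : over_g2space X M) :
  descends P z -> descends P (refine cV VU).
Proof.
move=> [s [sg [d1 d2 d3 d4 d5 d6]]].
exists (fun i => s (p i)), (fun i j => sg (p i) (p j)).
split => /=.
- by move=> i x /VU; exact: d1.
- by move=> i x /VU; exact: d2.
- by move=> i j x /VU Ui /VU; exact: d3.
- by move=> i j x /VU Ui /VU; exact: d4.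
- by move=> i j x /VU Ui /VU; exact: d5.
- by move=> i j k x /VU Ui /VU Uj /VU; exact: d6.
Qed.

(** The same maps [gamma] and [eta] do. *)
Lemma cohomologous_refinel z' : cohomologous (refine cV VU) z' -> cohomologous z z'.
Proof.
move=> [K [W [q [q' [c [e [cW WV sc se H]]]]]]].
exists K, W, (fun i => p (q i)), q', c, e; split => //.
by move=> i; have [WVi WUi] := WV i; split => // x /WVi /VU.
Qed.

Lemma cohomologous_refiner z' : cohomologous z' (refine cV VU) -> cohomologous z' z.
Proof.
move=> [K [W [q [q' [c [e [cW WV sc se H]]]]]]].
exists K, W, q, (fun i => p (q' i)), c, e; split => //.
by move=> i; have [WUi WVi] := WV i; split => // x /WVi /VU.
Qed.

End Refine.

(** The sections [s'_i . c_i^-1] with the morphisms of the given datum, translated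
    by [c_j^-1] and followed by the morphism of H-component [e^-1]. *)
Lemma cohomologous_descends z z' : cohomologous z z' ->
  exists (J : Type) (V : J -> set M) (p : J -> cc_index z) (cV : open_cover V)
         (VU : forall i, V i `<=` cc_cover (p i)),
  forall P : bundle X M, descends P z' -> descends P (refine cV VU).
Proof.
move=> [J [V [p [p' [c [e [cV VU sc se [E1 E2 E3]]]]]]]].
have VUl i : V i `<=` cc_cover (p i) by case: (VU i).
have VUr i : V i `<=` cc_cover (p' i) by case: (VU i).
exists J, V, p, cV, VUl => P [s [sg sP]].
have oV i : open (V i) by case: cV => + _; apply.
have [[oU _] sg_ sh_ [gE hE g1 h1]] := cocycleP z.
have scx i x : V i x -> smooth_at (c i) x.
  by move=> Vi; have /smooth_onP := sc i; apply.
have sex i j x : V i x -> V j x -> smooth_at (e i j) x.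
  by move=> Vi Vj; have /smooth_onP := se i j; apply => //; exact: openI.
have sgx i j x : V i x -> V j x -> smooth_at (cc_g (p i) (p j)) x.
  move=> /VUl Ui /VUl Uj; have /smooth_onP := sg_ (p i) (p j); apply => //; exact: openI.
pose t i x := actO (s (p' i) x) (c i x)^-1.
pose m1 i j x := actM (sg (p' i) (p' j) x) (1, (c j x)^-1).
pose m2 i j x := actM (idm (t i x)) ((e i j x)^-1, cm_beta (e i j x) * cc_g (p i) (p j) x).
pose ta i j x := compm (m2 i j x) (m1 i j x).
have m12 i j x : V i x -> V j x -> src (m2 i j x) = tgt (m1 i j x).
  move=> Vi Vj; rewrite src_actM src_idm tgt_actM (ds_tgt sP (VUr _ _ Vi) (VUr _ _ Vj)) /=.
  rewrite cm_beta1 mul1g /t -!actOM; congr actO; apply: (@mulgI _ (c i x)).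
  by rewrite mulVKg mulgA E1// mulgK.
have srct i j x : V i x -> V j x -> src (ta i j x) = t j x.
  move=> Vi Vj; rewrite src_compm ?m12// src_actM.
  by rewrite (ds_src sP (VUr _ _ Vi) (VUr _ _ Vj)).
have tgtt i j x : V i x -> V j x -> tgt (ta i j x) = actO (t i x) (cc_g (p i) (p j) x).
  move=> Vi Vj; rewrite tgt_compm ?m12// tgt_actM tgt_idm /=.
  by rewrite cm_betaV mulKg.
have projt i x : V i x -> proj (t i x) = x.
  by move=> /VUr Ui; rewrite proj_actO (ds_proj sP).
have st i x : V i x -> smooth_at (t i) x.
  move=> Vi; apply: smooth_at_actO; first exact: (ds_sec_smooth sP (VUr _ _ Vi)).
  by apply: smooth_at_invg; exact: scx.
exists t, ta; split => //=.
- move=> i j x Vi Vj; apply: smooth_at_compm.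
  + have nV : \forall y \near x, (V i `&` V j) y.
      by apply: open_nbhs_nbhs; split => //; exact: openI.
    by apply: filterS nV => y [Viy Vjy]; exact: m12.
  + apply: smooth_at_actM; first by apply: smooth_at_idm; exact: st.
    apply: smooth_at_pair; first by apply: smooth_at_invg; exact: sex.
    by apply: smooth_at_mulg; [apply: smooth_at_beta; exact: sex|exact: sgx].
  + apply: smooth_at_actM; first exact: (ds_mor_smooth sP (VUr _ _ Vi) (VUr _ _ Vj)).
    apply: smooth_at_pair; first exact: smooth_at_cst.
    by apply: smooth_at_invg; exact: scx.
- move=> i j k x Vi Vj Vk.
  have [I [W [cW [fr frP]]]] := exists_strict_frames P.
  have [l Wl] := cover_at x cW; have [lF _ _] := frP l.
  have mta a b : V a x -> V b x -> fr_mor (fr l) (ta a b x) =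
      cm_act (fr_ob (fr l) (s (p' a) x) * (c a x)^-1) (e a b x)^-1 *
      fr_mor (fr l) (sg (p' a) (p' b) x).
    move=> Va Vb; have pa := ds_proj sP (VUr _ _ Va); have pb := ds_proj sP (VUr _ _ Vb).
    have sab := ds_src sP (VUr _ _ Va) (VUr _ _ Vb).
    rewrite (fr_mor_compm lF) ?m12//; last by rewrite src_actM sab proj_actO pb.
    rewrite !(fr_mor_act lF) ?src_idm ?projt ?sab ?pb//=.
    by rewrite (fr_mor_idm lF) ?projt// mul1g cm_actr1 mulg1 (fr_ob_act lF) ?pa.
  apply/(triangleP lF (srct _ _ _ Vi Vj) (tgtt _ _ _ Vi Vj) (srct _ _ _ Vj Vk)
    (tgtt _ _ _ Vj Vk) (srct _ _ _ Vi Vk) (tgtt _ _ _ Vi Vk)).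
  + by rewrite projt.
  + by apply: gE; split; [split|]; exact: VUl.
  rewrite !mta// (fr_ob_act lF) ?(ds_proj sP (VUr _ _ Vi))//.
  apply: twisted_relation.
  + exact: (descent_frame_ob sP lF Wl (VUr _ _ Vi) (VUr _ _ Vj)).
  + exact: E1.
  + exact: (descent_frame_mor (cocycleP z') sP lF Wl (VUr _ _ Vi) (VUr _ _ Vj) (VUr _ _ Vk)).
  + by apply: E2.
Qed.

End Refinement.

(** * The 2-space of a cocycle *)

Section CocycleBundle.
Variables (R : realType) (X : crossed_module R) (M : manifoldType R).
Variable z : cocycle X M.

Local Notation I := (discrete_index (cc_index z)).
Local Notation U := (@cc_cover R X M z).
Local Notation g := (@cc_g R X M z).
Local Notation h := (@cc_h R X M z).

Lemma cc_beta_h i j k x : U i x -> U j x -> U k x ->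
  cm_beta (h i j k x) * g i j x * g j k x = g i k x.
Proof. by move=> Ui Uj Uk; have [_ _ _ [E _ _ _]] := cocycleP z; exact: E. Qed.

Lemma cc_h_assoc i j k l x : U i x -> U j x -> U k x -> U l x ->
  h i k l x * h i j k x = h i j l x * cm_act (g i j x) (h j k l x).
Proof. by move=> Ui Uj Uk Ul; have [_ _ _ [_ E _ _]] := cocycleP z; exact: E. Qed.

Lemma cc_g_id i x : U i x -> g i i x = 1.
Proof. by have [_ _ _ [_ _ E _]] := cocycleP z; exact: E. Qed.

Lemma cc_h_idr i j x : U i x -> U j x -> h i j j x = 1.
Proof. by move=> Ui Uj; have [_ _ _ [_ _ _ /(_ i j x (conj Ui Uj))[]]] := cocycleP z. Qed.

Lemma cc_h_idl i j x : U i x -> U j x -> h j j i x = 1.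
Proof. by move=> Ui Uj; have [_ _ _ [_ _ _ /(_ i j x (conj Ui Uj))[]]] := cocycleP z. Qed.

Lemma cc_open i : open (U i). Proof. by have [[+ _] _ _ _] := cocycleP z; apply. Qed.

Lemma cc_g_smooth_at i j x : U i x -> U j x -> smooth_at (g i j) x.
Proof.
move=> Ui Uj; have [_ + _ _] := cocycleP z => /(_ i j)/smooth_onP; apply => //.
by apply: openI; exact: cc_open.
Qed.

Lemma cc_h_smooth_at i j k x : U i x -> U j x -> U k x -> smooth_at (h i j k) x.
Proof.
move=> Ui Uj Uk; have [_ _ + _] := cocycleP z => /(_ i j k)/smooth_onP; apply => //.
by apply: openI; [apply: openI|]; exact: cc_open.
Qed.

(** The pair [(i, (x, k))] stands for [s_i x . k] and the tuple
    [((i, j), (x, (a, k)))] for the morphism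
    [(id . (a, g_ij k)) o (sg_ij x . k)] from [s_j x . k] to
    [s_i x . (beta a * g_ij * k)], where [s] and [sg] form the universal descent
    datum of type [z]. *)
Definition cb_ob_set : set (I * (M * cmG X)) := [set p | U p.1 p.2.1].
Definition cb_mor_set : set ((I * I) * (M * (cmH X * cmG X))) :=
  [set f | U f.1.1 f.2.1 /\ U f.1.2 f.2.1].

Definition cb_ob : chartedType R := set_type cb_ob_set.
Definition cb_mor : chartedType R := set_type cb_mor_set.

Lemma cb_obP (p : cb_ob) : U (set_val p).1 (set_val p).2.1.
Proof. exact: (set_valP p). Qed.
Lemma cb_morP (f : cb_mor) :
  U (set_val f).1.1 (set_val f).2.1 /\ U (set_val f).1.2 (set_val f).2.1.
Proof. exact: (set_valP f). Qed.

Definition cb_src_val (f : (I * I) * (M * (cmH X * cmG X))) : I * (M * cmG X) :=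
  (f.1.2, (f.2.1, f.2.2.2)).
Definition cb_tgt_val (f : (I * I) * (M * (cmH X * cmG X))) : I * (M * cmG X) :=
  (f.1.1, (f.2.1, cm_beta f.2.2.1 * g f.1.1 f.1.2 f.2.1 * f.2.2.2)).
Definition cb_idm_val (p : I * (M * cmG X)) : (I * I) * (M * (cmH X * cmG X)) :=
  ((p.1, p.1), (p.2.1, (1, p.2.2))).
(** To compose, [sg_ij] is moved past [a'] by interchange, which turns [a'] into
    [g_ij . a'], and then the triangle identity replaces [sg_ij] after
    [sg_jk] by [sg_ik], at the cost of [h_ijk^-1]. *)
Definition cb_cmp_val (f f' : (I * I) * (M * (cmH X * cmG X))) :
    (I * I) * (M * (cmH X * cmG X)) :=
  ((f.1.1, f'.1.2), (f'.2.1,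
    (f.2.2.1 * cm_act (g f.1.1 f'.1.1 f'.2.1) f'.2.2.1 *
       (h f.1.1 f'.1.1 f'.1.2 f'.2.1)^-1, f'.2.2.2))).

Lemma cb_src_subproof (f : cb_mor) : cb_src_val (set_val f) \in cb_ob_set.
Proof. by apply/mem_set; case: (cb_morP f). Qed.
Lemma cb_tgt_subproof (f : cb_mor) : cb_tgt_val (set_val f) \in cb_ob_set.
Proof. by apply/mem_set; case: (cb_morP f). Qed.
Lemma cb_idm_subproof (p : cb_ob) : cb_idm_val (set_val p) \in cb_mor_set.
Proof. by apply/mem_set; have Up := set_valP p; split. Qed.

Definition cb_src (f : cb_mor) : cb_ob := exist _ (cb_src_val (set_val f)) (cb_src_subproof f).
Definition cb_tgt (f : cb_mor) : cb_ob := exist _ (cb_tgt_val (set_val f)) (cb_tgt_subproof f).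
Definition cb_idm (p : cb_ob) : cb_mor := exist _ (cb_idm_val (set_val p)) (cb_idm_subproof p).

Lemma cb_cmp_subproof (f f' : cb_mor) : cb_src f = cb_tgt f' ->
  cb_cmp_val (set_val f) (set_val f') \in cb_mor_set.
Proof.
move=> /(congr1 (fun p => (set_val p).2.1)) /= e; apply/mem_set.
case: (cb_morP f) (cb_morP f') => fi _ [_ fk].
by split => //=; rewrite -e.
Qed.

Definition cb_cmp (f f' : cb_mor) (e : cb_src f = cb_tgt f') : cb_mor :=
  exist _ (cb_cmp_val (set_val f) (set_val f')) (cb_cmp_subproof e).

Lemma cb_composable (f f' : cb_mor) : cb_src f = cb_tgt f' <->
  [/\ (set_val f).1.2 = (set_val f').1.1, (set_val f).2.1 = (set_val f').2.1 &
      (set_val f).2.2.2 = cm_beta (set_val f').2.2.1 *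
        g (set_val f').1.1 (set_val f').1.2 (set_val f').2.1 * (set_val f').2.2.2].
Proof.
split=> [e|[e1 e2 e3]]; last by apply: val_inj; rewrite /= /cb_src_val /cb_tgt_val e1 e2 e3.
split.
- exact: (congr1 (fun p => (set_val p).1) e).
- exact: (congr1 (fun p => (set_val p).2.1) e).
- exact: (congr1 (fun p => (set_val p).2.2) e).
Qed.

Lemma cb_mor_eq i j x (a a' : cmH X) (k k' : cmG X) : a = a' -> k = k' ->
  ((i, j), (x, (a, k))) = ((i, j), (x, (a', k'))) :> (I * I) * (M * (cmH X * cmG X)).
Proof. by move=> -> ->. Qed.

Lemma cocycle_act_inv i j k x (y : cmG X) (l : cmH X) : U i x -> U j x -> U k x ->
  (h i j k x)^-1 * cm_act (g i k x * y) l =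
  cm_act (g i j x * (g j k x * y)) l * (h i j k x)^-1.
Proof.
move=> Ui Uj Uk; rewrite -(@cc_beta_h i j k x)// -!mulgA (cm_actM (cm_beta _)) cm_peiffer.
by rewrite !mulgA mulVg mul1g.
Qed.

Lemma act_interchange (k l : cmG X) (a b b' : cmH X) :
  cm_act k a * cm_act (k * l) (b * b') =
  cm_act (k * (cm_beta a * l)) b * cm_act k (a * cm_act l b').
Proof.
rewrite (cm_actM k l) (cm_actM k (_ * l)) (cm_actM (cm_beta a)) -!cm_actMr.
by congr cm_act; rewrite cm_actMr cm_peiffer -!mulgA mulKg.
Qed.

#[local] Obligation Tactic := idtac.

Program Definition cb_category : category R :=
  @Category R cb_ob cb_mor cb_src cb_tgt cb_idm cb_cmp _ _ _ _ _ _ _.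
Next Obligation. by move=> p; apply: val_inj; case: p => -[i [x k]] u. Qed.
Next Obligation.
move=> p; have := set_valP p; case: p => -[i [x k]] u /= Ui.
by apply: val_inj; rewrite /= /cb_tgt_val /= cc_g_id// cm_beta1 !mul1g.
Qed.
Next Obligation. by move=> f f' e; apply: val_inj. Qed.
Next Obligation.
move=> f f' e; have [e1 e2 e3] := (cb_composable f f').1 e.
apply: val_inj; rewrite /= /cb_tgt_val /cb_cmp_val /=.
have [Ui _] := cb_morP f; have [Uj Uk] := cb_morP f'; rewrite e2 in Ui.
rewrite e3 e2 e1 !cm_betaM cm_beta_act cm_betaV.
rewrite -(cc_beta_h Ui Uj Uk) -!mulgA; congr (_, (_, _)).
by rewrite !(mulKg, mulVKg).
Qed.
Next Obligation.
move=> f e; apply: val_inj; have := cb_morP f.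
case: f e => -[[i j] [x [a k]]] u e [/= Ui Uj].
by apply: cb_mor_eq; rewrite // cc_g_id// cc_h_idl// invg1 cm_act1 mul1g mulg1.
Qed.
Next Obligation.
move=> f e; apply: val_inj; have := cb_morP f.
case: f e => -[[i j] [x [a k]]] u e [/= Ui Uj].
by apply: cb_mor_eq; rewrite // cc_h_idr// invg1 cm_actr1 !mulg1.
Qed.
Next Obligation.
move=> f1 f2 f3 e12 e23 e e'.
have [e1 e2 _] := (cb_composable _ _).1 e12; have [e3 e4 _] := (cb_composable _ _).1 e23.
have [Ui _] := cb_morP f1; have [Uj _] := cb_morP f2; have [Uk Ul] := cb_morP f3.
rewrite e2 e4 in Ui; rewrite e4 in Uj.
apply: val_inj; rewrite /= /cb_cmp_val /= e3 e4.
apply: cb_mor_eq => //.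
rewrite !cm_actMr -cm_actM cm_actV -!mulgA; congr (_ * (_ * _)).
rewrite -invgM -(cc_h_assoc Ui Uj Uk Ul) invgM.
have := @cocycle_act_inv _ _ _ _ 1 (set_val f3).2.2.1 Ui Uj Uk; rewrite !mulg1 => E.
by rewrite mulgA E -!mulgA.
Qed.

Definition cb_act_ob_val (p : (I * (M * cmG X)) * cmG X) : I * (M * cmG X) :=
  (p.1.1, (p.1.2.1, p.1.2.2 * p.2)).
(** [(a, g_ij k) * (b, l) = (a * (g_ij k . b), g_ij k l)] in the semidirect
    product. *)
Definition cb_act_mor_val (f : ((I * I) * (M * (cmH X * cmG X))) * (cmH X * cmG X)) :
    (I * I) * (M * (cmH X * cmG X)) :=
  (f.1.1, (f.1.2.1,
    (f.1.2.2.1 * cm_act (g f.1.1.1 f.1.1.2 f.1.2.1 * f.1.2.2.2) f.2.1,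
     f.1.2.2.2 * f.2.2))).

Lemma cb_act_ob_subproof (p : cb_ob * cmG X) :
  cb_act_ob_val (set_val p.1, p.2) \in cb_ob_set.
Proof. by apply/mem_set; have Up := set_valP p.1. Qed.
Lemma cb_act_mor_subproof (f : cb_mor * (cmH X * cmG X)) :
  cb_act_mor_val (set_val f.1, f.2) \in cb_mor_set.
Proof. by apply/mem_set; have Up := cb_morP f.1. Qed.

Program Definition cb_act : functor (prod_category cb_category (lie2group X)) cb_category :=
  @Functor R (prod_category cb_category (lie2group X)) cb_category
    (fun p => exist _ (cb_act_ob_val (set_val p.1, p.2)) (cb_act_ob_subproof p))
    (fun f => exist _ (cb_act_mor_val (set_val f.1, f.2)) (cb_act_mor_subproof f))
    _ _ _ _.
Next Obligation. by move=> [f a]; apply: val_inj. Qed.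
Next Obligation.
move=> [[[[i j] [x [a k]]] u] [a' k']]; apply: val_inj.
rewrite /= /cb_tgt_val /cb_act_ob_val /=; congr (_, (_, _)).
by rewrite cm_betaM cm_beta_act invgM -!mulgA !mulKg.
Qed.
Next Obligation.
move=> [[[i [x k]] u] k']; apply: val_inj; apply: cb_mor_eq => //=.
by rewrite cm_actr1 mulg1.
Qed.
Next Obligation.
move=> [f [b l]] [f' [b' l']] e e'; apply: val_inj.
have lE : l = cm_beta b' * l' := congr1 snd e.
have [e1 e2 e3] := (cb_composable f f').1 (congr1 fst e).
have [Ui _] := cb_morP f; have [Uj Uk] := cb_morP f'; rewrite e2 in Ui.
rewrite /= /cb_cmp_val /cb_act_mor_val /= e1 e2 e3; apply: cb_mor_eq => //.
rewrite -!mulgA cocycle_act_inv// !mulgA; congr (_ * _).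
by rewrite -!mulgA; congr (_ * _); rewrite act_interchange.
Qed.

Program Definition cb_g2space : g2space X :=
  @G2Space R X cb_category cb_act _ _ _ _.
Next Obligation. by move=> [[i [x k]] u]; apply: val_inj; rewrite /= /cb_act_ob_val /= mulg1. Qed.
Next Obligation.
by move=> [[i [x k]] u] l l'; apply: val_inj; rewrite /= /cb_act_ob_val /= mulgA.
Qed.
Next Obligation.
move=> [[[i j] [x [a k]]] u]; apply: val_inj; apply: cb_mor_eq => /=.
  by rewrite cm_actr1 mulg1.
exact: mulg1.
Qed.
Next Obligation.
move=> [[[i j] [x [a k]]] u] [b l] [b' l']; apply: val_inj; apply: cb_mor_eq => /=.
  by rewrite cm_actMr -cm_actM !mulgA.
by rewrite mulgA.
Qed.

Program Definition cb_proj : functor cb_g2space (disc M) :=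
  @Functor R cb_g2space (disc M) (fun p : cb_ob => (set_val p).2.1)
    (fun f : cb_mor => (set_val f).2.1) _ _ _ _.
Next Obligation. by []. Qed.
Next Obligation. by []. Qed.
Next Obligation. by []. Qed.
Next Obligation. by move=> f f' e e'; have [_ e2 _] := (cb_composable f f').1 e; exact: esym. Qed.

Program Definition cb_over : over_g2space X M :=
  @OverG2Space R X M cb_g2space cb_proj _.
Next Obligation. by []. Qed.

Lemma cb_compm (f f' : mor cb_over) : src f = tgt f' ->
  set_val (compm f f') = cb_cmp_val (set_val f) (set_val f').
Proof. by move=> e; rewrite (compmE e). Qed.

Section SmoothCocycle.
Variables (N : chartedType R).
Context {mN : is_manifold N}.

(** An index that depends continuously on the point is locally constant. *)
Lemma smooth_at_index (T : chartedType R) {mT : is_manifold T} (F : cc_index z -> N -> T)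
    (i : N -> I) y : smooth_at i y -> smooth_at (F (i y)) y ->
  smooth_at (fun w => F (i w) w) y.
Proof.
move=> si; apply: smooth_at_near; have := near_discrete (smooth_at_continuous si).
by apply: filterS => w ->.
Qed.

Lemma smooth_at_cc_g (i j : N -> I) (x : N -> M) y :
  smooth_at i y -> smooth_at j y -> smooth_at x y ->
  U (i y) (x y) -> U (j y) (x y) -> smooth_at (fun w => g (i w) (j w) (x w)) y.
Proof.
move=> si sj sx Ui Uj.
apply: (@smooth_at_index _ _ (fun i w => g i (j w) (x w))) => //.
apply: (@smooth_at_index _ _ (fun j w => g (i y) j (x w))) => //.
by apply: smooth_at_comp sx; apply: cc_g_smooth_at.
Qed.

Lemma smooth_at_cc_h (i j k : N -> I) (x : N -> M) y :
  smooth_at i y -> smooth_at j y -> smooth_at k y -> smooth_at x y ->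
  U (i y) (x y) -> U (j y) (x y) -> U (k y) (x y) ->
  smooth_at (fun w => h (i w) (j w) (k w) (x w)) y.
Proof.
move=> si sj sk sx Ui Uj Uk.
apply: (@smooth_at_index _ _ (fun i w => h i (j w) (k w) (x w))) => //.
apply: (@smooth_at_index _ _ (fun j w => h (i y) j (k w) (x w))) => //.
apply: (@smooth_at_index _ _ (fun k w => h (i y) (j y) k (x w))) => //.
by apply: smooth_at_comp sx; exact: cc_h_smooth_at.
Qed.

Lemma smooth_at_proj1 (A B : chartedType R) {mA : is_manifold A} {mB : is_manifold B}
  (f : N -> A * B) y : smooth_at f y -> smooth_at (fun w => (f w).1) y.
Proof. by apply: smooth_at_comp; exact: smooth_at_fst. Qed.

Lemma smooth_at_proj2 (A B : chartedType R) {mA : is_manifold A} {mB : is_manifold B}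
  (f : N -> A * B) y : smooth_at f y -> smooth_at (fun w => (f w).2) y.
Proof. by apply: smooth_at_comp; exact: smooth_at_snd. Qed.

Lemma smooth_at_val (A : chartedType R) {mA : is_manifold A} (V : set A) (oV : open V)
  (f : N -> set_type V) y : smooth_at f y -> smooth_at (fun w => set_val (f w)) y.
Proof.
have mV : is_manifold (set_type V) by exact: open_is_manifold.
by apply: smooth_at_comp; exact: smooth_at_set_val.
Qed.

End SmoothCocycle.

Lemma open_index_cover (T : chartedType R) {mT : is_manifold T} (i : T -> I) (x : T -> M) :
  continuous i -> continuous x -> open [set y | U (i y) (x y)].
Proof.
move=> ci cx; rewrite openE => y Uy.
have nx : \forall w \near y, U (i y) (x w).
  by apply: cx; apply: open_nbhs_nbhs; split => //; exact: cc_open.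
have ni := near_discrete (ci y).
by apply: filterS2 ni nx => w; rewrite /= => ->.
Qed.

End CocycleBundle.

(** * Smoothness of the 2-space of a cocycle *)

Ltac smooth_tac := repeat first
  [ assumption | exact: smooth_at_id | exact: smooth_at_cst
  | exact: smooth_at_set_val | apply: smooth_at_pair | apply: smooth_at_mulg
  | apply: smooth_at_invg | apply: smooth_at_beta | apply: smooth_at_act
  | apply: smooth_at_cc_g | apply: smooth_at_cc_h
  | apply: smooth_at_proj1 | apply: smooth_at_proj2 ].

Section CocycleBundleSmooth.
Variables (R : realType) (X : crossed_module R) (M : manifoldType R).
Variable z : cocycle X M.

Local Notation I := (discrete_index (cc_index z)).
Local Notation U := (@cc_cover R X M z).
Local Notation g := (@cc_g R X M z).
Local Notation h := (@cc_h R X M z).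

Let cfst (A B : topologicalType) : continuous (@fst A B). Proof. by move=> ?; exact: cvg_fst. Qed.
Let csnd (A B : topologicalType) : continuous (@snd A B). Proof. by move=> ?; exact: cvg_snd. Qed.

Let c11 (A B C : topologicalType) : continuous (fun p : A * B * C => p.1.1).
Proof. by move=> p; exact: (continuous_comp (@cfst _ _ p) (@cfst _ _ _)). Qed.
Let c12 (A B C : topologicalType) : continuous (fun p : A * B * C => p.1.2).
Proof. by move=> p; exact: (continuous_comp (@cfst _ _ p) (@csnd _ _ _)). Qed.
Let c21 (A B C : topologicalType) : continuous (fun p : A * (B * C) => p.2.1).
Proof. by move=> p; exact: (continuous_comp (@csnd _ _ p) (@cfst _ _ _)). Qed.

Lemma open_cb_ob_set : open (@cb_ob_set R X M z).
Proof. exact: (@open_index_cover _ _ _ z (I * (M * cmG X))%type _ fst _ (@cfst _ _) (@c21 _ _ _)). Qed.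

Lemma open_cb_mor_set : open (@cb_mor_set R X M z).
Proof.
apply: openI.
  exact: (@open_index_cover _ _ _ z ((I * I) * (M * (cmH X * cmG X)))%type _ _ _
    (@c11 _ _ _) (@c21 _ _ _)).
exact: (@open_index_cover _ _ _ z ((I * I) * (M * (cmH X * cmG X)))%type _ _ _
  (@c12 _ _ _) (@c21 _ _ _)).
Qed.

#[global] Instance cb_ob_manifold : is_manifold (cb_ob z).
Proof. exact: (open_is_manifold open_cb_ob_set). Qed.
#[global] Instance cb_mor_manifold : is_manifold (cb_mor z).
Proof. exact: (open_is_manifold open_cb_mor_set). Qed.

Lemma smooth_cb_src : smooth (@cb_src R X M z).
Proof.
apply: smooth_at_smooth => f; apply: smooth_at_into_set_type.
change (smooth_at (fun f : cb_mor z => cb_src_val (set_val f)) f).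
by rewrite /cb_src_val; smooth_tac.
Qed.

Lemma smooth_cb_tgt : smooth (@cb_tgt R X M z).
Proof.
apply: smooth_at_smooth => f; apply: smooth_at_into_set_type.
change (smooth_at (fun f : cb_mor z => cb_tgt_val (set_val f)) f).
by have [Ui Uj] := cb_morP f; rewrite /cb_tgt_val; smooth_tac.
Qed.

Lemma smooth_cb_idm : smooth (@cb_idm R X M z).
Proof.
apply: smooth_at_smooth => f; apply: smooth_at_into_set_type.
change (smooth_at (fun f : cb_ob z => cb_idm_val (set_val f)) f).
by rewrite /cb_idm_val; smooth_tac.
Qed.

(** [(((i, j), k), (x, ((b, a), c)))] encodes the composable pair of
    [((i, j), (x, (b, _)))] and [((j, k), (x, (a, c)))], whose missing entry is
    forced. *)
Definition cb_pair_set : set (((I * I) * I) * (M * ((cmH X * cmH X) * cmG X))) :=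
  [set d | U d.1.1.1 d.2.1] `&` [set d | U d.1.1.2 d.2.1] `&` [set d | U d.1.2 d.2.1].

Lemma open_cb_pair_set : open cb_pair_set.
Proof.
pose T := (((I * I) * I) * (M * ((cmH X * cmH X) * cmG X)))%type.
have c111 : continuous (fun f : T => f.1.1.1).
  by move=> f; exact: (continuous_comp (@c11 _ _ _ f) (@cfst _ _ _)).
have c112 : continuous (fun f : T => f.1.1.2).
  by move=> f; exact: (continuous_comp (@c11 _ _ _ f) (@csnd _ _ _)).
apply: openI; first apply: openI.
- exact: (@open_index_cover _ _ _ z T _ _ _ c111 (@c21 _ _ _)).
- exact: (@open_index_cover _ _ _ z T _ _ _ c112 (@c21 _ _ _)).
- exact: (@open_index_cover _ _ _ z T _ _ _ (@c12 _ _ _) (@c21 _ _ _)).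
Qed.

Definition cb_pairs : manifoldType R := open_manifold _ open_cb_pair_set.

Definition cb_fst_val (d : ((I * I) * I) * (M * ((cmH X * cmH X) * cmG X))) :
    (I * I) * (M * (cmH X * cmG X)) :=
  (d.1.1, (d.2.1, (d.2.2.1.1,
     cm_beta d.2.2.1.2 * g d.1.1.2 d.1.2 d.2.1 * d.2.2.2))).
Definition cb_snd_val (d : ((I * I) * I) * (M * ((cmH X * cmH X) * cmG X))) :
    (I * I) * (M * (cmH X * cmG X)) :=
  ((d.1.1.2, d.1.2), (d.2.1, (d.2.2.1.2, d.2.2.2))).

Lemma cb_fst_subproof (d : cb_pairs) : cb_fst_val (set_val d) \in @cb_mor_set R X M z.
Proof. by apply/mem_set; have [[]] := set_valP d. Qed.
Lemma cb_snd_subproof (d : cb_pairs) : cb_snd_val (set_val d) \in @cb_mor_set R X M z.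
Proof. by apply/mem_set; have [[]] := set_valP d. Qed.

Definition cb_fst (d : cb_pairs) : cb_mor z := exist _ (cb_fst_val (set_val d)) (cb_fst_subproof d).
Definition cb_snd (d : cb_pairs) : cb_mor z := exist _ (cb_snd_val (set_val d)) (cb_snd_subproof d).

Lemma cb_pairs_composable d : cb_src (cb_fst d) = cb_tgt (cb_snd d).
Proof. by apply: val_inj. Qed.

Lemma smooth_2space_cb : smooth_2space (cb_category z).
Proof.
split.
  split; [exact: cb_ob_manifold|exact: cb_mor_manifold|exact: smooth_cb_src
    |exact: smooth_cb_tgt|exact: smooth_cb_idm].
exists cb_pairs, cb_fst, cb_snd, cb_pairs_composable; split.
- move=> f f' e; have [e1 e2 e3] := (cb_composable f f').1 e.
  have [Ui Uj] := cb_morP f; have [_ Uk] := cb_morP f'; rewrite -e2 in Uk.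
  have dP : ((set_val f).1, (set_val f').1.2, ((set_val f).2.1,
      ((set_val f).2.2.1, (set_val f').2.2.1, (set_val f').2.2.2))) \in cb_pair_set.
    by apply/mem_set; split; [split|].
  exists (exist (fun x => x \in cb_pair_set) _ dP : cb_pairs); split.
    split; apply: val_inj; rewrite /= /cb_fst_val /cb_snd_val /= ?e1 ?e2 -?e3.
      by rewrite -e2 -!surjective_pairing.
    by rewrite -!surjective_pairing.
  move=> d [pd qd]; apply: val_inj; rewrite /= -pd -qd.
  by case: d pd qd => -[[[i j] k] [x [[a b] c]]] u.
- apply: smooth_at_smooth => d; apply: smooth_at_into_set_type.
  change (smooth_at (fun d : cb_pairs => cb_fst_val (set_val d)) d).
  have [[Ui Uj] Uk] := set_valP d.
  by rewrite /cb_fst_val; smooth_tac.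
- apply: smooth_at_smooth => d; apply: smooth_at_into_set_type.
  change (smooth_at (fun d : cb_pairs => cb_snd_val (set_val d)) d).
  by rewrite /cb_snd_val; smooth_tac.
- move=> N k sp sq; apply: smooth_at_smooth => y; apply: smooth_at_into_set_type.
  have sp' : smooth_at (fun y => set_val (cb_fst (k y))) y.
    apply: (smooth_at_val open_cb_mor_set (f := fun y => cb_fst (k y))).
    exact: smooth_smooth_at.
  have sq' : smooth_at (fun y => set_val (cb_snd (k y))) y.
    apply: (smooth_at_val open_cb_mor_set (f := fun y => cb_snd (k y))).
    exact: smooth_smooth_at.
  have [P PE] : exists P, P = fun y => set_val (cb_fst (k y)) by eexists.
  have [Q QE] : exists Q, Q = fun y => set_val (cb_snd (k y)) by eexists.
  rewrite -PE in sp'; rewrite -QE in sq'.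
  have -> : (fun y => set_val (k y)) = (fun y =>
      ((P y).1, (Q y).1.2, ((P y).2.1, ((P y).2.2.1, (Q y).2.2.1, (Q y).2.2.2)))).
    apply: funext => w; rewrite PE QE /=.
    by case: (k w) => -[[[i j] l] [x [[a b] c]]] u.
  by smooth_tac.
- apply: smooth_at_smooth => d; apply: smooth_at_into_set_type.
  have [[Ui Uj] Uk] := set_valP d.
  change (smooth_at (fun d : cb_pairs =>
    cb_cmp_val (cb_fst_val (set_val d)) (cb_snd_val (set_val d))) d).
  by rewrite /cb_cmp_val /cb_fst_val /cb_snd_val /=; smooth_tac.
Qed.

#[global] Instance smooth_over_cb : smooth_over (cb_over z).
Proof.
split; first split.
- exact: smooth_2space_cb.
- split; apply: smooth_at_smooth => p; apply: smooth_at_into_set_type.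
    change (smooth_at (fun p : cb_ob z * cmG X => cb_act_ob_val (set_val p.1, p.2)) p).
    rewrite /cb_act_ob_val /=.
    have s1 : smooth_at (fun p : cb_ob z * cmG X => set_val p.1) p.
      by apply: smooth_at_val; [exact: open_cb_ob_set|smooth_tac].
    by smooth_tac.
  change (smooth_at (fun p : cb_mor z * (cmH X * cmG X) => cb_act_mor_val (set_val p.1, p.2)) p).
  rewrite /cb_act_mor_val /=.
  have s1 : smooth_at (fun p : cb_mor z * (cmH X * cmG X) => set_val p.1) p.
    by apply: smooth_at_val; [exact: open_cb_mor_set|smooth_tac].
  have [Ui Uj] := cb_morP p.1.
  by smooth_tac.
- split; apply: smooth_at_smooth => p; rewrite /=.
    by apply: smooth_at_proj1; apply: smooth_at_proj2; exact: (@smooth_at_set_val _ _ (@cb_ob_set R X M z)).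
  by apply: smooth_at_proj1; apply: smooth_at_proj2; exact: (@smooth_at_set_val _ _ (@cb_mor_set R X M z)).
Qed.

End CocycleBundleSmooth.

(** * The bundle of a cocycle *)

Lemma iso_left_inverse (R : realType) (C : category R) (f : mor C) :
  (forall f : mor C, exists f', src f' = tgt f /\ compm f' f = idm (src f)) -> iso f.
Proof.
move=> linv; apply/isoP; have [f1 [e1 k1]] := linv f; have [f2 [e2 k2]] := linv f1.
have t1 : src f = tgt f1 by rewrite -(tgt_compm e1) k1 tgt_idm.
have f2f : f2 = f.
  rewrite -[f2](@compm_idr _ _ _ (src f)); last by rewrite e2 t1.
  rewrite -k1 compmA// k2; apply: compm_idl; by rewrite e1.
by exists f1; split => //; rewrite -{1}f2f k2 e1.
Qed.

Section CocycleBundleFrames.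
Variables (R : realType) (X : crossed_module R) (M : manifoldType R).
Variable z : cocycle X M.

Local Notation I := (discrete_index (cc_index z)).
Local Notation U := (@cc_cover R X M z).
Local Notation g := (@cc_g R X M z).
Local Notation h := (@cc_h R X M z).

Lemma cc_open_cover : open_cover U.
Proof. by case: (cocycleP z). Qed.

(** An object over [x], used as default value for sections defined near [x] only. *)
Definition cb_point (x : M) : cb_ob z :=
  let i := cid (cover_at x cc_open_cover) in
  exist (fun p => p \in @cb_ob_set R X M z) (projT1 i, (x, 1)) (mem_set (projT2 i)).

Definition cb_sec (i : cc_index z) (x : M) : cb_ob z :=
  insubd (cb_point x) (i, (x, 1)).

Lemma cb_secE i x : U i x -> set_val (cb_sec i x) = (i, (x, 1)).
Proof. by move=> Ui; apply: insubdK; exact/mem_set. Qed.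

Definition cb_link (i j : cc_index z) (x : M) (a : cmH X) (k : cmG X) : cb_mor z :=
  insubd (cb_idm (cb_point x)) ((i, j), (x, (a, k))).

Lemma cb_linkE i j x a k : U i x -> U j x ->
  set_val (cb_link i j x a k) = ((i, j), (x, (a, k))).
Proof. by move=> Ui Uj; apply: insubdK; exact/mem_set. Qed.

Lemma smooth_at_cb_ob (N : chartedType R) {mN : is_manifold N} (F : N -> cb_ob z)
    (V : set N) (f : N -> I * (M * cmG X)) y :
  open V -> V y -> (forall w, V w -> set_val (F w) = f w) ->
  smooth_at f y -> smooth_at F y.
Proof.
move=> oV Vy Ff sf; apply: smooth_at_into_set_type.
by apply: (smooth_at_open_eq oV Vy _ sf) => w /Ff.
Qed.

Lemma smooth_at_cb_mor (N : chartedType R) {mN : is_manifold N} (F : N -> cb_mor z)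
    (V : set N) (f : N -> (I * I) * (M * (cmH X * cmG X))) y :
  open V -> V y -> (forall w, V w -> set_val (F w) = f w) ->
  smooth_at f y -> smooth_at F y.
Proof.
move=> oV Vy Ff sf; apply: smooth_at_into_set_type.
by apply: (smooth_at_open_eq oV Vy _ sf) => w /Ff.
Qed.

(** The cocycle identity for the indices i, j, i, j. *)
Lemma cc_h_conj i j x : U i x -> U j x -> cm_act (g i j x) (h j i j x) = h i j i x.
Proof.
move=> Ui Uj; have := cc_h_assoc (i := i) (j := j) (k := i) (l := j) Ui Uj Ui Uj.
by rewrite (cc_h_idl Uj Ui) (cc_h_idr Ui Uj) !mul1g => /esym.
Qed.

Lemma cb_iso (f : mor (cb_over z)) : iso f.
Proof.
apply: iso_left_inverse => {}f; have [Ui Uj] := cb_morP f.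
set i := (set_val f).1.1 in Ui *; set j := (set_val f).1.2 in Uj *.
set x := (set_val f).2.1 in Ui Uj *; set a := (set_val f).2.2.1.
pose f' := cb_link j i x (h j i j x * (cm_act (g j i x) a)^-1)
  (cm_beta a * g i j x * (set_val f).2.2.2).
have f'E := cb_linkE (h j i j x * (cm_act (g j i x) a)^-1)
  (cm_beta a * g i j x * (set_val f).2.2.2) Uj Ui.
have e : @src R (cb_over z) f' = tgt f by apply/cb_composable; rewrite f'E.
exists f'; split => //; apply: val_inj.
rewrite [LHS](cb_compm e) f'E /cb_cmp_val /= -/i -/j -/x -/a.
by rewrite mulgVK mulgV.
Qed.

(** Over [U k] every object [(i, (x, l))] is isomorphic to the object
    [(k, (x, g_ki x * l))], and the coordinates of a morphism are those of the
    morphism that it induces between objects of this form. *)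
Definition cb_frame (k : cc_index z) : frame (cb_over z) :=
  @Frame R X M (cb_over z)
    (fun p : cb_ob z => g k (set_val p).1 (set_val p).2.1 * (set_val p).2.2)
    (fun f : cb_mor z => cm_act (g k (set_val f).1.1 (set_val f).2.1) (set_val f).2.2.1 *
       (h k (set_val f).1.1 (set_val f).1.2 (set_val f).2.1)^-1)
    (cb_sec k)
    (fun p : cb_ob z => cb_link (set_val p).1 k (set_val p).2.1
       (h (set_val p).1 k (set_val p).1 (set_val p).2.1)
       (g k (set_val p).1 (set_val p).2.1 * (set_val p).2.2)).

Lemma cb_frame_strict k : strict_frame (U k) (cb_frame k).
Proof.
have oUk : open (U k) by exact: cc_open.
have isoE (p : cb_ob z) : U k (set_val p).2.1 -> set_val (fr_iso (cb_frame k) p) =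
    (((set_val p).1, k), ((set_val p).2.1,
     (h (set_val p).1 k (set_val p).1 (set_val p).2.1,
      g k (set_val p).1 (set_val p).2.1 * (set_val p).2.2))).
  by move=> Uk; have Ui := cb_obP p; exact: cb_linkE.
split; last first.
- move=> p Uk; have Ui := cb_obP p.
  by rewrite /fr_mor /= isoE//= (cc_h_conj Uk Ui) mulgV.
- by move=> x Uk; rewrite /= cb_secE//= cc_g_id// mul1g.
split.
- move=> p Uk; have Ui := cb_obP p.
  have sv : smooth_at (fun p : cb_ob z => set_val p) p by exact: smooth_at_set_val.
  by rewrite /=; smooth_tac.
- move=> f Uk; have [Ui Uj] := cb_morP f.
  have sv : smooth_at (fun p : cb_mor z => set_val p) f by exact: smooth_at_set_val.
  by rewrite /=; smooth_tac.
- move=> x Uk; apply: (smooth_at_cb_ob oUk Uk (f := fun x => (k : I, (x, 1)))).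
    by move=> y Uy; rewrite cb_secE.
  by smooth_tac.
- move=> p Uk; have Ui := cb_obP p.
  apply: (smooth_at_cb_mor (open_over (smooth_over_cb z) oUk) Uk isoE).
  have sv : smooth_at (fun p : cb_ob z => set_val p) p by exact: smooth_at_set_val.
  by smooth_tac.
- by move=> p l Uk; rewrite /= mulgA.
- move=> f [b l] Uk; have [Ui Uj] := cb_morP f; rewrite /= cm_actMr -!mulgA.
  by rewrite -cm_actM cocycle_act_inv.
- move=> f Uk; have [Ui Uj] := cb_morP f; rewrite /= cm_betaM cm_beta_act cm_betaV.
  rewrite -(cc_beta_h Uk Ui Uj) -!mulgA; congr (_ * (_ * _)).
  by rewrite !mulKg.
- move=> p Uk; have Ui := cb_obP p.
  by rewrite /= cm_actr1 mul1g cc_h_idr// invg1.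
- move=> f f' Uk e; have [e1 e2 _] := (cb_composable f f').1 e.
  have [Ui _] := cb_morP f; have [Uj Ul] := cb_morP f'; rewrite e2 in Ui.
  rewrite /fr_mor /= cb_compm// /cb_cmp_val /= e1 e2 !cm_actMr cm_actV -!mulgA.
  congr (_ * _).
  rewrite -invgM -(cc_h_assoc Uk Ui Uj Ul) invgM !mulgA; congr (_ * _).
  have := @cocycle_act_inv _ _ _ z _ _ _ _ 1 (set_val f').2.2.1 Uk Ui Uj.
  by rewrite !mulg1 cm_actM => ->.
- by move=> x Uk; rewrite /proj /= cb_secE.
- move=> p Uk; apply: val_inj; rewrite /= /cb_src_val /cb_act_ob_val isoE//=.
  by rewrite cb_secE//= mul1g.
- move=> p Uk; have Ui := cb_obP p; apply: val_inj; rewrite /= /cb_tgt_val isoE//=.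
  rewrite mulgA (cc_beta_h Ui Uk Ui) cc_g_id// mul1g.
  by rewrite -!surjective_pairing.
- by move=> p Uk; exact: cb_iso.
- move=> f f' Uk sff tff; have [Ui Uj] := cb_morP f.
  move: (congr1 set_val sff) (congr1 set_val tff); rewrite /= /cb_src_val /cb_tgt_val.
  move=> [ej ex ek] [ei _ _]; rewrite -ei -ej -ex => /mulIg/cm_act_inj ea.
  apply: val_inj; rewrite /= [LHS]surjective_pairing [RHS]surjective_pairing.
  rewrite (surjective_pairing (set_val f).1) (surjective_pairing (set_val f').1).
  rewrite (surjective_pairing (set_val f).2) (surjective_pairing (set_val f').2).
  rewrite (surjective_pairing (set_val f).2.2) (surjective_pairing (set_val f').2.2).
  by rewrite ei ej ex ek ea.
Qed.

Lemma cb_principal : principal_2bundle (cb_over z).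
Proof.
have [sg sp] := smooth_over_cb z; split => //.
exists (cc_index z), U; split; first exact: cc_open_cover.
move=> k; have [T _ _ _] := frame_trivialisation (smooth_over_cb z)
  (@cc_open _ _ _ z k) (cb_frame_strict k).
by exists (frame_functor (cb_frame_strict k)), (frame_inverse (cb_frame_strict k)).
Qed.

Definition cocycle_bundle : bundle X M := Bundle cb_principal.

Lemma descends_cocycle_bundle : descends cocycle_bundle z.
Proof.
exists cb_sec, (fun i j x => cb_link i j x 1 1); split.
- by move=> i x; have [tF _ _] := cb_frame_strict i; exact: (fr_sec_smooth tF).
- by move=> i x Ui; rewrite /proj /= cb_secE.
- move=> i j x Ui Uj; apply: (smooth_at_cb_mor (V := U i `&` U j)
    (f := fun x => ((i : I, j : I), (x, (1, 1))))).
  + by apply: openI; exact: cc_open.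
  + by [].
  + by move=> y [Uiy Ujy]; rewrite cb_linkE.
  + by smooth_tac.
- move=> i j x Ui Uj; apply: val_inj; apply: etrans (esym (cb_secE Uj)).
  by rewrite /= /cb_src_val cb_linkE.
- move=> i j x Ui Uj; apply: val_inj; rewrite /= /cb_tgt_val cb_linkE//=.
  by rewrite /cb_act_ob_val /= cb_secE//= cm_beta1 mulg1 !mul1g.
- move=> i j k x Ui Uj Uk.
  set s3 := actM (idm _) _; set s2 := actM _ (1, g j k x); set s1 := cb_link j k _ _ _.
  have s1E : set_val s1 = ((j, k), (x, (1, 1))) by exact: cb_linkE.
  have s2E : set_val s2 = ((i, j), (x, (1, g j k x))).
    transitivity (cb_act_mor_val (set_val (cb_link i j x 1 1), (1, g j k x))) => //.
    by rewrite cb_linkE// /cb_act_mor_val /= cm_actr1 !mul1g.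
  have s3E : set_val s3 = ((i, i), (x, (h i j k x, g i j x * g j k x))).
    transitivity (cb_act_mor_val (cb_idm_val (set_val (cb_sec i x)),
      (h i j k x, g i j x * g j k x))) => //.
    by rewrite cb_secE// /cb_act_mor_val /= cc_g_id// !mul1g cm_act1.
  have e21 : @src _ (cb_over z) s2 = @tgt _ (cb_over z) s1.
    by apply/cb_composable; rewrite s1E s2E /= cm_beta1 mul1g mulg1.
  have c21 := cb_compm e21.
  have e321 : @src _ (cb_over z) s3 = tgt (@compm _ (cb_over z) s2 s1).
    apply/cb_composable; rewrite c21 s1E s2E s3E /cb_cmp_val /= cm_actr1 mul1g.
    rewrite mul1g mulg1 cm_betaV -(cc_beta_h Ui Uj Uk) -!mulgA mulKg.
    by [].
  apply: val_inj; apply: etrans (cb_linkE _ _ Ui Uk) (etrans _ (esym (cb_compm e321))).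
  rewrite c21 s1E s2E s3E.
  rewrite /cb_cmp_val /= cm_actr1 !mul1g cc_g_id// cm_act1 mulgV mul1g.
  by rewrite cc_h_idl// invg1.
Qed.

End CocycleBundleFrames.

(** * Bundle morphisms from descent data *)

Section DescentFunctor.
Variables (R : realType) (X : crossed_module R) (M : manifoldType R).
Variables (z : cocycle X M) (P : bundle X M).
Variables (s : cc_index z -> M -> ob P) (sg : cc_index z -> cc_index z -> M -> mor P).
Hypothesis sP : is_descent s sg.

Local Notation I := (discrete_index (cc_index z)).
Local Notation U := (@cc_cover R X M z).
Local Notation g := (@cc_g R X M z).
Local Notation h := (@cc_h R X M z).

Definition descent_ob (p : cb_ob z) : ob P :=
  actO (s (set_val p).1 (set_val p).2.1) (set_val p).2.2.

(** The morphism for which the tuple [((i, j), (x, (a, k)))] stands, see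
    [cb_ob_set]. *)
Definition descent_mor_val (i j : cc_index z) (x : M) (a : cmH X) (k : cmG X) : mor P :=
  compm (actM (idm (s i x)) (a, g i j x * k)) (actM (sg i j x) (1, k)).

Definition descent_mor (f : cb_mor z) : mor P :=
  descent_mor_val (set_val f).1.1 (set_val f).1.2 (set_val f).2.1
    (set_val f).2.2.1 (set_val f).2.2.2.

Lemma descent_composable i j x a k : U i x -> U j x ->
  src (actM (idm (s i x)) (a, g i j x * k)) = tgt (actM (sg i j x) (1, k)).
Proof.
move=> Ui Uj; rewrite src_actM src_idm tgt_actM (ds_tgt sP Ui Uj) /= cm_beta1 mul1g.
by rewrite actOM.
Qed.

Lemma src_descent_mor f : src (descent_mor f) = descent_ob (cb_src f).
Proof.
have [Ui Uj] := cb_morP f; rewrite src_compm ?descent_composable// src_actM.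
by rewrite (ds_src sP Ui Uj).
Qed.

Lemma tgt_descent_mor f : tgt (descent_mor f) = descent_ob (cb_tgt f).
Proof.
have [Ui Uj] := cb_morP f; rewrite tgt_compm ?descent_composable// tgt_actM.
by rewrite tgt_idm /= mulgA.
Qed.

Lemma proj_descent_ob p : proj (descent_ob p) = (set_val p).2.1.
Proof. by have Ui := cb_obP p; rewrite proj_actO (ds_proj sP Ui). Qed.

Section InFrame.
Variables (W : set M) (t : frame P) (tF : is_frame W t).

Lemma descent_mor_frame (f : cb_mor z) : W (set_val f).2.1 ->
  fr_mor t (descent_mor f) =
  cm_act (fr_ob t (s (set_val f).1.1 (set_val f).2.1)) (set_val f).2.2.1 *
  fr_mor t (sg (set_val f).1.1 (set_val f).1.2 (set_val f).2.1).
Proof.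
move=> Wx; have [Ui Uj] := cb_morP f.
have pi := ds_proj sP Ui; have pj := ds_proj sP Uj; have sij := ds_src sP Ui Uj.
rewrite (fr_mor_compm tF) ?descent_composable// ?src_actM ?sij ?proj_actO ?pj//.
rewrite !(fr_mor_act tF) ?src_idm ?sij ?pj ?pi//=.
by rewrite (fr_mor_idm tF) ?pi// mul1g cm_actr1 mulg1.
Qed.

End InFrame.

(** Any frame around the point suffices; letting [t] be arbitrary keeps the
    choice of one out of the applications. *)
Lemma descent_frame_eq (f f' : mor P) : src f = src f' -> tgt f = tgt f' ->
  (forall W t, is_frame W t -> W (proj (src f)) -> fr_mor t f = fr_mor t f') -> f = f'.
Proof.
move=> sf tf mf; have [J [W [cW [t tP]]]] := exists_strict_frames P.
have [l Wl] := cover_at (proj (src f)) cW; have [lF _ _] := tP l.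
by apply: (fr_faithful lF) => //; exact: mf lF Wl.
Qed.

#[local] Obligation Tactic := idtac.

Program Definition descent_functor : functor (cb_over z) P :=
  @Functor R (cb_over z) P descent_ob descent_mor _ _ _ _.
Next Obligation. exact: src_descent_mor. Qed.
Next Obligation. exact: tgt_descent_mor. Qed.
Next Obligation.
move=> p; have Ui := cb_obP p; apply: descent_frame_eq.
- by rewrite src_descent_mor src_idm; congr descent_ob; exact: (@src_idm _ (cb_over z)).
- by rewrite tgt_descent_mor tgt_idm; congr descent_ob; exact: (@tgt_idm _ (cb_over z)).
- move=> W t tF; rewrite src_descent_mor proj_descent_ob => Wx.
  rewrite (descent_mor_frame tF)//= (descent_frame_id (cocycleP z) sP tF Wx Ui).
  by rewrite cm_actr1 mul1g (fr_mor_idm tF)// proj_descent_ob.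
Qed.
Next Obligation.
move=> f f' e e'; rewrite -(compmE e').
have [e1 e2 e3] := (cb_composable f f').1 e.
have [Ui _] := cb_morP f; have [Uj Uk] := cb_morP f'; rewrite e2 in Ui.
apply: descent_frame_eq.
- rewrite src_compm// !src_descent_mor; congr descent_ob.
  exact: (@src_cmp _ (cb_over z)).
- rewrite tgt_compm// !tgt_descent_mor; congr descent_ob.
  exact: (@tgt_cmp _ (cb_over z)).
- move=> W t tF; rewrite src_descent_mor proj_descent_ob /= => Wx.
  rewrite (fr_mor_compm tF)//; last by rewrite src_descent_mor proj_descent_ob.
  rewrite !(descent_mor_frame tF) ?e2// /cb_cmp_val /= e1 ?e2.
  set x := (set_val f').2.1 in Ui Uj Uk Wx *.
  rewrite (descent_frame_mor (cocycleP z) sP tF Wx Ui Uj Uk) !cm_actMr cm_actV.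
  rewrite -!mulgA mulKg; congr (_ * _).
  rewrite -cm_actM (descent_frame_ob sP tF Wx Ui Uj) cm_actM !mulgA.
  by rewrite cm_act_beta.
Qed.

Lemma smooth_descent_functor : smooth_functor descent_functor.
Proof.
have ss (N : chartedType R) (mN : is_manifold N) (i : N -> I) (x : N -> M) y :
    smooth_at i y -> smooth_at x y -> U (i y) (x y) -> smooth_at (fun w => s (i w) (x w)) y.
  move=> si sx Ui; apply: (smooth_at_index (F := fun i w => s i (x w))) => //.
  by apply: smooth_at_comp sx; exact: (ds_sec_smooth sP).
have ssg (N : chartedType R) (mN : is_manifold N) (i j : N -> I) (x : N -> M) y :
    smooth_at i y -> smooth_at j y -> smooth_at x y -> U (i y) (x y) -> U (j y) (x y) ->
    smooth_at (fun w => sg (i w) (j w) (x w)) y.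
  move=> si sj sx Ui Uj.
  apply: (smooth_at_index (F := fun i w => sg i (j w) (x w))) => //.
  apply: (smooth_at_index (F := fun j w => sg (i y) j (x w))) => //.
  by apply: smooth_at_comp sx; exact: (ds_mor_smooth sP).
split; apply: smooth_at_smooth => p.
  have sv : smooth_at (fun p : cb_ob z => set_val p) p by exact: smooth_at_set_val.
  have Ui := cb_obP p.
  by apply: smooth_at_actO; [apply: ss|]; smooth_tac.
have sv : smooth_at (fun p : cb_mor z => set_val p) p by exact: smooth_at_set_val.
have [Ui Uj] := cb_morP p; apply: smooth_at_compm.
- by apply: nbhs_everywhere => f; have [Vi Vj] := cb_morP f; exact: descent_composable.
- by apply: smooth_at_actM; [apply: smooth_at_idm; apply: ss|]; smooth_tac.
- by apply: smooth_at_actM; [apply: ssg|]; smooth_tac.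
Qed.

Lemma descent_bundle_morphism : @bundle_morphism _ _ _ (cocycle_bundle z) P descent_functor.
Proof.
split; first split.
- exact: smooth_descent_functor.
- move=> p k; rewrite /= /descent_ob /= /cb_act_ob_val /=.
  exact: actOM.
- move=> f [b l]; have [Ui Uj] := cb_morP f; apply: descent_frame_eq.
  + rewrite src_descent_mor [RHS]src_actM src_descent_mor.
    by rewrite -[RHS]actOM.
  + rewrite tgt_descent_mor [RHS]tgt_actM tgt_descent_mor.
    rewrite -[RHS]actOM; congr (actO _ _).
    by rewrite /= cm_betaM cm_beta_act invgM -!mulgA !mulKg.
  + move=> W t tF; rewrite src_descent_mor proj_descent_ob /= => Wx.
    rewrite [RHS](fr_mor_act tF) src_descent_mor ?proj_descent_ob//.
    rewrite !(descent_mor_frame tF)// /cb_act_mor_val /= /descent_ob /=.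
    rewrite (fr_ob_act tF) ?(ds_proj sP Uj)// cm_actMr -!mulgA; congr (_ * _).
    rewrite -cm_actM mulgA (descent_frame_ob sP tF Wx Ui Uj) -mulgA (cm_actM (cm_beta _)).
    by rewrite cm_act_beta.
- split; first by move=> p; exact: proj_descent_ob.
  by move=> f; rewrite /= -over_src src_descent_mor; exact: proj_descent_ob.
Qed.

End DescentFunctor.

(** * Classification *)

Section Classification.
Variables (R : realType) (X : crossed_module R) (M : manifoldType R).
Implicit Types (P Q : bundle X M) (z : cocycle X M).

Lemma descends_bundle_morphism P z : descends P z ->
  exists F : functor (cocycle_bundle z) P, bundle_morphism F.
Proof. by move=> [s [sg sP]]; exists (descent_functor sP); exact: descent_bundle_morphism. Qed.

Lemma cocycle_of_descends P (z : cocycle X M) : cocycle_of P z -> descends P z.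
Proof. by move=> /cocycle_of_framed/framed_cocycle[]. Qed.

Lemma exists_descends P : exists z, descends P z.
Proof.
have [d /cocycle_of_framed/framed_cocycle[dP dd]] := exists_cocycle_of P.
by exists (Cocycle dP).
Qed.

(** On the bundle of [z'], a refinement of [z] and [z'] itself have descent data,
    which can be compared in either order. *)
Lemma cohomologous_sym z z' : cohomologous z z' -> cohomologous z' z.
Proof.
move=> /cohomologous_descends[J [V [p [cV [VU H]]]]].
have D := descends_cocycle_bundle z'.
exact: cohomologous_refiner (descends_cohomologous D (H _ D)).
Qed.

(** For transitivity, refinements of the two outer cocycles descend to the bundle
    of the middle one. *)
Lemma cohomologous_equivalence : equivalence_relation (@cohomologous R X M).
Proof.
split; [|exact: cohomologous_sym|].
- move=> z; have D := descends_cocycle_bundle z; exact: (descends_cohomologous D D).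
- move=> z z' z'' /cohomologous_descends[J [V [p [cV [VU H]]]]].
  move=> /cohomologous_sym/cohomologous_descends[J' [V' [p' [cV' [VU' H']]]]].
  have D := descends_cocycle_bundle z'.
  exact: (cohomologous_refiner (cohomologous_refinel
    (descends_cohomologous (H _ D) (H' _ D)))).
Qed.

Lemma morita_descends P Q z z' : descends P z -> descends Q z' ->
  morita_equivalent P Q <-> cohomologous z z'.
Proof.
have [_ csym ctrans] := cohomologous_equivalence.
move=> Pz Qz'; split.
  move=> [B [[F FP] [F' FP']]]; have [y By] := exists_descends B.
  apply: (ctrans _ y).
    exact: descends_cohomologous Pz (descends_morphism FP By).
  exact: descends_cohomologous (descends_morphism FP' By) Qz'.
move=> /cohomologous_descends[J [V [p [cV [VU H]]]]].
exists (cocycle_bundle (refine cV VU)); split.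
  exact: descends_bundle_morphism (descends_refine cV VU Pz).
exact: descends_bundle_morphism (H _ Qz').
Qed.

Lemma morita_equivalence : equivalence_relation (@morita_equivalent R X M).
Proof.
have [crefl csym ctrans] := cohomologous_equivalence.
split.
- move=> P; have [z Pz] := exists_descends P; exact/(morita_descends Pz Pz).
- move=> P Q; have [z Pz] := exists_descends P; have [y Qy] := exists_descends Q.
  by move=> /(morita_descends Pz Qy)/csym ?; exact/(morita_descends Qy Pz).
- move=> P Q B; have [z Pz] := exists_descends P; have [y Qy] := exists_descends Q.
  have [w Bw] := exists_descends B.
  move=> /(morita_descends Pz Qy) zy /(morita_descends Qy Bw) yw.
  by apply/(morita_descends Pz Bw); exact: ctrans zy yw.
Qed.

End Classification.

Lemma class_eq (T : Type) (E : T -> T -> Prop) (x y : T) :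
  equivalence_relation E -> class E x = class E y <-> E x y.
Proof.
move=> [Er Es Et]; split=> [/(congr1 (fun A : classes E => sval A y))/= -> //|xy].
apply: eq_exist; apply: funext => w; apply: propext.
by split=> H; [exact: (Et _ _ _ (Es _ _ xy) H)|exact: (Et _ _ _ xy H)].
Qed.

Lemma class_repr (T : Type) (E : T -> T -> Prop) (A : classes E) :
  exists x, A = class E x.
Proof. by case: A => A [x AE]; exists x; apply: eq_exist. Qed.

(** A relation that is total on both sides and identifies the two equivalences
    induces a bijection between the sets of classes. *)
Lemma classes_bijection (S T : Type) (E : S -> S -> Prop) (F : T -> T -> Prop)
    (D : S -> T -> Prop) :
  equivalence_relation E -> equivalence_relation F ->
  (forall x, exists y, D x y) -> (forall y, exists x, D x y) ->
  (forall x y x' y', D x y -> D x' y' -> E x x' <-> F y y') ->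
  exists f : classes E -> classes F, bijective f /\
    forall x y, D x y -> f (class E x) = class F y.
Proof.
move=> EE FF Dl Dr DE.
have /choice[f fP] : forall A : classes E, exists B : classes F,
    exists x y, [/\ A = class E x, B = class F y & D x y].
  move=> A; have [x AE] := class_repr A; have [y Dxy] := Dl x.
  by exists (class F y), x, y.
have /choice[f' f'P] : forall B : classes F, exists A : classes E,
    exists x y, [/\ A = class E x, B = class F y & D x y].
  move=> B; have [y BE] := class_repr B; have [x Dxy] := Dr y.
  by exists (class E x), x, y.
exists f; split.
  exists f' => [A|B].
    have [x [y [AE fE Dxy]]] := fP A; have [x' [y' [f'E fE' Dxy']]] := f'P (f A).
    rewrite f'E AE; apply/class_eq => //; apply/(DE _ _ _ _ Dxy' Dxy).
    by apply/class_eq => //; rewrite -fE' fE.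
  have [x [y [AE fE Dxy]]] := f'P B; have [x' [y' [f'E fE' Dxy']]] := fP (f' B).
  rewrite fE' fE; apply/class_eq => //; apply/(DE _ _ _ _ Dxy' Dxy).
  by apply/class_eq => //; rewrite -f'E AE.
move=> x y Dxy; have [x' [y' [xE fE Dxy']]] := fP (class E x).
rewrite fE; apply/class_eq => //; apply/(DE _ _ _ _ Dxy' Dxy).
by apply/class_eq => //; rewrite xE.
Qed.

Theorem theorem2p22 (R : realType) (X : crossed_module R) (M : manifoldType R) :
  [/\ equivalence_relation (@morita_equivalent R X M),
      equivalence_relation (@cohomologous R X M),
      forall P : bundle X M, exists z : cocycle_data X M, cocycle_of P z,
      forall (P : bundle X M) (z : cocycle_data X M),
        cocycle_of P z -> is_cocycle z &
      exists f : classes (@morita_equivalent R X M) ->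
                 classes (@cohomologous R X M),
        bijective f /\
        forall (P : bundle X M) (z : cocycle X M),
          cocycle_of P z ->
          f (class (@morita_equivalent R X M) P) =
          class (@cohomologous R X M) z].
Proof.
split.
- exact: morita_equivalence.
- exact: cohomologous_equivalence.
- exact: exists_cocycle_of.
- by move=> P z /cocycle_of_framed/framed_cocycle[].
have [f [bf fE]] := classes_bijection (D := fun (P : bundle X M) (z : cocycle X M) => descends P z)
  (@morita_equivalence R X M) (@cohomologous_equivalence R X M)
  (@exists_descends R X M)
  (fun z => ex_intro (fun P : bundle X M => descends P z) _ (descends_cocycle_bundle z))
  (fun P z P' z' Pz P'z' => morita_descends Pz P'z').
by exists f; split => // P z /cocycle_of_descends; exact: fE.
Qed.
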